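(* Consider the McKean--Vlasov case $v_t=F*\mu_t-\nabla\log\mu_t$ with $F:\Pi^d\to\mathbb R^d$. Assume: (Assumption 1) there is $L$ such that $\|v_t(y)-v_k(z)\|\le L(|t-k|+\|y-z\|)$ for all $t,k\in[0,T]$, $y,z\in\Pi^d$; (Assumption 2) $\max\{\|\nabla\operatorname{div}v_t(y)\|,\|\nabla v_t(y)\|_{op}\}\le L_v$ for all $y\in\Pi^d$, $t\in[0,T]$, and $\|\nabla\log\mu_0(y)\|\le C_0$ for all $y\in\Pi^d$; (Kernel) $\operatorname{supp}(\kappa)\subset[-R/2,R/2]^d$, $\|\nabla\kappa(y)\|\le C_1|\kappa(y)|$ for all $y\in\Pi^d$, and $0<\theta\le\sqrt{\lambda_1}/\sqrt2$; (Assumption 4) $|\mathcal F[\mu_{t^*}](u)|^2>0$ for all $u\in\mathbb Z^d$. Let $i\in\{1,\dots,d\}$, and suppose $F^i\in H_p$ for some $p\ge0$. Let $0\le s\le p$ and let $\widehat{F^i}$ be the estimator with regularized Fourier transform $\mathcal F[\widehat{F^i}]_s$ with regularization parameter $\alpha>0$ satisfying $\alpha=o(1)$ as $N\to\infty$ and $$\frac1{\alpha N}\vee\frac{\mathbb E\|\hat g^i_{t^*}-g^i_{t^*}\|^2_{L^2}}{\alpha}=o(1)\quad\text{as }N\to\infty\text{ and }h\to0.$$ Then $$\mathbb E\|\widehat{F^i}-F^i\|^2_{L^2(\Pi^d)}=o(1)\quad\text{as }N\to\infty\text{ and }h\to0.$$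
   Context: Torus and flow. Fix $d\ge1$, $R>0$, $T>0$. $\Pi^d=\mathbb R^d/(R\mathbb Z^d)$ is the torus, identified with the cube $[-R/2,R/2]^d$ with periodic boundary conditions; operations on $\Pi^d$ are modulo $R$ and integrals are with respect to Lebesgue measure on the cube. $\|\cdot\|$ is the Euclidean norm, $\|\cdot\|_{op}$ the spectral norm; a superscript $i$ denotes the $i$-th coordinate of a vector-valued function. $v:[0,T]\times\Pi^d\to\mathbb R^d$, $v_t(x)=v(t,x)$, is a velocity field ($R$-periodic in space), and $X_t(x)$ is its flow: $\frac{d}{dt}X_t(x)=v_t(X_t(x))$, $X_0(x)=x$. $\mu_0$ is a probability density on $\Pi^d$ and $\mu_t=(X_t)_\#\mu_0$ is the push-forward density, which solves $\partial_t\mu_t+\operatorname{div}(\mu_tv_t)=0$. It is a standing assumption that $\mu$ is smooth in time and space and that there are $\lambda_1,\lambda_2>0$ with $\lambda_1\le\mu_t\le\lambda_2$ for all $t\in[0,T]$. Convolution: $F*\mu_t(x)=\int_{\Pi^d}F(x-y)\mu_t(y)\,dy$. Data. $M\ge1$, $h=T/M$, $t_j=jh$ for $j=0,\dots,M$. $X_0^1,\dots,X_0^N$ are i.i.d. with density $\mu_0$ and $X_t^k=X_t(X_0^k)$. Put $Y_{j,k}=\frac{X^k_{t_{j+1}}-X^k_{t_j}}{t_{j+1}-t_j}=\frac1h\int_{t_j}^{t_{j+1}}v_s(X_s^k)\,ds\in\mathbb R^d$. $t^*$ is a fixed time which is one of the grid points $t_0,\dots,t_M$ of each discretization considered. Kernel.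 $\kappa:\mathbb R^d\to[0,\infty)$ is bounded, supported in $[-R/2,R/2]^d$, with $\int\kappa=1$, $\int u\kappa(u)\,du=0$, $\int\kappa^2<\infty$. For $\theta\in(0,1)$ (the bandwidth, which may depend on $N$ and $h$), $\kappa_\theta(y)=\theta^{-d}\kappa(y/\theta)$, identified with the function on $\Pi^d$ given by its periodization $\sum_{z\in\mathbb Z^d}\kappa_\theta(x-Rz)$; likewise $\kappa(\frac{x-y}\theta)$ and $\nabla\kappa(\frac{x-y}\theta)$ are evaluated in this periodized sense. Write $\kappa_\theta^{k,j}(x)=\kappa_\theta(x-X^k_{t_j})$ and $Z_\theta(t_j,x)=\sum_{k=1}^N\kappa_\theta^{k,j}(x)$. Noise. $\epsilon_{j,k}$ ($0\le j\le M-1$, $1\le k\le N$) are i.i.d. $N(0,\sigma^2I)$, independent of the particle positions; Gaussian measures are taken in their periodized version on $\Pi^d$, with values represented in the cube. Estimators of $v$ and $\nabla\log\mu$. For $j=0,\dots,M-1$, $\hat v_{t_j}(x)=e_1$ (first canonical basis vector) if $Z_\theta(t_j,x)=0$ and $\hat v_{t_j}(x)=\frac1{Z_\theta(t_j,x)}\sum_{k=1}^N\kappa_\theta^{k,j}(x)(Y_{j,k}+\epsilon_{j,k})$ otherwise; $\hat v_{t_M}=\hat v_{t_{M-1}}$. For $j=0,\dots,M$, $\widehat{\nabla\log\mu_{t_j}}(x)=0$ if $Z_\theta(t_j,x)=0$ and $\widehat{\nabla\log\mu_{t_j}}(x)=\frac1\theta\,\frac{\sum_{k=1}^N\nabla\kappa((x-X^k_{t_j})/\theta)}{\sum_{k=1}^N\kappa((x-X^k_{t_j})/\theta)}$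 otherwise. Set $g_{t^*}=v_{t^*}+\nabla\log\mu_{t^*}$ and $\hat g_{t^*}=\hat v_{t^*}+\widehat{\nabla\log\mu_{t^*}}$. Fourier analysis. For integrable $f$ and a measure or density $\nu$ on $\Pi^d$ and $u\in\mathbb Z^d$: $\mathcal F[f](u)=\int_{\Pi^d}f(x)e^{-2\pi\mathrm i\,u^\top x/R}dx$, $\mathcal F[\nu](u)=\int_{\Pi^d}e^{-2\pi\mathrm i\,u^\top x/R}d\nu(x)$. The empirical Fourier transform is $\hat{\mathcal F}[\mu_{t^*}](u)=\frac1N\sum_{k=1}^Ne^{-2\pi\mathrm i\,u^\top X^k_{t^*}/R}$. Put $\ell_s(u)=(1+\|u\|^2)^{s/2}$ and $H_s=\{f\in L^2(\Pi^d):\|f\|_s^2=\sum_{u\in\mathbb Z^d}\ell_s^2(u)|\mathcal F[f](u)|^2<\infty\}$. Estimator of $F$. For $\alpha>0$ let $A_s=\{u\in\mathbb Z^d:|\hat{\mathcal F}[\mu_{t^*}](u)/\ell_s(u)|^2\ge\alpha\}$ and $$\mathcal F[\widehat{F^i}]_s=\frac{\mathcal F[\hat g^i_{t^*}]\cdot\overline{\hat{\mathcal F}[\mu_{t^*}]}}{|\hat{\mathcal F}[\mu_{t^*}]|^2}\,\mathbf 1_{A_s}$$ (equal to $0$ off $A_s$). $\widehat{F^i}$ is the function in $L^2(\Pi^d)$ whose Fourier transform is $\mathcal F[\widehat{F^i}]_s$. *)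

(* Defs.v *)
From HB Require Import structures.
From mathcomp Require Import all_boot all_order all_algebra.
From mathcomp Require Import complex.
From mathcomp Require Import all_classical all_reals all_analysis.
Set Implicit Arguments. Unset Strict Implicit. Unset Printing Implicit Defensive.
Import Order.TTheory GRing.Theory Num.Theory.
Import numFieldNormedType.Exports.
Local Open Scope classical_set_scope.
Local Open Scope ring_scope.
Import ComplexField.Normc.

Definition rV_display : measure_display.
Proof. exact: default_measure_display. Qed.

(* The sigma-algebra on 'rV[R]_n generated by the coordinates, i.e. the Borel
   sigma-algebra of R^n. *)
Section measurable_rV.
Context {R : realType} (n : nat).
Let coord (i : 'I_n) (x : 'rV[R]_n) : measurableTypeR R := x ord0 i.
Let set0_ : g_sigma_preimage coord set0.
Proof. exact: sigma_algebra0. Qed.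
Let setC_ A : g_sigma_preimage coord A -> g_sigma_preimage coord (~` A).
Proof. exact: sigma_algebraC. Qed.
Let bigcup_ (F : (set 'rV[R]_n)^nat) : (forall i, g_sigma_preimage coord (F i)) ->
  g_sigma_preimage coord (\bigcup_i (F i)).
Proof. exact: sigma_algebra_bigcup. Qed.
HB.instance Definition _ := @isMeasurable.Build
  rV_display
  'rV[R]_n (g_sigma_preimage coord) set0_ setC_ bigcup_.

Lemma measurable_coord (i : 'I_n) :
  measurable_fun [set: 'rV[R]_n] (fun x : 'rV[R]_n => x ord0 i).
Proof.
move=> _ Y mY; rewrite setTI; apply: sub_sigma_algebra => /=.
rewrite -bigcup_seq/=; exists i => /=; first by rewrite mem_index_enum.
by exists Y => //; rewrite setTI.
Qed.
End measurable_rV.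

Lemma measurable_rVP d (T : measurableType d) (R : realType) n
    (f : T -> 'rV[R]_n) :
  (forall i, measurable_fun setT (fun x => f x ord0 i)) ->
  measurable_fun setT f.
Proof.
move=> mf _ A mA; rewrite setTI.
suff : [set A : set 'rV[R]_n | measurable (f @^-1` A)] A by [].
move: A mA; apply: smallest_sub.
  split => /=.
  - by rewrite preimage_set0.
  - by move=> A mA; rewrite setTD preimage_setC; exact: measurableC.
  - by move=> F mF; rewrite preimage_bigcup; exact: bigcup_measurable.
rewrite -bigcup_seq/=; apply: bigcup_sub => i _ A [B mB <-] /=.
by rewrite setTI; have := mf i measurableT B mB; rewrite setTI.
Qed.

Section lebesgue_rV.
Context {R : realType}.
Definition cons_rV n (p : R * 'rV[R]_n) : 'rV[R]_n.+1 :=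
  \row_i (if unlift ord0 i is Some j then p.2 ord0 j else p.1).

Definition uncons_rV n (x : 'rV[R]_n.+1) : R * 'rV[R]_n :=
  (x ord0 ord0, \row_j x ord0 (lift ord0 j)).

Lemma uncons_rVK n : cancel (@cons_rV n) (@uncons_rV n).
Proof.
move=> [a x]; rewrite /uncons_rV /cons_rV mxE unlift_none; congr pair.
by apply/rowP => j; rewrite !mxE liftK.
Qed.

Lemma cons_rVK n : cancel (@uncons_rV n) (@cons_rV n).
Proof.
move=> x; apply/rowP => i; rewrite mxE /=.
by case: unliftP => [j ->|->]; rewrite ?mxE.
Qed.

Lemma measurable_cons_rV n : measurable_fun setT (@cons_rV n).
Proof.
apply: measurable_rVP => i; under eq_fun do rewrite mxE.
case: unlift => [j|]; last exact: measurable_fst.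
exact: measurableT_comp (measurable_coord j) measurable_snd.
Qed.

Lemma measurable_uncons_rV n : measurable_fun setT (@uncons_rV n).
Proof.
apply/measurable_fun_pairP; split; first exact: measurable_coord.
apply: measurable_rVP => i; under eq_fun do rewrite /= mxE.
exact: measurable_coord.
Qed.

Section step.
Context n (m : {sigma_finite_measure set 'rV[R]_n -> \bar R}).

Definition leb_step := pushforward (lebesgue_measure \x m)%E (@cons_rV n).

Let leb_step0 : leb_step set0 = 0%E.
Proof. by rewrite /leb_step /pushforward preimage_set0 measure0. Qed.

Let leb_step_ge0 A : (0 <= leb_step A)%E.
Proof. by rewrite /leb_step /pushforward measure_ge0. Qed.

Let leb_step_additive : semi_sigma_additive leb_step.
Proof.
pose mf := @measurable_cons_rV n.
move=> F mF tF mUF; rewrite /leb_step /pushforward preimage_bigcup.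
apply: measure_semi_sigma_additive.
- by move=> k; rewrite -[X in measurable X]setTI; exact: mf.
- apply/trivIsetP => /= i j _ _ ij; rewrite -preimage_setI.
  by move/trivIsetP : tF => /(_ _ _ _ _ ij) ->//; rewrite preimage_set0.
- by rewrite -preimage_bigcup -[X in measurable X]setTI; exact: mf.
Qed.

HB.instance Definition _ := isMeasure.Build _ _ _ leb_step
  leb_step0 leb_step_ge0 leb_step_additive.

Let leb_step_sigma_finite : sigma_finite setT leb_step.
Proof.
have /sigma_finiteP[F [TF ndF Foo]] := sigma_finiteT (@lebesgue_measure R).
have /sigma_finiteP[G [TG ndG Goo]] := sigma_finiteT m.
exists (fun k => @uncons_rV n @^-1` (F k `*` G k)).
  rewrite -preimage_bigcup; apply/seteqP; split => // x _ /=.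
  have /= [k _ Fk] : (\bigcup_i F i) (uncons_rV x).1 by rewrite -TF.
  have /= [l _ Gl] : (\bigcup_i G i) (uncons_rV x).2 by rewrite -TG.
  exists (maxn k l) => //; split.
  - by move: Fk; exact/subsetPset/ndF/leq_maxl.
  - by move: Gl; exact/subsetPset/ndG/leq_maxr.
move=> k; have [mF Fk] := Foo k; have [mG Gk] := Goo k; split.
  by rewrite -[X in measurable X]setTI; apply: measurable_uncons_rV => //;
     exact: measurableX.
rewrite /leb_step /pushforward.
suff -> : @cons_rV n @^-1` (@uncons_rV n @^-1` (F k `*` G k)) = F k `*` G k.
  by rewrite product_measure1E// lte_mul_pinfty// ge0_fin_numE.
by apply/seteqP; split => x; rewrite /preimage/mkset uncons_rVK.
Qed.

HB.instance Definition _ := Measure_isSigmaFinite.Build _ _ _ leb_step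
  leb_step_sigma_finite.
End step.

(* Lebesgue measure on R^n. *)
Fixpoint leb n : {sigma_finite_measure set 'rV[R]_n -> \bar R} :=
  if n is n'.+1 then leb_step (leb n') else dirac (0 : 'rV[R]_0).
End lebesgue_rV.

Section euclidean.
Context {R : realType}.

(* The library norm on 'rV[R]_n is the sup norm. *)
Definition enorm n (x : 'rV[R]_n) : R := Num.sqrt (\sum_i x ord0 i ^+ 2).

(* Row-vector convention: A acts by x |-> x *m A, as 'J f x does. *)
Definition opnorm n (A : 'M[R]_n) : R :=
  sup [set enorm (x *m A) | x in [set x : 'rV[R]_n | enorm x <= 1]].

Definition grad n (f : 'rV[R]_n -> R) (x : 'rV[R]_n) : 'rV[R]_n :=
  \row_i 'D_(delta_mx ord0 i) f x.

Definition div n (f : 'rV[R]_n -> 'rV[R]_n) (x : 'rV[R]_n) : R := \tr ('J f x).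

Definition iter_derive (V : normedModType R) (us : seq V) (f : V -> R) : V -> R :=
  foldr (fun u (g : V -> R) x => 'D_u g x) f us.

Definition smooth (V : normedModType R) (f : V -> R) : Prop :=
  forall us : seq V, continuous (iter_derive us f) /\
    forall x u, derivable (iter_derive us f) x u.

End euclidean.

(* Functions on the torus R^d / (side Z^d) are side-periodic functions on R^d,
   integrated over the cube. *)
Section torus.
Context {R : realType} (side : R).

Definition cube d : set 'rV[R]_d := [set x | forall i, `|x ord0 i| <= side / 2].

Arguments cube d _ : clear implicits.

Definition open_cube d : set 'rV[R]_d :=
  [set x | forall i, `|x ord0 i| < side / 2].

Arguments open_cube d _ : clear implicits.

Definition lattice d (z : 'rV[int]_d) : 'rV[R]_d := side *: map_mx intr z.

Definition torus_periodic d (V : Type) (f : 'rV[R]_d -> V) : Prop :=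
  forall (z : 'rV[int]_d) x, f (x + lattice z) = f x.

(* The representative of x modulo side Z^d in [-side/2, side/2[^d. *)
Definition wrap d (x : 'rV[R]_d) : 'rV[R]_d :=
  \row_i (x ord0 i - side * (Num.floor (x ord0 i / side + 2^-1))%:~R).

(* The sum is the finitely supported one; it is used below only for functions
   with bounded support. *)
Definition periodize d (V : nmodType) (f : 'rV[R]_d -> V) (x : 'rV[R]_d) : V :=
  \sum_(z \in [set: 'rV[int]_d]) f (x - lattice z).

Definition convolution d (F : 'rV[R]_d -> 'rV[R]_d) (m : 'rV[R]_d -> R)
    (x : 'rV[R]_d) : 'rV[R]_d :=
  \row_i \int[leb d]_(y in cube d) (F (x - y) ord0 i * m y).

Definition sqL2 d (f : 'rV[R]_d -> R[i]) : \bar R :=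
  (\int[leb d]_(x in cube d) (normc (f x) ^+ 2)%:E)%E.

Definition in_L2 d (f : 'rV[R]_d -> R[i]) : Prop :=
  [/\ measurable_fun (cube d) (fun x => complex.Re (f x)),
      measurable_fun (cube d) (fun x => complex.Im (f x)) &
      (sqL2 f < +oo)%E].

Definition cexpi (t : R) : R[i] := Complex (cos t) (sin t).

Definition character d (u : 'rV[int]_d) (x : 'rV[R]_d) : R[i] :=
  cexpi (- (2 * pi * (\sum_i (u ord0 i)%:~R * x ord0 i) / side)).

Definition fourier d (f : 'rV[R]_d -> R[i]) (u : 'rV[int]_d) : R[i] :=
  Complex (\int[leb d]_(x in cube d) complex.Re (f x * character u x))
          (\int[leb d]_(x in cube d) complex.Im (f x * character u x)).

Definition fourierR d (f : 'rV[R]_d -> R) (u : 'rV[int]_d) : R[i] :=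
  fourier (fun x => (f x)%:C%C) u.

Definition ell (s : R) d (u : 'rV[int]_d) : R :=
  (1 + \sum_i ((u ord0 i)%:~R) ^+ 2) `^ (s / 2).

Definition in_H (s : R) d (f : 'rV[R]_d -> R[i]) : Prop :=
  in_L2 f /\
  (\esum_(u in [set: 'rV[int]_d])
     (ell s u ^+ 2 * normc (fourier f u) ^+ 2)%:E < +oo)%E.

End torus.
Arguments cube {R} side d _.
Arguments open_cube {R} side d _.

Section dynamics.
Context {R : realType} (side T : R) (d : nat).
Implicit Types (v X : R -> 'rV[R]_d -> 'rV[R]_d) (mu : R -> 'rV[R]_d -> R).

(* X is the flow lifted to R^d.  At the end points of [0, T] the one-sided
   differential equation follows from continuity. *)
Definition is_flow v X : Prop := forall x,
  [/\ X 0 x = x,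
      {within `[0, T], continuous (X ^~ x)} &
      forall t, t \in `]0, T[ -> is_derive t 1 (X ^~ x) (v t (X t x))].

Definition pushforward_density X mu : Prop := forall t, t \in `[0, T] ->
  measurable_fun setT (X t) /\
  forall A : set 'rV[R]_d, measurable A ->
    (\int[leb d]_(x in cube side d `&` [set x | A (wrap side (X t x))]) (mu 0 x)%:E =
     \int[leb d]_(x in cube side d `&` A) (mu t x)%:E)%E.

(* Smoothness on the closed slab [0, T] x R^d: mu is the restriction of a smooth
   function on R x R^d. *)
Definition smooth_density mu : Prop :=
  exists m : R * 'rV[R]_d -> R, smooth m /\
    forall t x, t \in `[0, T] -> mu t x = m (t, x).

Definition grad_log (m : 'rV[R]_d -> R) : 'rV[R]_d -> 'rV[R]_d :=
  grad (fun x => ln (m x)).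

Definition lipschitz_velocity (L : R) v : Prop := forall t k y z,
  t \in `[0, T] -> k \in `[0, T] ->
  enorm (v t y - v k z) <= L * (`|t - k| + enorm (y - z)).

Definition regular_velocity (Lv : R) v : Prop := forall t y, t \in `[0, T] ->
  [/\ differentiable (v t) y, differentiable (div (v t)) y &
      Num.max (enorm (grad (div (v t)) y)) (opnorm ('J (v t) y)) <= Lv].

Definition mckean_vlasov (F : 'rV[R]_d -> 'rV[R]_d) v mu : Prop :=
  forall t x, t \in `[0, T] ->
    v t x = convolution side F (mu t) x - grad_log (mu t) x.

End dynamics.

Section kernel.
Context {R : realType} (side : R) (d : nat).
Implicit Types (kappa : 'rV[R]_d -> R).

Definition is_kernel kappa : Prop :=
  [/\ [/\ measurable_fun setT kappa, forall y, 0 <= kappa y,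
          exists B, forall y, kappa y <= B &
          forall y, ~ cube side d y -> kappa y = 0],
      \int[leb d]_y kappa y = 1,
      forall i, \int[leb d]_y (y ord0 i * kappa y) = 0 &
      (\int[leb d]_y (kappa y ^+ 2)%:E < +oo)%E].

(* kappa may jump across the boundary of the cube (a differentiable, compactly
   supported kappa with |grad kappa| <= C1 kappa on all of R^d would vanish
   identically), so the gradient is taken inside the cube and is 0 elsewhere. *)
Definition kgrad kappa (y : 'rV[R]_d) : 'rV[R]_d :=
  if `[< open_cube side d y >] then grad kappa y else 0.

Definition kernel_gradient_bound (C1 : R) kappa : Prop :=
  forall y, open_cube side d y ->
    differentiable kappa y /\ enorm (grad kappa y) <= C1 * `|kappa y|.

End kernel.

Section estimators.
Context {R : realType} (side T : R) (d : nat) (kappa : 'rV[R]_d -> R).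
(* pos t k is the (lifted) position of particle k at time t and e j k the noise;
   they are only used for k < N and j < M. *)
Variables (N M : nat) (theta : R).
Variables (pos : R -> nat -> 'rV[R]_d) (e : nat -> nat -> 'rV[R]_d).
Implicit Types (j : nat) (x : 'rV[R]_d).

Definition time_step : R := T / M%:R.
Definition grid_time j : R := j%:R * time_step.

Definition kappa_theta (y : 'rV[R]_d) : R :=
  (theta ^+ d)^-1 * kappa (theta^-1 *: y).

Definition weight j (k : nat) x : R :=
  periodize side kappa_theta (x - pos (grid_time j) k).

Definition Z_theta j x : R := \sum_(k < N) weight j k x.

Definition increment j (k : nat) : 'rV[R]_d :=
  (grid_time j.+1 - grid_time j)^-1 *: (pos (grid_time j.+1) k - pos (grid_time j) k).

Definition e1 : 'rV[R]_d := \row_(i < d) (i == 0%N :> nat)%:R.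

(* At the last grid point j = M the estimator of time M - 1 is used. *)
Definition v_hat j x : 'rV[R]_d :=
  let j := minn j M.-1 in
  if Z_theta j x == 0 then e1 else
  (Z_theta j x)^-1 *: \sum_(k < N) weight j k x *: (increment j k + e j k).

Definition score_hat j x : 'rV[R]_d :=
  if Z_theta j x == 0 then 0 else
  theta^-1 *:
  ((\sum_(k < N) periodize side (fun y => kappa (theta^-1 *: y))
                   (x - pos (grid_time j) k))^-1 *:
    \sum_(k < N) periodize side (fun y => kgrad side kappa (theta^-1 *: y))
                   (x - pos (grid_time j) k)).

Definition g_hat j x : 'rV[R]_d := v_hat j x + score_hat j x.

Definition fourier_emp (t : R) (u : 'rV[int]_d) : R[i] :=
  (N%:R^-1)%:C%C * \sum_(k < N) character side u (pos t k).

Definition A_set (s alpha t : R) : set 'rV[int]_d :=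
  [set u | alpha <= normc (fourier_emp t u / (ell s u)%:C%C) ^+ 2].

Definition fourier_F_hat (s alpha : R) j (i : 'I_d) (u : 'rV[int]_d) : R[i] :=
  if u \in A_set s alpha (grid_time j) then
    fourierR side (fun x => g_hat j x ord0 i) u * conjc (fourier_emp (grid_time j) u)
      / (normc (fourier_emp (grid_time j) u) ^+ 2)%:C%C
  else 0.

(* f is the element of L^2 with Fourier transform fourier_F_hat. *)
Definition is_F_hat (s alpha : R) j (i : 'I_d) (f : 'rV[R]_d -> R[i]) : Prop :=
  in_L2 side f /\ forall u, fourier side f u = fourier_F_hat s alpha j i u.

End estimators.

Section sampling.
Context {R : realType} (side : R) (d : nat).
Context {disp : measure_display} {Omega : measurableType disp}.
Variable P : probability Omega R.

Definition mutually_independent (I : finType) (X : I -> Omega -> 'rV[R]_d) :=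
  forall B : I -> set 'rV[R]_d, (forall i, measurable (B i)) ->
    P (\bigcap_(i in [set: I]) X i @^-1` B i) = (\prod_i P (X i @^-1` B i))%E.

Definition has_density (X : Omega -> 'rV[R]_d) (m : 'rV[R]_d -> R) : Prop :=
  forall A, measurable A ->
    P (X @^-1` A) = (\int[leb d]_(x in cube side d `&` A) (m x)%:E)%E.

(* X has the law of sigma * xi modulo side Z^d, represented in the cube, with xi
   standard Gaussian on R^d. *)
Definition has_periodized_gaussian_law (sigma : R) (X : Omega -> 'rV[R]_d) :=
  forall A, measurable A ->
    P (X @^-1` A) =
    (\int[leb d]_(x in [set x | A (wrap side (sigma *: x))])
       (\prod_(i < d) normal_pdf 0 1 (x ord0 i))%:E)%E.

Definition data_family (N M : nat) (X0 : nat -> Omega -> 'rV[R]_d)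
    (eps : nat -> nat -> Omega -> 'rV[R]_d) (a : 'I_N + 'I_M * 'I_N) :=
  match a with inl k => X0 k | inr (j, k) => eps j k end.

Definition sampling_model (mu0 : 'rV[R]_d -> R) (sigma : R) (N M : nat)
    (X0 : nat -> Omega -> 'rV[R]_d) (eps : nat -> nat -> Omega -> 'rV[R]_d) :=
  [/\ forall k, (k < N)%N -> measurable_fun setT (X0 k) /\ has_density (X0 k) mu0,
      forall j k, (j < M)%N -> (k < N)%N ->
        measurable_fun setT (eps j k) /\
        has_periodized_gaussian_law sigma (eps j k) &
      mutually_independent (@data_family N M X0 eps)].

End sampling.

(* Main.v *)
(* In the McKean-Vlasov case g = v + grad log mu is the convolution F * mu, so
   with phi, psi the exact and the empirical Fourier transform of mu at t^*,
   F^[g] = F^[F] phi, and on A_s (where |psi|^2 >= alpha, as ell_s >= 1)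
     F^[F_hat] - F^[F] = (F^[g_hat - g] - F^[F] (psi - phi)) / psi,
   while off A_s the error is - F^[F].  Fix a finite set S0 of frequencies
   outside of which F^[F] has l^2-mass at most e.  Once alpha is small compared
   with |phi / ell_s|^2 on S0, a frequency of S0 is outside A_s only if
   |phi|^2 <= 4 |psi - phi|^2.  Since E |psi - phi|^2 <= 2 / N by pairwise
   independence, Parseval's identity bounds the risk by a constant multiple of
   E ||g_hat - g||^2 / alpha + 1 / (alpha N) + 1 / N + e.
   Parseval's identity is the density of the trigonometric polynomials in L^2 of
   the cube: their bounded L^2-limits form an algebra closed under bounded
   pointwise limits, hence under taking signs, so they contain the indicators of
   half spaces, then those of all Borel sets.
   The risk need not be an integral of measurable functions of the sample, so it
   is only handled through the definition of the integral by simple functions. *)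
Require Import Defs.
From HB Require Import structures.
From mathcomp Require Import all_boot all_order all_algebra.
From mathcomp Require Import complex.
From mathcomp Require Import all_classical all_reals all_analysis.
From mathcomp Require Import measurable_realfun.
From mathcomp Require Import ring lra zify.
Set Implicit Arguments.
Unset Strict Implicit.
Unset Printing Implicit Defensive.
Import Order.TTheory GRing.Theory Num.Theory.
Import numFieldNormedType.Exports.
Local Open Scope classical_set_scope.
Local Open Scope ring_scope.
Import ComplexField.Normc.


(** * Lebesgue measure on the torus *)

(** No rate of decay of [|phi|] is available, so the order of the choices carries the argument: [S0]
    depends only on [F] and on the target accuracy, and is fixed before alpha and N move. The sum
    over [S0] of [4 |F^[F]|^2 / |phi|^2] may be huge, but it is then a constant, and it is
    multiplied by a variance of order 1/N. The factor 4 comes from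
    [|phi|^2 <= 2 |psi|^2 + 2 |psi - phi|^2] together with [|psi|^2 < |phi|^2 / 4]. No supremum of
    [|psi - phi|] over the frequencies has to be controlled: the variance is bounded at each
    frequency and summed against weights whose total is finite by Bessel's inequality. Integrals are
    those of real functions, so the Fourier analysis is done with sines and cosines and complex
    coefficients are assembled at the end. The price is that a real wave mixes the frequencies u and
    -u, which is handled by symmetrization. Sums over all frequencies are replaced by bounds valid
    for every finite set of them. *)

Section translation1.
Context {R : realType}.
Notation leb1 := (@lebesgue_measure R).

Lemma preimage_addr_itvoc (a b c : R) :
  (fun x : R => x + a) @^-1` `]b, c] = `]b - a, c - a]%classic.
Proof.
apply/seteqP; split => x /=; rewrite !in_itv/=; lra.
Qed.

Lemma measurable_addr (a : R) :
  measurable_fun [set: measurableTypeR R] (fun x : R => x + a : measurableTypeR R).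
Proof. by apply: measurable_realfun.measurable_funD => //; exact: measurable_id. Qed.

(** Lebesgue measure is determined by its values on half-open intervals, whose length a translation
    preserves. *)
Lemma lebesgue_measure_addr (a : R) (A : set R) : measurable A ->
  pushforward leb1 (fun x => x + a : measurableTypeR R) A = leb1 A.
Proof.
move=> mA; apply/esym/lebesgue_measure_unique => //=; first exact: measurable_addr.
move=> _ _ [[b c]] _ <-.
rewrite /pushforward /= preimage_addr_itvoc !lebesgue_measure_itv/= !lte_fin.
by rewrite ltrD2r; case: ifPn => // _; rewrite -!EFinD; congr EFin; lra.
Qed.

Lemma ge0_integral_addr (a : R) (D : set R) (f : R -> \bar R) : measurable D ->
  measurable_fun D f -> (forall x, D x -> 0 <= f x)%E ->
  (\int[leb1]_(x in (fun x : R => x + a)%R @^-1` D) f (x + a)%R = \int[leb1]_(x in D) f x)%E.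
Proof.
move=> mD mf f0.
rewrite -[LHS](@ge0_integral_pushforward _ _ _ _ _ _ (measurable_addr a) leb1 D f)//; last first.
  by move=> x /[!inE]; exact: f0.
apply: eq_measure_integral; first exact: measurable_addr.
move=> ? A mA _; exact: (lebesgue_measure_addr a mA).
Qed.

Lemma periodic_floor (V : Type) (s : R) (f : R -> V) : (forall x, f (x + s) = f x) ->
  forall (z : int) x, f (x + s * z%:~R) = f x.
Proof.
move=> fs.
have fn (n : nat) x : f (x + s * n%:R) = f x.
  elim: n x => [|n ih] x; first by rewrite mulr0 addr0.
  by rewrite -natr1 mulrDr mulr1 addrA fs.
move=> [n|n] x; first exact: fn.
by rewrite -(fn n.+1 (x + _)) NegzE mulrNz mulrN subrK.
Qed.

(** Only the remainder [r] of the shift modulo [s] matters; the part of the shifted interval beyond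
    [s / 2] is moved back by one period. *)
Lemma ge0_integral_periodic (s : R) (f : R -> \bar R) (a : R) : 0 < s ->
  measurable_fun setT f -> (forall x, 0 <= f x)%E -> (forall x, f (x + s)%R = f x) ->
  (\int[leb1]_(x in `[(- (s / 2))%R, (s / 2)%R]) f (x + a)%R =
   \int[leb1]_(x in `[(- (s / 2))%R, (s / 2)%R]) f x)%E.
Proof.
move=> s0 mf f0 fs.
have mfa b : measurable_fun setT (fun x : R => f (x + b)).
  exact: (measurableT_comp mf (measurable_addr b)).
pose k := Num.floor (a / s); pose r := a - s * k%:~R.
have -> : (fun x : R => f (x + a)) = (fun x => f (x + r)).
  apply/funext => x; rewrite /r addrA -mulrN -mulrNz.
  by rewrite (periodic_floor fs).
have [r0 rs] : 0 <= r /\ r < s.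
  have := floor_le_tmp (a / s); have := floorD1_gt (a / s).
  rewrite /r -/k ltr_pdivrMr// intrD ler_pdivlMr//.
  by move=> h1 h2; split; lra.
(* Half-open intervals can be cut into disjoint pieces; the end point removed is a null set. *)
rewrite -(integral_itv_bndo_bndc); last exact: measurable_funTS.
rewrite -[RHS](integral_itv_bndo_bndc); last exact: measurable_funTS.
have shiftI b c e : (\int[leb1]_(x in `[b%R, c%R[) f (x + e)%R = \int[leb1]_(x in `[(b + e)%R, (c + e)%R[) f x)%E.
  rewrite -[RHS](ge0_integral_addr e) //; last exact: measurable_funTS.
  congr integral; apply/seteqP; split => x /=; rewrite !in_itv/=; lra.
rewrite shiftI.
have split3 (b c e : R) : b <= c -> c <= e ->
    (\int[leb1]_(x in `[b, e[) f x = \int[leb1]_(x in `[b, c[) f x + \int[leb1]_(x in `[c, e[) f x)%E.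
  move=> bc ce; rewrite -ge0_integral_setU//.
  - congr integral; apply/seteqP; split => x /=; rewrite !in_itv/=; last by move=> []; lra.
    by move=> /andP[? ?]; have [?|?] := ltP x c; [left|right]; lra.
  - exact: measurable_funTS.
  - by apply/disj_setPS => x [] /=; rewrite !in_itv/=; lra.
rewrite (split3 _ (s/2)); [|lra|lra].
rewrite [RHS](split3 _ (- (s/2) + r)); [|lra|lra].
rewrite addeC; congr (_ + _)%E.
rewrite [X in `[X, _[](_ : _ = - (s/2) + s); last by lra.
rewrite [in LHS](_ : s/2 + r = - (s/2) + r + s); last by lra.
by rewrite -shiftI; apply: eq_integral => x _; rewrite fs.
Qed.

End translation1.

Section cube.
Context {R : realType}.
Notation leb1 := (@lebesgue_measure R).
Implicit Types (s : R) (d n : nat).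

(** [leb n.+1] is the image of a product measure under [cons_rV], so this is a change of variables
    followed by Tonelli's theorem. *)
Lemma ge0_integral_leb_cons n (f : 'rV[R]_n.+1 -> \bar R) :
  measurable_fun setT f -> (forall x, 0 <= f x)%E ->
  (\int[leb n.+1]_x f x = \int[leb1]_a \int[leb n]_x f (cons_rV (a, x)))%E.
Proof.
move=> mf f0.
transitivity (\int[(leb1 \x leb n)%E]_z (f (cons_rV z)))%E.
  have mc : measurable_fun [set: measurableTypeR R * 'rV[R]_n] (@cons_rV R n).
    exact: measurable_cons_rV.
  have := @ge0_integral_pushforward _ _ _ _ _ _ mc
    (leb1 \x leb n)%E setT f measurableT mf (fun _ _ => f0 _).
  rewrite preimage_setT => <-.
  exact: eq_measure_integral.
rewrite (@fubini_tonelli1 _ _ _ _ _ leb1 (leb n) (f \o @cons_rV R n))//.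
  by apply: (measurableT_comp mf); exact: measurable_cons_rV.
by move=> x; exact: f0.
Qed.

Lemma measurable_cube s d : measurable (cube s d).
Proof.
rewrite (_ : cube s d = \bigcap_(i in [set: 'I_d])
    ((fun x : 'rV[R]_d => x ord0 i) @^-1` `[- (s / 2), s / 2]%classic)).
  apply: fin_bigcap_measurable; first exact: finite_finset.
  move=> i _; rewrite -[X in measurable X]setTI.
  by apply: measurable_coord => //; exact: measurable_itv.
apply/seteqP; split => x /=.
  by move=> h i _ /=; rewrite in_itv/= -ler_norml.
by move=> h i; have := h i I; rewrite /= in_itv/= -ler_norml.
Qed.
#[local] Hint Extern 0 (measurable (cube _ _)) => solve [exact: measurable_cube] : core.

Lemma cube_cons s n (a : R) (x : 'rV[R]_n) :
  cube s n.+1 (cons_rV (a, x)) <-> (a \in `[- (s/2), s/2] /\ cube s n x).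
Proof.
rewrite in_itv/= -ler_norml; split=> [h|[ha h] i].
  split; first by have := h ord0; rewrite mxE unlift_none.
  by move=> i; have := h (lift ord0 i); rewrite mxE liftK.
by rewrite mxE; case: unliftP => [j _|_]//=; exact: h.
Qed.

Lemma ge0_integral_cube_cons s n (f : 'rV[R]_n.+1 -> \bar R) :
  measurable_fun setT f -> (forall x, 0 <= f x)%E ->
  (\int[leb n.+1]_(x in cube s n.+1) f x =
   \int[leb1]_(a in `[(- (s / 2))%R, (s / 2)%R]) \int[leb n]_(x in cube s n) f (cons_rV (a, x)))%E.
Proof.
move=> mf f0; rewrite integral_mkcond ge0_integral_leb_cons.
- rewrite [RHS]integral_mkcond; apply: eq_integral => a _.
  rewrite [RHS]patchE; case: ifPn => aI.
    rewrite [RHS]integral_mkcond; apply: eq_integral => x _.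
    rewrite !patchE; case: ifPn => xc.
      rewrite ifT//; move: xc; rewrite !inE => /cube_cons[]//.
    rewrite ifF//; apply/negbTE; apply: contra xc; rewrite !inE => xc.
    by apply/cube_cons; split => //; rewrite inE in aI.
  apply: integral0_eq => x _; rewrite patchE ifF//; apply/negbTE.
  by apply: contra aI; rewrite !inE => /cube_cons[].
- apply/(measurable_restrictT _ _).1 => //; exact: measurable_funTS.
- by move=> x; rewrite patchE; case: ifPn.
Qed.

Lemma integral_itv_cst s (r : \bar R) : 0 < s ->
  (\int[leb1]_(a in `[(- (s / 2))%R, (s / 2)%R]) r = s%:E * r)%E.
Proof.
move=> s0; rewrite integral_cst//= lebesgue_measure_itv/= lte_fin ifT; last by lra.
by rewrite muleC -EFinD; congr (_%:E * _)%E; lra.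
Qed.

Lemma leb_cube s d : 0 < s ->
  (leb d : {measure set _ -> \bar R}) (cube s d) = (s ^+ d)%:E.
Proof.
move=> s0; elim: d => [|n ih].
  by rewrite /= diracE mem_set// => -[].
transitivity (\int[leb n.+1]_(x in cube s n.+1) (cst 1%E x))%E.
  by rewrite integral_cst// mul1e.
rewrite ge0_integral_cube_cons//.
rewrite (eq_integral (fun=> (s ^+ n)%:E)); last first.
  by move=> a _; rewrite -[RHS]mul1e -ih -integral_cst.
by rewrite integral_itv_cst// exprS EFinM.
Qed.

Lemma measurable_add_rV d (a : 'rV[R]_d) : measurable_fun setT (fun x : 'rV[R]_d => x + a).
Proof.
apply: measurable_rVP => i; under eq_fun do rewrite mxE.
apply: (measurableT_comp (measurable_addr (a ord0 i))); exact: measurable_coord.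
Qed.

Lemma measurable_opp_rV d : measurable_fun setT (fun x : 'rV[R]_d => - x).
Proof.
apply: measurable_rVP => i; under eq_fun do rewrite mxE.
by apply: measurableT_comp => //; exact: measurable_coord.
Qed.

Lemma cons_rVD n (p q : R * 'rV[R]_n) :
  cons_rV p + cons_rV q = cons_rV (p.1 + q.1, p.2 + q.2).
Proof.
by apply/rowP => i; rewrite !mxE; case: unlift => [j|]//=; rewrite mxE.
Qed.

Lemma measurable_integral_cube_cons s n (f : 'rV[R]_n.+1 -> \bar R) :
  measurable_fun setT f -> (forall x, 0 <= f x)%E ->
  measurable_fun setT (fun a : R => \int[leb n]_(x in cube s n) f (cons_rV (a, x)))%E.
Proof.
move=> mf f0; under eq_fun do rewrite integral_mkcond.
pose h (z : R * 'rV[R]_n) : \bar R := if `[< cube s n z.2 >] then f (cons_rV z) else 0%E.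
rewrite (_ : (fun _ => _) = fubini_F (leb n) h).
  apply: measurable_fun_fubini_tonelli_F; last by move=> z; rewrite /h; case: ifP.
  rewrite (_ : h = (f \o @cons_rV R n) \_ (setT `*` cube s n)).
    apply/(measurable_restrictT _ _).1; first exact: measurableX.
    apply: measurable_funTS; apply: (measurableT_comp mf); exact: measurable_cons_rV.
  apply/funext => z; rewrite /h patchE /=; congr (if _ then _ else _).
  by apply/asboolP/idP; rewrite inE /=; [split|move=> []].
apply/funext => x0; apply: eq_integral => x _; rewrite /h patchE /=.
by congr (if _ then _ else _); apply/idP/asboolP; rewrite inE.
Qed.

Definition unit_period s d (i : 'I_d) : 'rV[R]_d := s *: delta_mx ord0 i.

(** Induction on the dimension: the inner integral is invariant by the induction hypothesis, and as
    a function of the first coordinate it is periodic, so the one-dimensional case applies to it. *)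
Lemma ge0_integral_torus s d (f : 'rV[R]_d -> \bar R) (a : 'rV[R]_d) : 0 < s ->
  measurable_fun setT f -> (forall x, 0 <= f x)%E ->
  (forall i x, f (x + unit_period s i)%R = f x) ->
  (\int[leb d]_(x in cube s d) f (x + a)%R = \int[leb d]_(x in cube s d) f x)%E.
Proof.
move=> s0; elim: d f a => [|n ih] f a mf f0 fs.
  by apply: eq_integral => x _; congr f; apply/rowP => -[].
have mfa : measurable_fun setT (fun x : 'rV[R]_n.+1 => f (x + a)).
  exact: (measurableT_comp mf (measurable_add_rV a)).
rewrite (ge0_integral_cube_cons s mfa (fun x => f0 _)) (ge0_integral_cube_cons s mf f0).
pose a0 := (uncons_rV a).1; pose a' := (uncons_rV a).2.
have aE : a = cons_rV (a0, a') by rewrite -[LHS]cons_rVK.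
pose G (x0 : R) := (\int[leb n]_(x in cube s n) f (cons_rV (x0, x)))%E.
have mfc x0 : measurable_fun setT (fun x => f (cons_rV (x0, x))).
  apply: (measurableT_comp mf); apply: (measurableT_comp (@measurable_cons_rV R n)).
  exact: pair1_measurable.
transitivity (\int[leb1]_(x0 in `[(- (s / 2))%R, (s / 2)%R]) G (x0 + a0)%R)%E.
  apply: eq_integral => x0 _; rewrite /G.
  rewrite (eq_integral (fun x : 'rV[R]_n => f (cons_rV (x0 + a0, x + a')))); last first.
    by move=> x _; rewrite [in LHS]aE cons_rVD.
  apply: (ih (fun x => f (cons_rV (x0 + a0, x)))) => // i x.
  rewrite -[RHS](fs (lift ord0 i)); congr f.
  apply/rowP => j; rewrite !mxE/=; case: unliftP => [k ->|->] /=; rewrite ?mxE ?eqxx/=.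
    by rewrite (inj_eq (@lift_inj _ ord0)).
  by rewrite mulr0 addr0.
rewrite ge0_integral_periodic//.
- exact: measurable_integral_cube_cons.
- by move=> x; apply: integral_ge0.
- move=> x0; apply: eq_integral => x _; rewrite -[RHS](fs ord0); congr f.
  apply/rowP => j; rewrite !mxE/=; case: unliftP => [k ->|->] /=; rewrite ?mxE ?eqxx/= ?mulr1//.
  by rewrite mulr0 addr0.
Qed.

End cube.
#[global] Hint Extern 0 (measurable (cube _ _)) => solve [exact: measurable_cube] : core.

(** * Trigonometric polynomials and Parseval's identity *)

Section waves.
Context {R : realType} (s : R) (s_gt0 : 0 < s) (d : nat).
Implicit Types (u v : 'rV[int]_d) (x y : 'rV[R]_d).
Notation Q := (cube s d).

(** The phase of the conjugate character. Its cosine and sine replace the complex exponential until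
    [fourierE] puts the two together. *)
Definition wave u x : R := 2 * pi * (\sum_i (u ord0 i)%:~R * x ord0 i) / s.
Definition cosw u x : R := cos (wave u x).
Definition sinw u x : R := sin (wave u x).

Lemma characterE u x : character s u x = Complex (cosw u x) (- sinw u x).
Proof. by rewrite /character /cexpi cosN sinN. Qed.

Lemma waveD u x y : wave u (x + y) = wave u x + wave u y.
Proof.
rewrite /wave -mulrDl -mulrDr -big_split/=; congr (_ * _ / _).
by apply: eq_bigr => i _; rewrite mxE mulrDr.
Qed.

Lemma waveBl u v x : wave (u - v) x = wave u x - wave v x.
Proof.
rewrite /wave -mulrBl -mulrBr -sumrB; congr (_ * _ / _).
by apply: eq_bigr => i _; rewrite !mxE intrD mulrDl mulrNz mulNr.
Qed.

Lemma wave0 x : wave 0 x = 0.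
Proof. by rewrite /wave big1 ?mulr0 ?mul0r// => i _; rewrite mxE mul0r. Qed.

Lemma waveNl u x : wave (- u) x = - wave u x.
Proof. by rewrite -sub0r waveBl wave0 sub0r. Qed.

Lemma waveDl u v x : wave (u + v) x = wave u x + wave v x.
Proof. by rewrite -{1}[v]opprK waveBl waveNl opprK. Qed.

Lemma cosD2pin (a : R) (z : int) : cos (a + 2 * pi * z%:~R) = cos a.
Proof.
apply: (@periodic_floor _ _ (2 * pi) (@cos R)) => x.
by rewrite mulr_natl cosD2pi.
Qed.

Lemma sinD2pin (a : R) (z : int) : sin (a + 2 * pi * z%:~R) = sin a.
Proof.
apply: (@periodic_floor _ _ (2 * pi) (@sin R)) => x.
by rewrite mulr_natl sinD2pi.
Qed.

Lemma wave_lattice u (z : 'rV[int]_d) :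
  wave u (lattice s z) = 2 * pi * (\sum_i u ord0 i * z ord0 i)%:~R.
Proof.
rewrite /wave /lattice rmorph_sum/= -mulrA; congr (_ * _).
rewrite mulr_suml; apply: eq_bigr => i _; rewrite !mxE intrM.
by field; rewrite gt_eqF.
Qed.

Lemma cosw_per u : torus_periodic s (cosw u).
Proof. by move=> z x; rewrite /cosw waveD wave_lattice cosD2pin. Qed.

Lemma sinw_per u : torus_periodic s (sinw u).
Proof. by move=> z x; rewrite /sinw waveD wave_lattice sinD2pin. Qed.

Lemma measurable_wave u D : measurable D -> measurable_fun D (wave u).
Proof.
move=> mD; apply: measurable_funTS.
rewrite /wave; apply: measurable_realfun.measurable_funM => //.
apply: measurable_realfun.measurable_funM => //.
apply: measurable_sum => i; apply: measurable_realfun.measurable_funM => //.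
exact: measurable_coord.
Qed.

Lemma measurable_cosw u D : measurable D -> measurable_fun D (cosw u).
Proof.
move=> mD; apply: measurableT_comp; last exact: measurable_wave.
by apply: continuous_measurable_fun; exact: continuous_cos.
Qed.

Lemma measurable_sinw u D : measurable D -> measurable_fun D (sinw u).
Proof.
move=> mD; apply: measurableT_comp; last exact: measurable_wave.
by apply: continuous_measurable_fun; exact: continuous_sin.
Qed.

Lemma cosw_le1 u x : `|cosw u x| <= 1.
Proof. by rewrite ler_norml cos_geN1 cos_le1. Qed.

Lemma sinw_le1 u x : `|sinw u x| <= 1.
Proof. by rewrite ler_norml sin_geN1 sin_le1. Qed.

Lemma unit_periodE (i : 'I_d) : unit_period s i = lattice s (delta_mx ord0 i).
Proof. by rewrite /unit_period /lattice; congr (_ *: _); rewrite map_delta_mx. Qed.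

Lemma integral_torus (f : 'rV[R]_d -> \bar R) (a : 'rV[R]_d) :
  measurable_fun setT f -> torus_periodic s f ->
  (\int[leb d]_(x in Q) f (x + a)%R = \int[leb d]_(x in Q) f x)%E.
Proof.
move=> mf fs; rewrite integralE [RHS]integralE.
have fp i x : f (x + unit_period s i) = f x by rewrite unit_periodE fs.
congr (_ - _)%E.
- rewrite -(ge0_integral_torus (f := f^\+%E) a s_gt0)//; last by move=> i x; rewrite !funeposE fp.
    by apply: eq_integral => x _; rewrite !funeposE.
  exact: measurable_funepos.
- rewrite -(ge0_integral_torus (f := f^\-%E) a s_gt0)//; last by move=> i x; rewrite !funenegE fp.
    by apply: eq_integral => x _; rewrite !funenegE.
  exact: measurable_funeneg.
Qed.

Lemma Rintegral_torus (f : 'rV[R]_d -> R) (a : 'rV[R]_d) :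
  measurable_fun setT f -> torus_periodic s f ->
  \int[leb d]_(x in Q) f (x + a) = \int[leb d]_(x in Q) f x.
Proof.
move=> mf fs; rewrite /Rintegral; congr fine.
rewrite (@integral_torus (fun x => (f x)%:E))//; first exact/measurable_EFinP.
by move=> z x; rewrite fs.
Qed.

Lemma leb_cube_fin : (leb d Q < +oo)%E.
Proof. by rewrite leb_cube// ltry. Qed.

Lemma integrable_bounded (f : 'rV[R]_d -> R) (B : R) : measurable_fun Q f ->
  (forall x, Q x -> `|f x| <= B) -> (leb d).-integrable Q (EFin \o f).
Proof.
move=> mf fB; apply: measurable_bounded_integrable => //; first exact: leb_cube_fin.
by exists B; split; [rewrite num_real|move=> M BM x Qx; apply: le_trans (fB x Qx) (ltW BM)].
Qed.

(** Half a wavelength along a coordinate in which the frequency does not vanish. This shift reverses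
    the signs of [cosw u] and [sinw u], so their integrals over the torus equal their own
    opposites. *)
Lemma half_wave u : u != 0 -> exists a, forall x, wave u (x + a) = wave u x + pi.
Proof.
move=> u0; have [i ui] : exists i, u ord0 i != 0.
  apply/not_existsP => h; move/negP: u0; apply.
  by apply/eqP/rowP => i; rewrite mxE; have /negP := h i; rewrite negbK => /eqP.
exists ((s / (2 * (u ord0 i)%:~R)) *: delta_mx ord0 i) => x.
rewrite waveD; congr (_ + _); rewrite /wave (bigD1 i)//= big1 ?addr0.
  rewrite !mxE !eqxx mulr1; field.
  by rewrite intr_eq0 ui gt_eqF.
by move=> j ji; rewrite !mxE eqxx (negbTE ji) !mulr0.
Qed.

Lemma integral_cosw u : \int[leb d]_(x in Q) cosw u x = if u == 0 then s ^+ d else 0.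
Proof.
have [->|u0] := eqVneq.
  under eq_Rintegral do rewrite /cosw wave0 cos0.
  by rewrite Rintegral_cst// mul1r leb_cube.
have [a ha] := half_wave u0.
have : \int[leb d]_(x in Q) cosw u x = - \int[leb d]_(x in Q) cosw u x.
  rewrite -[LHS](Rintegral_torus a); [|exact: measurable_cosw|exact: cosw_per].
  rewrite -mulN1r -RintegralZl//.
    by apply: eq_Rintegral => x _; rewrite /cosw ha cosDpi mulN1r.
  by apply: (integrable_bounded (B := 1)) => [|x _]; [exact: measurable_cosw|exact: cosw_le1].
lra.
Qed.

Lemma integral_sinw u : \int[leb d]_(x in Q) sinw u x = 0.
Proof.
have [->|u0] := eqVneq u 0.
  under eq_Rintegral do rewrite /sinw wave0 sin0.
  by rewrite Rintegral_cst// mul0r.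
have [a ha] := half_wave u0.
have : \int[leb d]_(x in Q) sinw u x = - \int[leb d]_(x in Q) sinw u x.
  rewrite -[LHS](Rintegral_torus a); [|exact: measurable_sinw|exact: sinw_per].
  rewrite -mulN1r -RintegralZl//.
    by apply: eq_Rintegral => x _; rewrite /sinw ha sinDpi mulN1r.
  by apply: (integrable_bounded (B := 1)) => [|x _]; [exact: measurable_sinw|exact: sinw_le1].
lra.
Qed.

End waves.

(** * Negligibility of the boundary of the cube *)

Section open_cube.
Context {R : realType} (s : R) (s_gt0 : 0 < s).

Lemma measurable_open_cube d : measurable (open_cube s d).
Proof.
rewrite (_ : open_cube s d = \bigcap_(i in [set: 'I_d])
    ((fun x : 'rV[R]_d => x ord0 i) @^-1` `]- (s / 2), s / 2[%classic)).
  apply: fin_bigcap_measurable; first exact: finite_finset.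
  move=> i _; rewrite -[X in measurable X]setTI.
  by apply: measurable_coord => //; exact: measurable_itv.
apply/seteqP; split => x /=.
  by move=> h i _ /=; rewrite in_itv/= -ltr_norml.
by move=> h i; have := h i I; rewrite /= in_itv/= -ltr_norml.
Qed.

Lemma open_cubeW d (x : 'rV[R]_d) : open_cube s d x -> cube s d x.
Proof. by move=> h i; exact: ltW (h i). Qed.

Lemma open_cube_cons n (a : R) (x : 'rV[R]_n) :
  open_cube s n.+1 (cons_rV (a, x)) <-> (a \in `]- (s/2), (s/2)[) /\ open_cube s n x.
Proof.
rewrite in_itv/= -ltr_norml; split=> [h|[ha h] i].
  split; first by have := h ord0; rewrite mxE unlift_none.
  by move=> i; have := h (lift ord0 i); rewrite mxE liftK.
by rewrite mxE; case: unliftP => [j _|_]//=; exact: h.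
Qed.

Lemma leb_open_cube d :
  (leb d : {measure set _ -> \bar R}) (open_cube s d) = (s ^+ d)%:E.
Proof.
elim: d => [|n ih].
  by rewrite /= diracE mem_set// => -[].
transitivity (\int[leb n.+1]_x (\1_(open_cube s n.+1) x)%:E)%E.
  by rewrite integral_indic ?setIT//; exact: measurable_open_cube.
rewrite ge0_integral_leb_cons; last 2 first.
- by apply/measurable_EFinP; apply: measurable_indic; exact: measurable_open_cube.
- by move=> x; rewrite lee_fin.
transitivity (\int[@lebesgue_measure R]_a ((s ^+ n)%:E * (\1_(`]- (s / 2), (s / 2)[%classic) a)%:E))%E.
  apply: eq_integral => a _; rewrite -ih.
  have := @integral_indic _ _ R (leb n) setT measurableT (open_cube s n) (@measurable_open_cube n).
  rewrite setIT => <-.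
  have [aI|aI] := boolP (a \in `]- (s / 2), (s / 2)[).
    rewrite indicE mem_set// mule1; apply: eq_integral => x _; rewrite !indicE.
    have [ox|ox] := pselect (open_cube s n x).
      by rewrite !mem_set//; apply/open_cube_cons.
    by rewrite !memNset// => /open_cube_cons[].
  rewrite indicE memNset/=; last exact/negP.
  rewrite mule0; apply: integral0_eq => x _; rewrite indicE memNset// => /open_cube_cons[].
  by rewrite (negbTE aI).
rewrite ge0_integralZl//; last 2 first.
- by apply/measurable_EFinP; exact: measurable_indic.
- by rewrite lee_fin exprn_ge0// ltW.
rewrite integral_indic// setIT /= lebesgue_measure_itv/= lte_fin ifT; last by rewrite gtrN// divr_gt0.
by rewrite exprSr -EFinD -EFinM; congr (_ * _)%:E; lra.
Qed.

(** The open and the closed cube have the same finite volume. This is used for half spaces, which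
    trigonometric polynomials single out only inside the open cube. *)
Lemma cube_ae_open d (T : Type) (f g : 'rV[R]_d -> T) : (forall x, open_cube s d x -> f x = g x) ->
  ae_eq (leb d) (cube s d) f g.
Proof.
move=> fg; exists (cube s d `\` open_cube s d); split.
- by apply: measurableD => //; exact: measurable_open_cube.
- rewrite measureD//; last by rewrite leb_cube_fin.
    rewrite (_ : _ `&` _ = open_cube s d).
      by rewrite [X in (X - _)%E](leb_cube d s_gt0) [X in (_ - X)%E]leb_open_cube subee.
    by apply/seteqP; split => [x []//|x ox]; split => //; exact: open_cubeW.
  exact: measurable_open_cube.
- move=> x /= /not_implyP[Qx fgx]; split => // ox; apply: fgx; exact: fg.
Qed.

Lemma eq_integral_open d (f g : 'rV[R]_d -> R) : measurable_fun (cube s d) f ->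
  measurable_fun (cube s d) g -> (forall x, open_cube s d x -> f x = g x) ->
  (\int[leb d]_(x in cube s d) (f x)%:E = \int[leb d]_(x in cube s d) (g x)%:E)%E.
Proof.
move=> mf mg fg; apply: ae_eq_integral => //; [exact/measurable_EFinP|exact/measurable_EFinP|].
by apply: cube_ae_open => x /fg ->.
Qed.

End open_cube.

(** * Square integrable functions *)

Section square_integrable.
Context {R : realType} d0 (T : measurableType d0) (m : {measure set T -> \bar R})
  (D : set T) (mD : measurable D).
Implicit Types f g : T -> R.

Lemma RintegrableD f g : m.-integrable D (EFin \o f) -> m.-integrable D (EFin \o g) ->
  m.-integrable D (EFin \o (fun x => f x + g x)).
Proof.
move=> hf hg; rewrite (_ : _ \o _ = (EFin \o f) \+ (EFin \o g))%E//.
exact: integrableD.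
Qed.

Lemma RintegrableZ (k : R) f : m.-integrable D (EFin \o f) ->
  m.-integrable D (EFin \o (fun x => k * f x)).
Proof. by move=> hf; exact: (integrableZl mD k hf). Qed.

Lemma RintegrableN f : m.-integrable D (EFin \o f) ->
  m.-integrable D (EFin \o (fun x => - f x)).
Proof. by move=> hf; exact: (integrableN hf). Qed.

Lemma RintegrableB f g : m.-integrable D (EFin \o f) -> m.-integrable D (EFin \o g) ->
  m.-integrable D (EFin \o (fun x => f x - g x)).
Proof. by move=> hf hg; apply: RintegrableD => //; exact: RintegrableN. Qed.

Lemma Rintegrable_sum (I : Type) (S : seq I) (F : I -> T -> R) :
  (forall i, m.-integrable D (EFin \o F i)) ->
  m.-integrable D (EFin \o (fun x => \sum_(i <- S) F i x)).
Proof.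
move=> hF; elim: S => [|i S ih].
  rewrite (_ : _ \o _ = cst 0%E); first exact: integrable0.
  by apply/funext => x /=; rewrite big_nil.
rewrite (_ : (fun x => _) = (fun x => F i x + \sum_(j <- S) F j x)).
  exact: RintegrableD.
by apply/funext => x; rewrite big_cons.
Qed.

Lemma Rintegral_sum (I : Type) (S : seq I) (F : I -> T -> R) :
  (forall i, m.-integrable D (EFin \o F i)) ->
  \int[m]_(x in D) (\sum_(i <- S) F i x) = \sum_(i <- S) \int[m]_(x in D) F i x.
Proof.
move=> hF; elim: S => [|i S ih].
  rewrite big_nil; under eq_Rintegral do rewrite big_nil.
  by rewrite Rintegral_cst// mul0r.
rewrite big_cons -ih -RintegralD//; last exact: Rintegrable_sum.
by under eq_Rintegral do rewrite big_cons.
Qed.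

Lemma integral_EFin_Rintegral f : m.-integrable D (EFin \o f) ->
  (\int[m]_(x in D) (f x)%:E = (\int[m]_(x in D) f x)%:E)%E.
Proof. by move=> hf; rewrite /Rintegral fineK//; exact: integrable_fin_num. Qed.

(** Measurability of [f] is recorded separately since it does not follow from that of its square. *)
Definition sqint f := measurable_fun D f /\ m.-integrable D (EFin \o (fun x => f x ^+ 2)).

Lemma sqintP f : measurable_fun D f ->
  (\int[m]_(x in D) (f x ^+ 2)%:E < +oo)%E -> sqint f.
Proof.
move=> mf hf; split => //; apply/integrableP; split.
  by apply/measurable_EFinP; exact: measurable_funX.
apply: le_lt_trans hf; apply: ge0_le_integral => //=.
- by apply/measurable_EFinP; apply: measurableT_comp => //; exact: measurable_funX.
- by apply/measurable_EFinP; exact: measurable_funX.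
- by move=> x _; rewrite lee_fin ger0_norm// sqr_ge0.
Qed.

(** Because [|f g| <= f^2 + g^2]. *)
Lemma sqintM f g : sqint f -> sqint g -> m.-integrable D (EFin \o (fun x => f x * g x)).
Proof.
move=> [mf hf] [mg hg].
apply: (le_integrable mD _ _ (RintegrableD hf hg)).
  by apply/measurable_EFinP; exact: measurable_realfun.measurable_funM.
move=> x _ /=; rewrite lee_fin [leRHS]ger0_norm ?addr_ge0 ?sqr_ge0//.
by rewrite ler_norml; apply/andP; split; nra.
Qed.

Lemma sqintD f g : sqint f -> sqint g -> sqint (fun x => f x + g x).
Proof.
move=> hf hg; have hfg := sqintM hf hg; move: hf hg => [mf hf] [mg hg].
split; first exact: measurable_realfun.measurable_funD.
rewrite (_ : (fun x => _) = fun x => (f x ^+ 2 + 2 * (f x * g x)) + g x ^+ 2).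
  by do 2 apply: RintegrableD => //; exact: RintegrableZ.
by apply/funext => x; ring.
Qed.

Lemma sqintZ (k : R) f : sqint f -> sqint (fun x => k * f x).
Proof.
move=> [mf hf]; split; first exact: measurable_realfun.measurable_funM.
rewrite (_ : (fun x => _) = fun x => k ^+ 2 * (f x ^+ 2)); first exact: RintegrableZ.
by apply/funext => x; rewrite exprMn.
Qed.

Lemma sqintB f g : sqint f -> sqint g -> sqint (fun x => f x - g x).
Proof.
move=> hf hg; rewrite (_ : (fun x => _) = fun x => f x + (-1) * g x).
  by apply: sqintD => //; exact: sqintZ.
by apply/funext => x; rewrite mulN1r.
Qed.

Lemma Rintegral_sqr_ge0 f : 0 <= \int[m]_(x in D) (f x ^+ 2).
Proof. by apply: Rintegral_ge0 => x _; exact: sqr_ge0. Qed.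

Lemma sqint_bounded f (B : R) : (m D < +oo)%E -> measurable_fun D f ->
  (forall x, D x -> `|f x| <= B) -> sqint f.
Proof.
move=> Dfin mf fB; split => //.
apply: measurable_bounded_integrable => //; first exact: measurable_funX.
exists (B ^+ 2); split; first by rewrite num_real.
move=> M BM x Dx; apply: le_trans (ltW BM).
rewrite /= normrX lerXn2r ?nnegrE//; last exact: fB.
by apply: le_trans (fB x Dx).
Qed.

Lemma sqint_integrable f : (m D < +oo)%E -> sqint f -> m.-integrable D (EFin \o f).
Proof.
move=> Dfin hf; rewrite (_ : f = fun x => f x * 1); last first.
  by apply/funext => x; rewrite mulr1.
apply: sqintM => //; apply: (@sqint_bounded (fun=> 1) 1) => // x _.
by rewrite normr1.
Qed.

End square_integrable.

(** * Bessel's inequality and best approximation by trigonometric sums *)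

Section parseval.
Context {R : realType} (s : R) (s_gt0 : 0 < s) (d : nat).
Implicit Types (u v : 'rV[int]_d) (f g : 'rV[R]_d -> R).
Notation Q := (cube s d).
Notation sqint := (sqint (leb d) Q).
Notation cosw := (cosw s).
Notation sinw := (sinw s).

Definition coefA f u := \int[leb d]_(x in Q) (f x * cosw u x).
Definition coefB f u := \int[leb d]_(x in Q) (f x * sinw u x).

Definition trigsum (S : seq 'rV[int]_d) (a b : 'rV[int]_d -> R) (x : 'rV[R]_d) :=
  \sum_(u <- S) (a u * cosw u x + b u * sinw u x).

Lemma sqint_cosw u : sqint (cosw u).
Proof.
apply: (sqint_bounded _ _ _ (B := 1)) => //; first exact: leb_cube_fin.
  exact: measurable_cosw.
by move=> x _; exact: cosw_le1.
Qed.

Lemma sqint_sinw u : sqint (sinw u).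
Proof.
apply: (sqint_bounded _ _ _ (B := 1)) => //; first exact: leb_cube_fin.
  exact: measurable_sinw.
by move=> x _; exact: sinw_le1.
Qed.

Lemma sqint_wave (a b : R) u : sqint (fun x => a * cosw u x + b * sinw u x).
Proof. by apply: sqintD => //; apply: sqintZ => //; [exact: sqint_cosw|exact: sqint_sinw]. Qed.

Lemma sqint_trigsum S a b : sqint (trigsum S a b).
Proof.
rewrite /trigsum; elim: S => [|u S ih].
  apply: (sqint_bounded _ _ _ (B := 0)) => //; first exact: leb_cube_fin.
    by under eq_fun do rewrite big_nil; exact: measurable_cst.
  by move=> x _; rewrite big_nil normr0.
under eq_fun do rewrite big_cons.
by apply: sqintD => //; exact: sqint_wave.
Qed.

(** With [c_u = a u - i b u], the two functions are the real and the imaginary part of the sum of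
    the [c_u] times the exponentials of [i wave u]. Their squares add up to the squared modulus of
    this complex sum, for which distinct frequencies are orthogonal; a single real part would still
    couple u with -u. [G u v] is the real part of the term with coefficient [c_u] times the
    conjugate of [c_v]. *)
Lemma trigsum_norm S a b :
  \int[leb d]_(x in Q) (trigsum S a b x ^+ 2) +
  \int[leb d]_(x in Q) (trigsum S (fun u => - b u) a x ^+ 2) =
  s ^+ d * \sum_(u <- S) \sum_(v <- S) (a u * a v + b u * b v) *+ (u == v).
Proof.
have [_ h1] := sqint_trigsum S a b.
have [_ h2] := sqint_trigsum S (fun u => - b u) a.
rewrite -RintegralD//.
pose G u v x := (a u * a v + b u * b v) * cosw (u - v) x +
  (b u * a v - a u * b v) * sinw (u - v) x.
have hG u v : (leb d).-integrable Q (EFin \o G u v).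
  by apply: sqint_integrable => //; [exact: leb_cube_fin|exact: sqint_wave].
transitivity (\int[leb d]_(x in Q) (\sum_(u <- S) \sum_(v <- S) G u v x)).
  apply: eq_Rintegral => x _; rewrite /trigsum !expr2 !mulr_suml -big_split/=.
  apply: eq_bigr => u _; rewrite !mulr_sumr -big_split/=; apply: eq_bigr => v _.
  by rewrite /G /cosw /sinw waveBl cosB sinB; ring.
rewrite Rintegral_sum//; last by move=> u; exact: Rintegrable_sum.
rewrite mulr_sumr; apply: eq_bigr => u _; rewrite Rintegral_sum//.
rewrite mulr_sumr; apply: eq_bigr => v _; rewrite /G.
rewrite RintegralD//; last 2 first.
- by apply: RintegrableZ => //; apply: sqint_integrable => //; [exact: leb_cube_fin|exact: sqint_cosw].
- by apply: RintegrableZ => //; apply: sqint_integrable => //; [exact: leb_cube_fin|exact: sqint_sinw].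
rewrite !RintegralZl//; last 2 first.
- by apply: sqint_integrable => //; [exact: leb_cube_fin|exact: sqint_sinw].
- by apply: sqint_integrable => //; [exact: leb_cube_fin|exact: sqint_cosw].
rewrite integral_cosw// integral_sinw// mulr0 addr0 subr_eq0.
by case: eqVneq => _; rewrite ?mulr0 ?mulr0n ?mulr0// mulrC.
Qed.

Lemma trigsum_normu S a b : uniq S ->
  \int[leb d]_(x in Q) (trigsum S a b x ^+ 2) +
  \int[leb d]_(x in Q) (trigsum S (fun u => - b u) a x ^+ 2) =
  s ^+ d * \sum_(u <- S) (a u ^+ 2 + b u ^+ 2).
Proof.
move=> uS; rewrite trigsum_norm; congr (_ * _).
rewrite big_seq [RHS]big_seq; apply: eq_bigr => u Su.
rewrite (bigD1_seq u)//= eqxx mulr1n big1 ?addr0 ?expr2//.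
by move=> v; rewrite eq_sym => /negbTE ->.
Qed.

Lemma integral_trigsum f S a b : sqint f ->
  \int[leb d]_(x in Q) (f x * trigsum S a b x) =
  \sum_(u <- S) (a u * coefA f u + b u * coefB f u).
Proof.
move=> hf.
have hc u : (leb d).-integrable Q (EFin \o (fun x => f x * cosw u x)).
  by apply: sqintM => //; exact: sqint_cosw.
have hs u : (leb d).-integrable Q (EFin \o (fun x => f x * sinw u x)).
  by apply: sqintM => //; exact: sqint_sinw.
transitivity (\int[leb d]_(x in Q) (\sum_(u <- S)
    (a u * (f x * cosw u x) + b u * (f x * sinw u x)))).
  apply: eq_Rintegral => x _; rewrite /trigsum mulr_sumr.
  by apply: eq_bigr => u _; ring.
rewrite Rintegral_sum//; last by move=> u; apply: RintegrableD => //; exact: RintegrableZ.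
apply: eq_bigr => u _; rewrite RintegralD//; [|exact: RintegrableZ|exact: RintegrableZ].
by rewrite !RintegralZl.
Qed.

Lemma integral_sqrB f g : sqint f -> sqint g ->
  \int[leb d]_(x in Q) ((f x - g x) ^+ 2) =
  \int[leb d]_(x in Q) (f x ^+ 2) - 2 * \int[leb d]_(x in Q) (f x * g x)
    + \int[leb d]_(x in Q) (g x ^+ 2).
Proof.
move=> hf hg; have hfg : (leb d).-integrable Q (EFin \o (fun x => f x * g x)).
  exact: sqintM.
move: hf hg => [_ hf] [_ hg].
transitivity (\int[leb d]_(x in Q) ((f x ^+ 2 - 2 * (f x * g x)) + g x ^+ 2)).
  by apply: eq_Rintegral => x _; ring.
have h2 : (leb d).-integrable Q (EFin \o (fun x => 2 * (f x * g x))).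
  exact: RintegrableZ.
rewrite RintegralD//; last exact: RintegrableB.
by rewrite RintegralB// RintegralZl.
Qed.

(** The square of [f] minus its partial Fourier sum has a nonnegative integral. As [S] need not be
    symmetric, the squared norm of the partial sum is not known exactly; it is at most [X], the
    square of its companion [trigsum S (- b) a] being nonnegative, and this is enough. *)
Lemma bessel_seq f S : uniq S -> sqint f ->
  \sum_(u <- S) (coefA f u ^+ 2 + coefB f u ^+ 2) <=
  s ^+ d * \int[leb d]_(x in Q) (f x ^+ 2).
Proof.
move=> uS hf; have sd : 0 < s ^+ d by rewrite exprn_gt0.
pose a u := coefA f u / s ^+ d; pose b u := coefB f u / s ^+ d.
have hP := sqint_trigsum S a b.
have h0 := Rintegral_sqr_ge0 (leb d) Q (fun x => f x - trigsum S a b x).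
have h1 := Rintegral_sqr_ge0 (leb d) Q (trigsum S (fun u => - b u) a).
have := trigsum_normu a b uS.
rewrite integral_sqrB// integral_trigsum// in h0 => h2.
have e1 : \sum_(u <- S) (a u * coefA f u + b u * coefB f u) =
    (s ^+ d)^-1 * \sum_(u <- S) (coefA f u ^+ 2 + coefB f u ^+ 2).
  by rewrite mulr_sumr; apply: eq_bigr => u _; rewrite /a /b; field; rewrite gt_eqF.
have e2 : s ^+ d * \sum_(u <- S) (a u ^+ 2 + b u ^+ 2) =
    (s ^+ d)^-1 * \sum_(u <- S) (coefA f u ^+ 2 + coefB f u ^+ 2).
  by rewrite !mulr_sumr; apply: eq_bigr => u _; rewrite /a /b; field; rewrite gt_eqF.
rewrite mulrC -ler_pdivrMr// mulrC; move: h0 h1 h2; rewrite e1 e2.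
set X := _ * \sum_(u <- S) _; set I0 := \int[_]_(x in _) (f x ^+ 2).
set I1 := \int[_]_(x in _) _; set I2 := \int[_]_(x in _) _.
by clearbody X I0 I1 I2; lra.
Qed.

(** A vanishing companion makes the squared norm of the sum exactly [s ^+ d] times that of its
    coefficients. Completing the square at the coefficients [coefA f u / s ^+ d] and
    [coefB f u / s ^+ d] then shows that no choice of [a] and [b] does better than these. *)
Lemma trigsum_approx f S a b : uniq S -> sqint f ->
  (forall x, trigsum S (fun u => - b u) a x = 0) ->
  \int[leb d]_(x in Q) (f x ^+ 2) <= \int[leb d]_(x in Q) ((f x - trigsum S a b x) ^+ 2)
     + (s ^+ d)^-1 * \sum_(u <- S) (coefA f u ^+ 2 + coefB f u ^+ 2).
Proof.
move=> uS hf P0; have sd : 0 < s ^+ d by rewrite exprn_gt0.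
rewrite integral_sqrB//; last exact: sqint_trigsum.
rewrite integral_trigsum//.
have := trigsum_normu a b uS.
under [X in _ + X = _ -> _]eq_Rintegral do rewrite P0 expr0n/=.
rewrite Rintegral_cst// mul0r addr0 => ->.
rewrite mulrC -[X in _ + X]addr0.
suff : 0 <= s ^+ d * \sum_(u <- S) (a u ^+ 2 + b u ^+ 2)
    - 2 * (\sum_(u <- S) (a u * coefA f u + b u * coefB f u))
    + (s ^+ d)^-1 * \sum_(u <- S) (coefA f u ^+ 2 + coefB f u ^+ 2).
  set X := _ * \sum_(u <- S) _; set Y := \sum_(u <- S) _.
  set Z := _^-1 * _; set I0 := \int[_]_(x in _) _.
  by clearbody X Y Z I0; lra.
rewrite !mulr_sumr -sumrB -big_split/=; apply: sumr_ge0 => u _.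
suff -> : s ^+ d * (a u ^+ 2 + b u ^+ 2) - 2 * (a u * coefA f u + b u * coefB f u)
    + (s ^+ d)^-1 * (coefA f u ^+ 2 + coefB f u ^+ 2) =
    s ^+ d * ((a u - (s ^+ d)^-1 * coefA f u) ^+ 2 + (b u - (s ^+ d)^-1 * coefB f u) ^+ 2).
  by rewrite mulr_ge0 ?addr_ge0 ?sqr_ge0// ltW.
by field; rewrite gt_eqF.
Qed.

(** The values [c] and [s'] stay abstract so that one identity between coefficients serves a
    polynomial, at (cos, sin), and its companion, at (sin, -cos). *)
Definition tpoly (l : seq (R * R * 'rV[int]_d)) (c s' : 'rV[int]_d -> R) : R :=
  \sum_(t <- l) (t.1.1 * c t.2 + t.1.2 * s' t.2).

Lemma tpoly_collect l : exists S a b, uniq S /\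
  forall c s', tpoly l c s' = \sum_(u <- S) (a u * c u + b u * s' u).
Proof.
pose S := undup [seq t.2 | t <- l].
exists S, (fun u => \sum_(t <- l) t.1.1 *+ (t.2 == u)),
  (fun u => \sum_(t <- l) t.1.2 *+ (t.2 == u)); split; first exact: undup_uniq.
move=> c s'; rewrite /tpoly.
transitivity (\sum_(t <- l) \sum_(u <- S) (t.1.1 * c u + t.1.2 * s' u) *+ (t.2 == u)).
  rewrite big_seq [RHS]big_seq; apply: eq_bigr => t tl.
  rewrite (bigD1_seq t.2) ?undup_uniq//= ?eqxx ?mulr1n; last first.
    by rewrite mem_undup; apply/mapP; exists t.
  by rewrite big1 ?addr0// => u; rewrite eq_sym => /negbTE ->.
rewrite exchange_big/=; apply: eq_bigr => u _.
rewrite !mulr_suml -big_split/=; apply: eq_bigr => t _.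
by case: eqP; rewrite ?mulr0n ?mul0r ?addr0.
Qed.

Definition trig (P : 'rV[R]_d -> R) :=
  exists l, forall x, P x = tpoly l (fun u => cosw u x) (fun u => sinw u x).

Lemma trig_approx f P : trig P -> sqint f -> exists S, uniq S /\
  \int[leb d]_(x in Q) (f x ^+ 2) <= \int[leb d]_(x in Q) ((f x - P x) ^+ 2)
     + (s ^+ d)^-1 * \sum_(u <- S) (coefA f u ^+ 2 + coefB f u ^+ 2).
Proof.
move=> [l Pl] hf.
(* Each wave is shared equally between u and -u. The polynomial is unchanged, and its companion
   vanishes, as [trigsum_approx] requires. *)
pose l' := [seq (t.1.1 / 2, t.1.2 / 2, t.2) | t <- l] ++
           [seq (t.1.1 / 2, - t.1.2 / 2, - t.2) | t <- l].
have [S [a [b [uS Sab]]]] := tpoly_collect l'.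
have E1 : P = trigsum S a b.
  apply/funext => x.
  transitivity (tpoly l' (fun u => cosw u x) (fun u => sinw u x)); last exact: Sab.
  rewrite Pl /tpoly big_cat /= !big_map -big_split/=.
  apply: eq_bigr => t _; rewrite /cosw /sinw waveNl cosN sinN.
  by field.
exists S; split => //; rewrite E1; apply: trigsum_approx => // x.
transitivity (tpoly l' (fun u => sinw u x) (fun u => - cosw u x)).
  by rewrite Sab; apply: eq_bigr => u _; ring.
rewrite /tpoly big_cat /= !big_map -big_split/= big1// => t _.
by rewrite /cosw /sinw waveNl cosN sinN; field.
Qed.

End parseval.

(** * Closure properties of the L^2-limits of trigonometric polynomials *)

Section trig_approximation.
Context {R : realType} (s : R) (s_gt0 : 0 < s) (d : nat).
Implicit Types (u v : 'rV[int]_d) (f g P : 'rV[R]_d -> R).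
Notation Q := (cube s d).
Notation sqint := (sqint (leb d) Q).
Notation cosw := (cosw s).
Notation sinw := (sinw s).
Notation trig := (@trig R s d).

Let mQ := @measurable_cube R s d.

Lemma eq_trig P P' : P =1 P' -> trig P -> trig P'.
Proof. by move=> PP' [l hl]; exists l => x; rewrite -PP'. Qed.

Lemma trigD P P' : trig P -> trig P' -> trig (fun x => P x + P' x).
Proof.
by move=> [l hl] [l' hl']; exists (l ++ l') => x; rewrite /tpoly big_cat /= hl hl'.
Qed.

Lemma trig_wave (a b : R) u : trig (fun x => a * cosw u x + b * sinw u x).
Proof. by exists [:: (a, b, u)] => x; rewrite /tpoly big_seq1. Qed.

Lemma trig_cst (c : R) : trig (fun=> c).
Proof.
apply: eq_trig (trig_wave c 0 0) => x.
by rewrite /cosw wave0 cos0 mul0r mulr1 addr0.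
Qed.

Lemma trig_sum (I : Type) (S : seq I) (F : I -> 'rV[R]_d -> R) :
  (forall i, trig (F i)) -> trig (fun x => \sum_(i <- S) F i x).
Proof.
move=> hF; elim: S => [|i S ih].
  by apply: eq_trig (trig_cst 0) => x; rewrite big_nil.
by apply: eq_trig (trigD (hF i) ih) => x; rewrite big_cons.
Qed.

(** Product-to-sum formulas: waves at u and u' multiply to waves at u + u' and u - u'. *)
Lemma trigM P P' : trig P -> trig P' -> trig (fun x => P x * P' x).
Proof.
move=> [l hl] [l' hl'].
apply: (@eq_trig (fun x => \sum_(t <- l) \sum_(t' <- l')
    ((t.1.1 * cosw t.2 x + t.1.2 * sinw t.2 x) *
     (t'.1.1 * cosw t'.2 x + t'.1.2 * sinw t'.2 x)))) => [x|].
  rewrite hl hl' /tpoly mulr_suml; apply: eq_bigr => t _.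
  by rewrite mulr_sumr.
apply: trig_sum => t; apply: trig_sum => t'.
move: t t' => [[a b] u] [[a' b'] u'] /=.
apply: eq_trig (trigD (trig_wave ((a * a' - b * b') / 2) ((a * b' + b * a') / 2) (u + u'))
   (trig_wave ((a * a' + b * b') / 2) ((b * a' - a * b') / 2) (u - u'))) => x.
rewrite /cosw /sinw waveDl waveBl cosD sinD cosB sinB.
by field.
Qed.

Lemma sqint_trig P : trig P -> sqint P.
Proof.
move=> [l hl]; rewrite (_ : P = fun x => tpoly l (fun u => cosw u x) (fun u => sinw u x)).
  rewrite /tpoly; elim: l {hl} => [|t l ih].
    apply: (sqint_bounded _ _ _ (B := 0)) => //; first exact: leb_cube_fin.
      by under eq_fun do rewrite big_nil; exact: measurable_cst.
    by move=> x _; rewrite big_nil normr0.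
  under eq_fun do rewrite big_cons.
  by apply: sqintD => //; exact: sqint_wave.
by apply/funext.
Qed.

Lemma trig_bounded P : trig P -> exists C, forall x, `|P x| <= C.
Proof.
move=> [l hl]; exists (\sum_(t <- l) (`|t.1.1| + `|t.1.2|)) => x.
rewrite hl /tpoly; apply: le_trans (ler_norm_sum _ _ _) _.
apply: ler_sum => t _; apply: le_trans (ler_normD _ _) _.
by rewrite !normrM lerD// ler_piMr// ?cosw_le1 ?sinw_le1.
Qed.

(** The L^2-closure of the trigonometric polynomials, shown by [sqint_tapprox] to contain every
    square integrable function. *)
Definition tapprox f := sqint f /\ forall e : R, 0 < e ->
  exists2 P, trig P & \int[leb d]_(x in Q) ((f x - P x) ^+ 2) <= e.

(** A crude substitute for Minkowski's inequality, from [(a + b)^2 <= 2 a^2 + 2 b^2]; it is the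
    source of the fractions [e / 4] below. *)
Lemma Rint_sqrD f g : sqint f -> sqint g ->
  \int[leb d]_(x in Q) ((f x + g x) ^+ 2) <=
  2 * \int[leb d]_(x in Q) (f x ^+ 2) + 2 * \int[leb d]_(x in Q) (g x ^+ 2).
Proof.
move=> hf hg; have [_ hfg] := sqintD mQ hf hg.
move: hf hg => [_ hf] [_ hg].
rewrite -!RintegralZl// -RintegralD//; [|exact: RintegrableZ|exact: RintegrableZ].
apply: le_Rintegral => //; first by apply: RintegrableD => //; exact: RintegrableZ.
by move=> x _; have := sqr_ge0 (f x - g x); nra.
Qed.

Lemma tapprox_trig P : trig P -> tapprox P.
Proof.
move=> hP; split; first exact: sqint_trig.
move=> e e0; exists P => //.
under eq_Rintegral do rewrite subrr expr0n/=.
by rewrite Rintegral_cst// mul0r ltW.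
Qed.

Lemma tapprox_near f : sqint f ->
  (forall e : R, 0 < e -> exists2 g, tapprox g & \int[leb d]_(x in Q) ((f x - g x) ^+ 2) <= e) ->
  tapprox f.
Proof.
move=> hf H; split => // e e0.
have e4 : 0 < e / 4 by rewrite divr_gt0.
have [g [hg Hg] fg] := H _ e4; have [P hP gP] := Hg _ e4; exists P => //.
have := Rint_sqrD (sqintB mQ hf hg)
  (sqintB mQ hg (sqint_trig hP)).
under [X in X <= _ -> _]eq_Rintegral do rewrite addrA subrK.
by move=> h; apply: le_trans h _; lra.
Qed.

Lemma tapproxD f g : tapprox f -> tapprox g -> tapprox (fun x => f x + g x).
Proof.
move=> [hf Hf] [hg Hg]; split; first exact: sqintD.
move=> e e0; have e4 : 0 < e / 4 by rewrite divr_gt0.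
have [P hP fP] := Hf _ e4; have [P' hP' gP'] := Hg _ e4.
exists (fun x => P x + P' x); first exact: trigD.
have := Rint_sqrD (sqintB mQ hf (sqint_trig hP))
  (sqintB mQ hg (sqint_trig hP')).
under [X in X <= _ -> _]eq_Rintegral do rewrite addrACA -opprD.
by move=> h; apply: le_trans h _; lra.
Qed.

Lemma sqintMb f g (B : R) : (forall x, Q x -> `|f x| <= B) -> measurable_fun Q f ->
  sqint g -> sqint (fun x => f x * g x) /\
  \int[leb d]_(x in Q) ((f x * g x) ^+ 2) <= B ^+ 2 * \int[leb d]_(x in Q) (g x ^+ 2).
Proof.
move=> fB mf [mg hg].
have mfg : measurable_fun Q (fun x => f x * g x).
  exact: measurable_realfun.measurable_funM.
have hB : (leb d).-integrable Q (EFin \o (fun x => B ^+ 2 * g x ^+ 2)).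
  exact: RintegrableZ.
have le1 x : Q x -> (f x * g x) ^+ 2 <= B ^+ 2 * g x ^+ 2.
  move=> Qx; rewrite exprMn ler_wpM2r ?sqr_ge0// -[f x ^+ 2]ger0_norm ?sqr_ge0//.
  by rewrite normrX lerXn2r ?nnegrE// (le_trans _ (fB x Qx)).
have hfg : (leb d).-integrable Q (EFin \o (fun x => (f x * g x) ^+ 2)).
  apply: (le_integrable mQ _ _ hB).
    by apply/measurable_EFinP; exact: measurable_funX.
  move=> x Qx /=; rewrite lee_fin !ger0_norm ?sqr_ge0 ?le1//.
  by rewrite mulr_ge0 ?sqr_ge0.
by split; [split|rewrite -RintegralZl//; apply: le_Rintegral].
Qed.

(** The order of the replacements matters, since [g] may be unbounded: [g] is first replaced by a
    polynomial, at a cost controlled by the bound of [f]; that polynomial is itself bounded, so [f]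
    can be replaced next. *)
Lemma tapproxM f g (B : R) : (forall x, Q x -> `|f x| <= B) ->
  tapprox f -> tapprox g -> tapprox (fun x => f x * g x).
Proof.
move=> fB [hf Hf] [hg Hg].
have [hfg _] := sqintMb fB (proj1 hf) hg.
apply: tapprox_near => // e e0.
(* The added 1 makes the division legitimate when [B = 0]. *)
have B1 : 0 < B ^+ 2 + 1 by rewrite ltr_wpDl// sqr_ge0.
have [P' hP' gP'] := Hg (e / (B ^+ 2 + 1)) (divr_gt0 e0 B1).
exists (fun x => f x * P' x); last first.
  have [_ h] := sqintMb fB (proj1 hf) (sqintB mQ hg (sqint_trig hP')).
  under eq_Rintegral do rewrite -mulrBr.
  apply: le_trans h _.
  have : B ^+ 2 * (e / (B ^+ 2 + 1)) <= e.
    by rewrite mulrA ler_pdivrMr//; nra.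
  by apply: le_trans; rewrite ler_wpM2l ?sqr_ge0.
have [C PC] := trig_bounded hP'.
have [hfP _] := sqintMb fB (proj1 hf) (sqint_trig hP').
split => // {e e0 gP'} e e0.
have C1 : 0 < C ^+ 2 + 1 by rewrite ltr_wpDl// sqr_ge0.
have [P hP fP] := Hf (e / (C ^+ 2 + 1)) (divr_gt0 e0 C1).
exists (fun x => P' x * P x); first exact: trigM.
have PCQ x : Q x -> `|P' x| <= C by [].
have [_ h] := sqintMb PCQ (proj1 (sqint_trig hP')) (sqintB mQ hf (sqint_trig hP)).
under eq_Rintegral do rewrite [f _ * _]mulrC -mulrBr.
apply: le_trans h _.
have : C ^+ 2 * (e / (C ^+ 2 + 1)) <= e.
  by rewrite mulrA ler_pdivrMr//; nra.
by apply: le_trans; rewrite ler_wpM2l ?sqr_ge0.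
Qed.

Lemma tapproxZ (k : R) f : tapprox f -> tapprox (fun x => k * f x).
Proof.
move=> hf; apply: (tapproxM (B := `|k|)) => //.
exact/tapprox_trig/trig_cst.
Qed.

(** Dominated convergence for [(f - f_n)^2 <= 4 g^2]. The bound [g] is a function rather than a
    constant so that the lemma also reaches unbounded limits in [tapprox_ge0]. *)
Lemma tapprox_lim (f_ : nat -> 'rV[R]_d -> R) f g :
  (forall n, tapprox (f_ n)) -> sqint g ->
  (forall n x, Q x -> `|f_ n x| <= g x) ->
  (forall x, Q x -> f_ ^~ x @ \oo --> f x) -> tapprox f.
Proof.
move=> hf [mg hg] fg fcvg.
have fgl x : Q x -> `|f x| <= g x.
  move=> Qx; apply: (cvgr_to_le (cvg_norm (fcvg x Qx))).
  by near=> n; exact: fg.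
have mf : measurable_fun Q f.
  by apply: (@measurable_fun_cvg _ _ _ _ f_) => // n; have [[]] := hf n.
have hsf : sqint f.
  split => //; apply: (le_integrable _ _ _ hg) => //.
    by apply/measurable_EFinP; exact: measurable_funX.
  move=> x Qx /=; rewrite lee_fin !ger0_norm ?sqr_ge0//.
  rewrite -[f x ^+ 2]ger0_norm ?sqr_ge0// normrX lerXn2r ?nnegrE ?fgl//.
  exact: le_trans (fgl x Qx).
apply: tapprox_near => // e e0.
pose h n x := ((f x - f_ n x) ^+ 2)%:E.
have D1 n : measurable_fun Q (h n).
  apply/measurable_EFinP; apply: measurable_funX.
  by apply: measurable_realfun.measurable_funB => //; have [[]] := hf n.
have D3 : {ae leb d, forall x, Q x -> h ^~ x @ \oo --> (0%E : \bar R)}.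
  apply: aeW => x Qx; apply: cvg_EFin; first by near=> n.
  rewrite (_ : _ \o _ = fun n => (f x - f_ n x) * (f x - f_ n x)); last first.
    by apply/funext => n; rewrite /= expr2.
  rewrite -[X in _ --> X](mulr0 0); apply: cvgM; rewrite -[X in _ --> X](subrr (f x));
    by apply: cvgB; [exact: cvg_cst|exact: fcvg].
have D4 : (leb d).-integrable Q (EFin \o (fun x => 4 * g x ^+ 2)) by exact: RintegrableZ.
have D5 : {ae leb d, forall x n, Q x -> (`|h n x| <= (4 * g x ^+ 2)%:E)%E}.
  apply: aeW => x n Qx; rewrite /h /= lee_fin ger0_norm ?sqr_ge0//.
  have := fg n x Qx; have := fgl x Qx; rewrite !ler_norml => /andP[? ?] /andP[? ?].
  have -> : 4 * g x ^+ 2 = (2 * g x) ^+ 2 by ring.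
  by rewrite -[leLHS]ger0_norm ?sqr_ge0// normrX lerXn2r ?nnegrE ?ler_norml//; lra.
have [_ _] := dominated_convergence mQ D1 (measurable_cst 0%E) D3 D4 D5.
rewrite integral0 => /fine_cvg/(@cvgr_lt _ _ _ _ _ _) /(_ _ e0) [n _ /(_ n (leqnn n)) /= hn].
by exists (f_ n) => //; apply: ltW.
Unshelve. all: by end_near.
Qed.

Lemma tapprox_eq_open f g : tapprox f -> measurable_fun Q g ->
  (forall x, open_cube s d x -> f x = g x) -> tapprox g.
Proof.
move=> [[mf hf] Hf] mg fg.
split.
  apply: sqintP => //; rewrite -(@eq_integral_open _ _ s_gt0 _ (fun x => f x ^+ 2)).
  - by case/integrableP : hf => _; under eq_integral do rewrite /= ger0_norm ?sqr_ge0//.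
  - exact: measurable_funX.
  - exact: measurable_funX.
  - by move=> x /fg ->.
move=> e e0; have [P hP fP] := Hf e e0; exists P => //.
have [mP _] := sqint_trig hP.
rewrite /Rintegral -(@eq_integral_open _ _ s_gt0 _ (fun x => (f x - P x) ^+ 2))//.
- by apply: measurable_funX; exact: measurable_realfun.measurable_funB.
- by apply: measurable_funX; exact: measurable_realfun.measurable_funB.
- by move=> x /fg ->.
Qed.

(* A polynomial whose iterates converge to the sign on [-1, 1]. *)
Definition sgn_step (h : R) := (3 * h - h ^+ 3) / 2.

Lemma sgn_step_le1 h : `|h| <= 1 -> `|sgn_step h| <= 1.
Proof.
rewrite !ler_norml /sgn_step => /andP[h1 h2]; apply/andP; split.
  have : 0 <= (h + 1) ^+ 2 * (2 - h) by rewrite mulr_ge0 ?sqr_ge0//; lra.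
  by move=> ?; nra.
have : 0 <= (1 - h) ^+ 2 * (2 + h) by rewrite mulr_ge0 ?sqr_ge0//; lra.
by move=> ?; nra.
Qed.

Lemma iter_sgn_step_le1 n h : `|h| <= 1 -> `|iter n sgn_step h| <= 1.
Proof. by move=> h1; elim: n => //= n; exact: sgn_step_le1. Qed.

Lemma iter_sgn_stepN n h : iter n sgn_step (- h) = - iter n sgn_step h.
Proof. by elim: n => //= n ->; rewrite /sgn_step; field. Qed.

(** The value 1 is a double fixed point: [1 - sgn_step t = (1 - t)^2 (2 + t) / 2]. The iterates
    increase, hence stay above [h], and there the distance to 1 shrinks at each step by a factor at
    most [1 - h / 2]. *)
Lemma iter_sgn_step_bound n h : 0 < h <= 1 ->
  h <= iter n sgn_step h <= 1 /\ 1 - iter n sgn_step h <= (1 - h / 2) ^+ n.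
Proof.
move=> /andP[h0 h1]; elim: n => [|n [/andP[i1 i2] i3]] /=.
  by rewrite expr0; split; lra.
move: (iter n sgn_step h) i1 i2 i3 => t i1 i2 i3.
have E : 1 - sgn_step t = (1 - t) * ((1 - t) * (2 + t) / 2) by rewrite /sgn_step; field.
have t0 : 0 <= 1 - t by lra.
have c1 : 0 <= (1 - t) * (2 + t) / 2 by nra.
have c2 : (1 - t) * (2 + t) / 2 <= 1 - h / 2 by nra.
have c3 : 1 - h / 2 <= 1 by lra.
split; last first.
  by rewrite E exprSr; apply: ler_pM.
apply/andP; split; last by have := mulr_ge0 t0 c1; rewrite -E subr_ge0.
have : (1 - t) * ((1 - t) * (2 + t) / 2) <= 1 - t by rewrite ler_piMr//; lra.
by rewrite -E; lra.
Qed.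

Lemma iter_sgn_step_cvg h : `|h| <= 1 -> (fun n => iter n sgn_step h) @ \oo --> Num.sg h.
Proof.
have H k : 0 < k <= 1 -> (fun n => iter n sgn_step k) @ \oo --> (1 : R).
  move=> k01; have B n := iter_sgn_step_bound n k01.
  have c0 : (fun n => (1 - k / 2) ^+ n) @ \oo --> (0 : R).
    by apply: cvg_expr; rewrite ger0_norm; lra.
  have c1 : (fun n => 1 - (1 - k / 2) ^+ n) @ \oo --> (1 : R).
    by rewrite -[X in _ --> X]subr0; apply: cvgB => //; exact: cvg_cst.
  apply: (squeeze_cvgr _ c1 (cvg_cst (1 : R))).
  by near=> n; have [/andP[? ?] ?] := B n; apply/andP; split; lra.
move=> h1; have [h0|h0|->] := ltgtP h 0.
- rewrite ltr0_sg// -[h]opprK; under eq_fun do rewrite iter_sgn_stepN.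
  by apply: cvgN; apply: H; move: h1; rewrite ler_norml; lra.
- by rewrite gtr0_sg//; apply: H; move: h1; rewrite ler_norml; lra.
- rewrite sgr0; apply: cvg_near_cst; near=> n; elim: (n) => //= k ->.
  by rewrite /sgn_step; field.
Unshelve. all: by end_near.
Qed.

Lemma tapprox_sg f : (forall x, Q x -> `|f x| <= 1) -> tapprox f ->
  tapprox (fun x => Num.sg (f x)).
Proof.
move=> f1 hf; apply: (@tapprox_lim (fun n x => iter n sgn_step (f x)) _ (fun=> 1)).
- elim=> //= n ih; set g := fun x => iter n sgn_step (f x) in ih *.
  have g1 x : Q x -> `|g x| <= 1 by move=> Qx; apply: iter_sgn_step_le1; exact: f1.
  rewrite (_ : (fun x => _) = fun x => 3 / 2 * g x + (- 1 / 2) * (g x * (g x * g x))); last first.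
    by apply/funext => x; rewrite /sgn_step -/(g x); field.
  apply: tapproxD; apply: tapproxZ => //.
  by do 2 apply: (tapproxM g1 ih) => //.
- apply: (sqint_bounded _ _ _ (B := 1)) => //; first exact: leb_cube_fin.
  by move=> x _; rewrite normr1.
- by move=> n x Qx; apply: iter_sgn_step_le1; exact: f1.
- by move=> x Qx; apply: iter_sgn_step_cvg; exact: f1.
Qed.

(** For a sign [g], the indicator of [g = 1] is [(g + g^2) / 2]; dividing by [C] brings [f] into
    [-1, 1] without changing its sign. *)
Lemma tapprox_indic_gt0 f (B : R) : (forall x, Q x -> `|f x| <= B) -> tapprox f ->
  tapprox (\1_[set x | 0 < f x]).
Proof.
move=> fB hf; pose C := `|B| + 1.
have C0 : 0 < C by rewrite /C ltr_wpDl.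
pose g x := Num.sg (C^-1 * f x).
have hg : tapprox g.
  apply: tapprox_sg; last exact: tapproxZ.
  move=> x Qx; rewrite normrM gtr0_norm ?invr_gt0// mulrC ler_pdivrMr// mul1r.
  by rewrite (le_trans (fB x Qx))// (le_trans (ler_norm _))// /C lerDl.
have g1 x : Q x -> `|g x| <= 1 by move=> _; rewrite normr_sg lern1 leq_b1.
rewrite (_ : \1__ = fun x => 2^-1 * (g x + g x * g x)).
  by apply: tapproxZ; apply: tapproxD => //; exact: (tapproxM g1).
apply/funext => x; rewrite indicE /g sgrM gtr0_sg ?invr_gt0// mul1r.
have [fx|fx|fx] := ltgtP (f x) 0.
- by rewrite ltr0_sg// memNset /=; [field|rewrite ltNge ltW].
- by rewrite gtr0_sg// mem_set//=; field.
- by rewrite memNset /= fx ?ltxx//= sgr0; field.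
Qed.

End trig_approximation.

(** * Density of the trigonometric polynomials in L^2 of the cube *)

Section square_integrable_approximation.
Context {R : realType} (s : R) (s_gt0 : 0 < s) (d : nat).
Implicit Types (u v : 'rV[int]_d) (f g P : 'rV[R]_d -> R) (A : set 'rV[R]_d).
Notation Q := (cube s d).
Notation sqint := (sqint (leb d) Q).
Notation cosw := (cosw s).
Notation sinw := (sinw s).
Notation trig := (@trig R s d).
Notation tapprox := (@tapprox R s d).
Let mQ := @measurable_cube R s d.

Lemma tapprox_cst (c : R) : tapprox (fun=> c).
Proof. apply: (tapprox_trig s_gt0); exact: trig_cst. Qed.

Lemma sqint_cst (c : R) : sqint (fun=> c).
Proof. by have [] := tapprox_cst c. Qed.

Lemma indic_le1 A x : `|\1_A x : R| <= 1.
Proof. by rewrite indicE normr_nat; case: (x \in A) => //=; rewrite ler01. Qed.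

Lemma tapprox_setC A : tapprox (\1_A) -> tapprox (\1_(~` A)).
Proof.
move=> hA; rewrite (_ : \1_(~` A) = fun x => 1 + (-1) * \1_A x).
  by apply: (tapproxD s_gt0); [exact: tapprox_cst|exact: (tapproxZ s_gt0)].
by apply/funext => x; rewrite !indicE in_setC; case: (x \in A) => /=; ring.
Qed.

Lemma tapprox_setI A B : tapprox (\1_A) -> tapprox (\1_B) -> tapprox (\1_(A `&` B)).
Proof.
move=> hA hB; rewrite indicI.
by apply: (tapproxM s_gt0 (B := 1)) => // x _; exact: indic_le1.
Qed.

Lemma tapprox_setU A B : tapprox (\1_A) -> tapprox (\1_B) -> tapprox (\1_(A `|` B)).
Proof.
move=> hA hB; rewrite -[_ `|` _]setCK setCU.
by apply: tapprox_setC; apply: tapprox_setI; exact: tapprox_setC.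
Qed.

Lemma tapprox_bigcup (F : nat -> set 'rV[R]_d) : (forall n, tapprox (\1_(F n))) ->
  tapprox (\1_(\bigcup_n F n)).
Proof.
move=> hF; pose G n := \big[setU/set0]_(i < n) F i.
apply: (@tapprox_lim _ _ s_gt0 _ (fun n => \1_(G n)) _ (fun=> 1)).
- elim=> [|n ih]; rewrite /G; first by rewrite big_ord0 indic0; exact: tapprox_cst.
  by rewrite big_ord_recr/=; exact: tapprox_setU.
- exact: sqint_cst.
- by move=> n x _; exact: indic_le1.
move=> x _; apply: cvg_near_cst.
have [[k _ Fk]|nF] := pselect ((\bigcup_n F n) x).
  near=> n; rewrite !indicE !mem_set//; first by exists k.
  rewrite /G -bigcup_mkord; exists k => //=; near: n; exact: nbhs_infty_gt.
near=> n; rewrite !indicE !memNset// /G -bigcup_mkord => -[k _ Fk].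
by apply: nF; exists k.
Unshelve. all: by end_near.
Qed.

Definition half_space (i : 'I_d) (c : R) : set 'rV[R]_d := [set x | c < x ord0 i].

Lemma measurable_half_space i c : measurable (half_space i c).
Proof.
rewrite (_ : half_space i c = setT `&` (fun x : 'rV[R]_d => x ord0 i) @^-1` `]c, +oo[%classic).
  by apply: measurable_coord => //; exact: measurable_itv.
by rewrite setTI; apply/seteqP; split => x /=; rewrite in_itv/= andbT.
Qed.

(* By the formula for the difference of two sines: inside the cube a half space is
   where a trigonometric polynomial is positive. *)
Lemma half_space_wave (t c : R) : `|t| < s / 2 -> `|c| < s / 2 ->
  (0 < sin (2 * pi * (t - c / 2) / s) - sin (pi * c / s)) = (c < t).
Proof.
move=> ts cs.
have E : sin (2 * pi * (t - c / 2) / s) - sin (pi * c / s) =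
   2 * cos (pi * t / s) * sin (pi * (t - c) / s).
  have s0 : s != 0 by rewrite gt_eqF.
  have -> : 2 * pi * (t - c / 2) / s = pi * t / s + pi * (t - c) / s by field.
  have -> : pi * c / s = pi * t / s - pi * (t - c) / s by field.
  by rewrite sinD sinB; ring.
have pi0 := @pi_gt0 R.
move: ts cs; rewrite !ltr_norml => /andP[t1 t2] /andP[c1 c2].
have cos0 : 0 < cos (pi * t / s).
  apply: cos_gt0_pihalf; rewrite ltr_pdivlMr// ltr_pdivrMr//.
  by apply/andP; split; nra.
have sinp (y : R) : 0 < y < s -> 0 < sin (pi * y / s).
  move=> /andP[y0 ys]; apply: sin_gt0_pi.
  by rewrite divr_gt0 ?mulr_gt0//= ltr_pdivrMr// ltr_pM2l.
rewrite E pmulr_rgt0 ?mulr_gt0//.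
have [tc|tc|->] := ltgtP c t.
- by rewrite sinp//; lra.
- apply/negbTE; rewrite -leNgt -oppr_ge0 -sinN -mulNr -mulrN ltW// sinp//; lra.
- by rewrite subrr mulr0 mul0r sin0 ltxx.
Qed.

Lemma tapprox_half_space i c : tapprox (\1_(half_space i c)).
Proof.
have mh : measurable_fun Q (\1_(half_space i c) : _ -> R).
  by apply: measurable_indic; exact: measurable_half_space.
(* A threshold outside the range of the open cube cuts off either nothing or everything there. *)
have [cs|cs] := ltP `|c| (s / 2); last first.
  have [c0|c0] := leP 0 c.
    apply: (tapprox_eq_open s_gt0 (tapprox_cst 0)) => // x ox.
    rewrite indicE memNset//; rewrite /half_space/= => cx; have := ox i; rewrite ltr_norml => /andP[_].
    by move: cs cx; rewrite ger0_norm//; lra.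
  apply: (tapprox_eq_open s_gt0 (tapprox_cst 1)) => // x ox.
  rewrite indicE mem_set//=; have := ox i; rewrite ltr_norml => /andP[+ _].
  by move: cs; rewrite ltr0_norm// /half_space/=; lra.
pose f (x : 'rV[R]_d) := sin (2 * pi * (x ord0 i - c / 2) / s) - sin (pi * c / s).
have hf : trig f.
  (* The coefficients come from expanding [sin (2 pi x_i / s - pi c / s)]. *)
  have := trigD (trig_wave s (- sin (pi * c / s)) (cos (pi * c / s)) (delta_mx ord0 i))
    (trig_cst s d (- sin (pi * c / s))).
  apply: eq_trig => x; rewrite /cosw /sinw.
  have -> : wave s (delta_mx ord0 i) x = 2 * pi * x ord0 i / s.
    rewrite /wave (bigD1 i)//= big1 ?addr0 ?mxE ?eqxx ?mul1r//.
    by move=> j ji; rewrite mxE eqxx/= (negbTE ji) mul0r.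
  rewrite /f mulrBr mulrBl sinB.
  have -> : 2 * pi * (c / 2) / s = pi * c / s by field; rewrite gt_eqF.
  ring.
apply: (tapprox_eq_open s_gt0 (tapprox_indic_gt0 s_gt0 (B := 2) _ (tapprox_trig s_gt0 hf))) => //.
  move=> x _; rewrite (le_trans (ler_normB _ _))//.
  by have := sinw_le1; rewrite (_ : 2 = 1 + 1 :> R)// lerD// ler_norml sin_geN1 sin_le1.
move=> x ox; rewrite !indicE; congr (_%:R); congr nat_of_bool.
by apply/idP/idP; rewrite !inE/= /f half_space_wave//; exact: ox.
Qed.

Lemma tapprox_coord_preimage (i : 'I_d) (B : set R) : measurable B ->
  tapprox (\1_((fun x : 'rV[R]_d => x ord0 i) @^-1` B)).
Proof.
move=> mB; suff : [set B : set R | tapprox (\1_((fun x : 'rV[R]_d => x ord0 i) @^-1` B))] B by [].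
have {}mB : (@ocitv R).-sigma.-measurable B := mB.
(* The Borel sets of the line are generated by the rays []c, +oo[], whose preimages are half
   spaces. *)
move: B mB; rewrite RGenOInfty.measurableE; apply: smallest_sub.
  split => /=.
  - by rewrite preimage_set0 indic0; exact: tapprox_cst.
  - by move=> B hB; rewrite setTD preimage_setC; exact: tapprox_setC.
  - by move=> F hF; rewrite preimage_bigcup; exact: tapprox_bigcup.
move=> _ [c ->] /=; rewrite (_ : _ @^-1` _ = half_space i c); first exact: tapprox_half_space.
by apply/seteqP; split => x /=; rewrite in_itv/= andbT.
Qed.

Lemma tapprox_measurable A : measurable A -> tapprox (\1_A).
Proof.
move=> mA; suff : [set A : set 'rV[R]_d | tapprox (\1_A)] A by [].
move: A mA; apply: smallest_sub.
  split => /=.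
  - by rewrite indic0; exact: tapprox_cst.
  - by move=> A hA; rewrite setTD; exact: tapprox_setC.
  - by move=> F hF; exact: tapprox_bigcup.
rewrite -bigcup_seq/=; apply: bigcup_sub => i _ A [B mB <-] /=.
by rewrite setTI; exact: tapprox_coord_preimage.
Qed.

Import HBNNSimple.

Lemma tapprox_nnsfun (h : {nnsfun 'rV[R]_d >-> R}) : tapprox h.
Proof.
have [S hS] : exists S : seq R,
    forall x, h x = \sum_(y <- S) (y * \1_(h @^-1` [set y]) x).
  by eexists => x; rewrite fimfunE fsbig_finite.
rewrite (_ : (h : _ -> R) = fun x => \sum_(y <- S) (y * \1_(h @^-1` [set y]) x)); last exact/funext.
elim: S {hS} => [|y S ih].
  by under eq_fun do rewrite big_nil; exact: tapprox_cst.
under eq_fun do rewrite big_cons; apply: (tapproxD s_gt0) => //.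
by apply: (tapproxZ s_gt0); exact: tapprox_measurable.
Qed.

(** [f] itself dominates its increasing simple approximations. *)
Lemma tapprox_ge0 f : (forall x, Q x -> 0 <= f x) -> sqint f -> tapprox f.
Proof.
move=> f0 hf; have [mf _] := hf.
have mEf : measurable_fun Q (EFin \o f) by exact/measurable_EFinP.
pose g := nnsfun_approx mQ mEf.
have gf x : Q x -> (EFin \o g ^~ x) @ \oo --> (f x)%:E.
  move=> Qx; have Ef0 y : Q y -> (0 <= (EFin \o f) y)%E by move=> Qy; rewrite lee_fin f0.
  exact: (cvg_nnsfun_approx mQ mEf Ef0 Qx).
have gfr x : Q x -> (fun n => g n x) @ \oo --> f x.
  by move=> Qx; exact: (fine_cvg (gf x Qx)).
apply: (@tapprox_lim _ _ s_gt0 _ (fun n => g n : _ -> R) _ f) => //.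
  by move=> n; exact: tapprox_nnsfun.
move=> n x Qx; rewrite ger0_norm//.
apply: (cvgr_to_ge (gfr x Qx)).
near=> m; have nm : (n <= m)%N by near: m; exact: nbhs_infty_ge.
by have /lefP := nd_nnsfun_approx mQ mEf nm; exact.
Unshelve. all: by end_near.
Qed.

Lemma sqint_tapprox f : sqint f -> tapprox f.
Proof.
move=> hf; have [mf hf2] := hf.
pose p g x := Num.max (g x) 0 : R.
have hp g : sqint g -> tapprox (p g).
  move=> [mg hg]; apply: tapprox_ge0; first by move=> x _; rewrite /p le_max lexx orbT.
  have mp : measurable_fun Q (p g) by apply: measurable_maxr.
  split => //; apply: (le_integrable mQ _ _ hg).
    by apply/measurable_EFinP; exact: measurable_funX.
  move=> x Qx /=; rewrite lee_fin !ger0_norm ?sqr_ge0// /p /Num.max.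
  by case: ifP => // _; rewrite expr0n/= sqr_ge0.
rewrite (_ : f = fun x => p f x + (-1) * p (fun y => (-1) * f y) x).
  apply: (tapproxD s_gt0); first exact: hp.
  by apply: (tapproxZ s_gt0); apply: hp; exact: sqintZ.
apply/funext => x; rewrite /p mulN1r /Num.max.
by have [?|?] := ltP (f x) 0; have [?|?] := ltP (-1 * f x) 0; lra.
Qed.

(** The half of Parseval's identity complementary to [bessel_seq], with an error [e] in place of an
    infinite sum. *)
Lemma sqint_parseval f : sqint f -> forall e : R, 0 < e -> exists S : seq 'rV[int]_d, uniq S /\
  s ^+ d * \int[leb d]_(x in Q) (f x ^+ 2) <=
  \sum_(u <- S) (coefA s f u ^+ 2 + coefB s f u ^+ 2) + e.
Proof.
move=> hf e e0; have [_ H] := sqint_tapprox hf.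
have sd : 0 < s ^+ d by rewrite exprn_gt0.
have [P hP fP] := H (e / s ^+ d) (divr_gt0 e0 sd).
have [S [uS hS]] := trig_approx s_gt0 hP hf; exists S; split => //.
rewrite mulrC -ler_pdivlMr// mulrDl addrC (le_trans hS)// lerD//.
by rewrite mulrC.
Qed.

End square_integrable_approximation.

Lemma ler_sum_subset (R : numDomainType) (T : eqType) (S S' : seq T) (G : T -> R) : uniq S -> uniq S' ->
  {subset S <= S'} -> (forall t, 0 <= G t) -> \sum_(t <- S) G t <= \sum_(t <- S') G t.
Proof.
move=> uS uS' SS' G0; rewrite [leRHS](bigID (mem S))/=.
rewrite -[leLHS]addr0 lerD ?sumr_ge0//.
rewrite (perm_big [seq x <- S' | x \in S]) ?big_filter//.
apply: uniq_perm => //; first exact: filter_uniq.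
by move=> t; rewrite mem_filter; case tS : (t \in S) => //=; rewrite SS'.
Qed.

(** * Fourier coefficients of complex functions *)

Section complex_fourier.
Context {R : realType} (s : R) (s_gt0 : 0 < s) (d : nat).
Implicit Types (u v : 'rV[int]_d) (f g : 'rV[R]_d -> R) (h : 'rV[R]_d -> R[i]).
Notation Q := (cube s d).
Notation sqint := (sqint (leb d) Q).
Notation coefA := (coefA s).
Notation coefB := (coefB s).
Let mQ := @measurable_cube R s d.

Lemma sqr_normcE (z : R[i]) : normc z ^+ 2 = complex.Re z ^+ 2 + complex.Im z ^+ 2.
Proof. by case: z => a b; rewrite /= sqr_sqrtr// addr_ge0 ?sqr_ge0. Qed.

Lemma sqr_normcM (z z' : R[i]) : normc (z * z') ^+ 2 = normc z ^+ 2 * normc z' ^+ 2.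
Proof. by case: z => a b; case: z' => a' b'; rewrite !sqr_normcE/=; ring. Qed.

Lemma sqr_normcD (z z' : R[i]) : normc (z + z') ^+ 2 <= 2 * (normc z ^+ 2 + normc z' ^+ 2).
Proof.
case: z => a b; case: z' => a' b'; rewrite !sqr_normcE/=.
by have := sqr_ge0 (a - a'); have := sqr_ge0 (b - b'); nra.
Qed.

Lemma sqr_normcC (r : R) : normc r%:C%C ^+ 2 = r ^+ 2.
Proof. by rewrite sqr_normcE/= expr0n/= addr0. Qed.

Lemma sqr_normcN (z : R[i]) : normc (- z) ^+ 2 = normc z ^+ 2.
Proof. by case: z => a b; rewrite !sqr_normcE/= !sqrrN. Qed.

Lemma in_L2P h : in_L2 s h -> sqint (fun x => complex.Re (h x)) /\ sqint (fun x => complex.Im (h x)).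
Proof.
move=> [mr mi hfin].
have mn : measurable_fun Q (fun x => (normc (h x) ^+ 2)%:E).
  apply/measurable_EFinP; under eq_fun do rewrite sqr_normcE.
  by apply: measurable_realfun.measurable_funD; exact: measurable_funX.
split; apply: sqintP => //; apply: le_lt_trans hfin; apply: ge0_le_integral => //.
- by move=> x _; rewrite lee_fin sqr_ge0.
- by apply/measurable_EFinP; exact: measurable_funX.
- by move=> x _; rewrite lee_fin sqr_normcE lerDl sqr_ge0.
- by move=> x _; rewrite lee_fin sqr_ge0.
- by apply/measurable_EFinP; exact: measurable_funX.
- by move=> x _; rewrite lee_fin sqr_normcE lerDr sqr_ge0.
Qed.

Lemma sqL2E h : sqint (fun x => complex.Re (h x)) -> sqint (fun x => complex.Im (h x)) ->
  sqL2 s h = (\int[leb d]_(x in Q) (complex.Re (h x) ^+ 2) +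
              \int[leb d]_(x in Q) (complex.Im (h x) ^+ 2))%:E.
Proof.
move=> [_ hr] [_ hi]; rewrite /sqL2 -RintegralD//.
rewrite -integral_EFin_Rintegral//; last exact: RintegrableD.
by apply: eq_integral => x _; rewrite sqr_normcE.
Qed.

Lemma fourierE h u : sqint (fun x => complex.Re (h x)) -> sqint (fun x => complex.Im (h x)) ->
  fourier s h u =
  Complex (coefA (fun x => complex.Re (h x)) u + coefB (fun x => complex.Im (h x)) u)
          (coefA (fun x => complex.Im (h x)) u - coefB (fun x => complex.Re (h x)) u).
Proof.
move=> hr hi.
have hc f : sqint f -> (leb d).-integrable Q (EFin \o (fun x => f x * cosw s u x)).
  by move=> hf; apply: sqintM => //; exact: sqint_cosw.
have hs f : sqint f -> (leb d).-integrable Q (EFin \o (fun x => f x * sinw s u x)).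
  by move=> hf; apply: sqintM => //; exact: sqint_sinw.
rewrite /fourier /coefA /coefB -RintegralD//; [|exact: hc|exact: hs].
rewrite -RintegralB//; [|exact: hc|exact: hs].
congr Complex; apply: eq_Rintegral => x _; rewrite characterE.
  by case: (h x) => a b /=; ring.
by case: (h x) => a b /=; ring.
Qed.

Lemma fourierRE f u :
  (leb d).-integrable Q (EFin \o (fun x => f x * cosw s u x)) ->
  (leb d).-integrable Q (EFin \o (fun x => f x * sinw s u x)) ->
  fourierR s f u = Complex (coefA f u) (- coefB f u).
Proof.
move=> hc hs; rewrite /fourierR /fourier /coefA /coefB -mulN1r -RintegralZl//.
by congr Complex; apply: eq_Rintegral => x _; rewrite characterE/=; ring.
Qed.

Lemma fourierR_sqint f u : sqint f -> fourierR s f u = Complex (coefA f u) (- coefB f u).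
Proof.
move=> hf; apply: fourierRE; apply: sqintM => //; [exact: sqint_cosw|exact: sqint_sinw].
Qed.

Lemma coefAN f u : coefA f (- u) = coefA f u.
Proof. by apply: eq_Rintegral => x _; rewrite /cosw waveNl cosN. Qed.

Lemma coefBN f u : sqint f -> coefB f (- u) = - coefB f u.
Proof.
move=> hf; rewrite /coefB -mulN1r -RintegralZl//.
  by apply: eq_Rintegral => x _; rewrite /sinw waveNl sinN; ring.
by apply: sqintM => //; exact: sqint_sinw.
Qed.

Lemma bessel_fourierR f (S : seq 'rV[int]_d) : uniq S -> sqint f ->
  \sum_(u <- S) normc (fourierR s f u) ^+ 2 <= s ^+ d * \int[leb d]_(x in Q) (f x ^+ 2).
Proof.
move=> uS hf; apply: le_trans (bessel_seq s_gt0 uS hf).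
by apply: ler_sum => u _; rewrite fourierR_sqint// sqr_normcE/= sqrrN.
Qed.

(* The cross terms of [normc (fourier h u) ^+ 2] are odd in the coefficients
   [coefB], so they cancel over a set of frequencies symmetric about 0. *)
Lemma sqL2_le_fourier h (K : \bar R) : in_L2 s h ->
  (forall S : seq 'rV[int]_d, uniq S ->
     ((\sum_(u <- S) normc (fourier s h u) ^+ 2)%:E <= K)%E) ->
  ((s ^+ d)%:E * sqL2 s h <= K)%E.
Proof.
move=> hL2 HK; have [hr hi] := in_L2P hL2.
case: K HK => [K| |] HK; last 2 first.
- exact: leey.
- by have := HK [::] isT; rewrite big_nil.
rewrite sqL2E// -EFinM lee_fin; apply/ler_addgt0Pr => e e0.
pose a x := complex.Re (h x); pose b x := complex.Im (h x).
have e2 : 0 < e / 2 by rewrite divr_gt0.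
have [S1 [uS1 H1]] := sqint_parseval s_gt0 hr e2.
have [S2 [uS2 H2]] := sqint_parseval s_gt0 hi e2.
(* Closed under negation, and large enough for the Parseval sums of both the real and the imaginary
   part. *)
pose S := undup (S1 ++ S2 ++ [seq - u | u <- S1 ++ S2]).
have uS : uniq S by exact: undup_uniq.
have NS u : (- u \in S) = (u \in S).
  rewrite !mem_undup !mem_cat.
  rewrite -(mem_map (@oppr_inj _) S1 u) -(mem_map (@oppr_inj _) S2 u).
  rewrite -[u in RHS]opprK !map_cat !mem_cat !(mem_map (@oppr_inj _)) opprK.
  by do !case: (_ \in _).
pose g f u := coefA f u ^+ 2 + coefB f u ^+ 2.
have g0 f u : 0 <= g f u by rewrite addr_ge0 ?sqr_ge0.
have E : \sum_(u <- S) normc (fourier s h u) ^+ 2 = \sum_(u <- S) (g a u + g b u).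
  suff : 2 * \sum_(u <- S) normc (fourier s h u) ^+ 2 = 2 * \sum_(u <- S) (g a u + g b u) by lra.
  rewrite [LHS]mulr_natl mulr2n [X in _ + X = _](_ : _ =
      \sum_(u <- S) normc (fourier s h (- u)) ^+ 2).
    rewrite -big_split mulr_sumr; apply: eq_bigr => u _.
    rewrite -[LHS]/(normc (fourier s h u) ^+ 2 + normc (fourier s h (- u)) ^+ 2).
    rewrite !fourierE// !sqr_normcE/= !coefAN !coefBN// /g -/a -/b.
    by ring.
  rewrite -(big_map (fun u => - u) xpredT (fun u => normc (fourier s h u) ^+ 2)).
  apply: perm_big; apply: uniq_perm => //.
    by rewrite map_inj_uniq//; exact: oppr_inj.
  by move=> u; rewrite -{2}[u]opprK (mem_map (@oppr_inj _)) NS.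
have := HK S uS; rewrite lee_fin E big_split/= => HKS.
have l1 : \sum_(u <- S1) g a u <= \sum_(u <- S) g a u.
  by apply: ler_sum_subset => // u uS1'; rewrite mem_undup !mem_cat uS1'.
have l2 : \sum_(u <- S2) g b u <= \sum_(u <- S) g b u.
  by apply: ler_sum_subset => // u uS2'; rewrite mem_undup !mem_cat uS2' orbT.
rewrite mulrDr; move: H1 H2 l1 l2 HKS; rewrite /g -/a -/b.
set x1 := s ^+ d * _; set x2 := s ^+ d * _.
set y1 := \sum_(u <- S1) _; set y2 := \sum_(u <- S2) _.
set z1 := \sum_(u <- S) _; set z2 := \sum_(u <- S) _.
by clearbody x1 x2 y1 y2 z1 z2 => *; lra.
Qed.

End complex_fourier.

(** * Series indexed by a countable type *)

Section countable_series.
Context {R : realType} (T : countType).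
Implicit Types G : T -> R.

(** Turns a family over [T] into a sequence by decoding natural numbers, so that the theory of
    nonnegative series applies; numbers that code no element contribute 0. *)
Definition nat_ext G (n : nat) : R := oapp G 0 (pickle_inv n : option T).

Lemma nat_ext_ge0 G n : (forall t, 0 <= G t) -> 0 <= nat_ext G n.
Proof. by move=> G0; rewrite /nat_ext; case: pickle_inv => //=. Qed.

Lemma sum_le_nneseries G (S : seq T) : (forall t, 0 <= G t) -> uniq S ->
  ((\sum_(t <- S) G t)%:E <= \sum_(n <oo) (nat_ext G n)%:E)%E.
Proof.
move=> G0 uS; pose N := (\max_(t <- S) pickle t).+1.
have -> : \sum_(t <- S) G t = \sum_(n <- map pickle S) nat_ext G n.
  by rewrite big_map; apply: eq_bigr => t _; rewrite /nat_ext pickleK_inv.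
apply: (@le_trans _ _ (\sum_(0 <= n < N) (nat_ext G n)%:E)%E).
  rewrite sumEFin lee_fin; apply: ler_sum_subset.
  - by rewrite map_inj_uniq//; exact: (pcan_inj (@pickleK_inv T)).
  - exact: iota_uniq.
  - move=> n /mapP[t tS ->]; rewrite mem_index_iota /= ltnS.
    by rewrite (big_rem t)//= leq_maxl.
  - by move=> n; exact: nat_ext_ge0.
by apply: nneseries_lim_ge => n _; rewrite lee_fin nat_ext_ge0.
Qed.

Lemma nneseries_le_sum G (K : R) : (forall t, 0 <= G t) ->
  (forall S : seq T, uniq S -> \sum_(t <- S) G t <= K) ->
  (\sum_(n <oo) (nat_ext G n)%:E <= K%:E)%E.
Proof.
move=> G0 GK; apply: lime_le.
  by apply: is_cvg_nneseries => n _ _; rewrite lee_fin nat_ext_ge0.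
near=> N; rewrite sumEFin lee_fin.
have -> : \sum_(0 <= n < N) nat_ext G n = \sum_(t <- pmap (@pickle_inv T) (iota 0 N)) G t.
  rewrite /index_iota subn0; elim: (iota 0 N) => [|n l ih]; first by rewrite !big_nil.
  by rewrite big_cons ih /nat_ext /=; case: pickle_inv => [t|] /=; rewrite ?big_cons ?add0r.
apply: GK; apply: (pmap_uniq (@pickle_invK T)); exact: iota_uniq.
Unshelve. all: by end_near.
Qed.

End countable_series.

(** * Convolution *)

Section reflection.
Context {R : realType} (s : R) (s_gt0 : 0 < s).
Notation leb1 := (@lebesgue_measure R).

Lemma ge0_integral_itv_opp (G : R -> \bar R) : measurable_fun setT G ->
  (forall x, 0 <= G x)%E ->
  (\int[leb1]_(a in `[(- (s / 2))%R, (s / 2)%R]) G (- a)%R =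
   \int[leb1]_(a in `[(- (s / 2))%R, (s / 2)%R]) G a)%E.
Proof.
move=> mG G0.
have mo : measurable_fun [set: measurableTypeR R] (-%R : _ -> measurableTypeR R).
  exact: oppr_measurable.
have mI : measurable (`[(- (s / 2))%R, (s / 2)%R]%classic : set (measurableTypeR R)) by [].
have := @ge0_integral_pushforward _ _ _ _ _ _ mo leb1 _ G mI (measurable_funTS mG) (fun _ _ => G0 _).
rewrite opp_preimage_itvbndbnd/= opprK => <-.
by apply: eq_measure_integral => A mA _; exact: lebesgue_measureN.
Qed.

(** Coordinate by coordinate, as for translations. Together with translation invariance it handles
    the substitution of [x - y] for [y] in a convolution. *)
Lemma ge0_integral_cube_opp d (f : 'rV[R]_d -> \bar R) : measurable_fun setT f ->
  (forall x, 0 <= f x)%E ->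
  (\int[leb d]_(x in cube s d) f (- x)%R = \int[leb d]_(x in cube s d) f x)%E.
Proof.
elim: d f => [|n ih] f mf f0.
  by apply: eq_integral => x _; congr f; apply/rowP => -[].
have mfo : measurable_fun setT (fun x : 'rV[R]_n.+1 => f (- x)).
  exact: (measurableT_comp mf (@measurable_opp_rV R n.+1)).
rewrite (ge0_integral_cube_cons s mfo (fun x => f0 _)) (ge0_integral_cube_cons s mf f0).
pose G (x0 : R) := (\int[leb n]_(x in cube s n) f (cons_rV (x0, x)))%E.
have mfc x0 : measurable_fun setT (fun x => f (cons_rV (x0, x))).
  apply: (measurableT_comp mf); apply: (measurableT_comp (@measurable_cons_rV R n)).
  exact: pair1_measurable.
transitivity (\int[leb1]_(x0 in `[(- (s / 2))%R, (s / 2)%R]) G (- x0)%R)%E.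
  apply: eq_integral => x0 _; rewrite /G -(ih _ (mfc (- x0)))//.
  apply: eq_integral => x _; congr f.
  by apply/rowP => i; rewrite !mxE/=; case: unliftP => [k _|_] /=; rewrite ?mxE.
rewrite ge0_integral_itv_opp//; last by move=> x; apply: integral_ge0.
exact: measurable_integral_cube_cons.
Qed.

End reflection.

(** * Convolution of an integrable function with a bounded one *)

Section torus_convolution.
Context {R : realType} (s : R) (s_gt0 : 0 < s) (d : nat).
Notation Q := (cube s d).
Notation cosw := (cosw s).
Notation sinw := (sinw s).
Notation coefA := (coefA s).
Notation coefB := (coefB s).
Let mQ := @measurable_cube R s d.

Lemma measurable_floor : measurable_fun [set: R] (fun x : R => (Num.floor x)%:~R : R).
Proof.
apply: nondecreasing_measurable => // x y xy.
by rewrite ler_int; exact: le_floor.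
Qed.

Lemma measurable_wrap : measurable_fun setT (@Defs.wrap R s d).
Proof.
apply: measurable_rVP => i; under eq_fun do rewrite mxE.
apply: measurable_realfun.measurable_funB; first exact: measurable_coord.
apply: measurable_realfun.measurable_funM => //.
apply: (measurableT_comp measurable_floor).
apply: measurable_realfun.measurable_funD => //.
by apply: measurable_realfun.measurable_funM => //; exact: measurable_coord.
Qed.

Lemma wrap_cube (x : 'rV[R]_d) : Q (Defs.wrap s x).
Proof.
move=> i; rewrite mxE; set y := x ord0 i; set k := Num.floor _.
have h1 := floor_le_tmp (y / s + 2^-1); have h2 := floorD1_gt (y / s + 2^-1).
rewrite -/k in h1 h2; rewrite intrD mulr1z in h2.
have ys : y = (y / s) * s by rewrite divfK// gt_eqF.
rewrite {1}ys; move: (y / s) h1 h2 => t h1 h2.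
rewrite (_ : t * s - s * k%:~R = (t - k%:~R) * s); last by ring.
rewrite normrM (gtr0_norm s_gt0) mulrC ler_pM2l// ler_norml.
by apply/andP; split; lra.
Qed.

Lemma wrap_periodic (V : Type) (f : 'rV[R]_d -> V) x : torus_periodic s f -> f (Defs.wrap s x) = f x.
Proof.
move=> fp; rewrite -[RHS](fp (\row_i - Num.floor (x ord0 i / s + 2^-1))); congr f.
by apply/rowP => i; rewrite !mxE mulrNz mulrN.
Qed.

(** A periodic function is its restriction to the cube composed with [wrap]. Measurability on all of
    R^d is needed because [x - y] leaves the cube. *)
Lemma periodic_measurable (f : 'rV[R]_d -> R) : torus_periodic s f ->
  measurable_fun Q f -> measurable_fun setT f.
Proof.
move=> fp mf; rewrite (_ : f = f \o @Defs.wrap R s d); last first.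
  by apply/funext => x /=; rewrite wrap_periodic.
apply: (measurable_comp mQ) mf measurable_wrap.
by move=> _ [x _ <-]; exact: wrap_cube.
Qed.

Variables (f m : 'rV[R]_d -> R) (B : R).
Hypotheses (f_per : torus_periodic s f) (f_int : (leb d).-integrable Q (EFin \o f)).
Hypotheses (m_meas : measurable_fun Q m) (m_bnd : forall x, Q x -> `|m x| <= B).

Definition rconv x : R := \int[leb d]_(y in Q) (f (x - y) * m y).
Definition norm1 : R := \int[leb d]_(x in Q) `|f x|.

Let mf : measurable_fun setT f.
Proof. by apply: periodic_measurable => //; apply/measurable_EFinP; case/integrableP: f_int. Qed.

Lemma measurable_sub_rV : measurable_fun setT (fun z : 'rV[R]_d * 'rV[R]_d => z.1 - z.2).
Proof.
apply: measurable_rVP => i; under eq_fun do rewrite !mxE.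
apply: measurable_realfun.measurable_funB.
  exact: (measurableT_comp (measurable_coord i) measurable_fst).
exact: (measurableT_comp (measurable_coord i) measurable_snd).
Qed.

Let mfshift a : measurable_fun setT (fun x : 'rV[R]_d => f (x + a)).
Proof. exact: (measurableT_comp mf (measurable_add_rV a)). Qed.

Let mfsub x : measurable_fun setT (fun y : 'rV[R]_d => f (x - y)).
Proof.
rewrite (_ : (fun _ => _) = (fun y : 'rV[R]_d => f (- y + x))).
  exact: (measurableT_comp (mfshift x) (@measurable_opp_rV R d)).
by apply/funext => y; rewrite addrC.
Qed.

Let int_abs : (\int[leb d]_(x in Q) `|f x|%:E = norm1%:E)%E.
Proof. by rewrite integral_EFin_Rintegral//; exact: integrable_norm. Qed.

Lemma integral_abs_shift a : (\int[leb d]_(x in Q) `|f (x + a)|%:E = norm1%:E)%E.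
Proof.
rewrite (integral_torus s_gt0 (f := fun x => `|f x|%:E))//.
  by apply/measurable_EFinP; exact: measurableT_comp.
by move=> z x; rewrite f_per.
Qed.

Lemma integral_abs_sub x : (\int[leb d]_(y in Q) `|f (x - y)|%:E = norm1%:E)%E.
Proof.
rewrite -(integral_abs_shift x).
rewrite -(ge0_integral_cube_opp s (f := fun y => `|f (y + x)|%:E)).
- by apply: eq_integral => y _; rewrite addrC.
- by apply/measurable_EFinP; exact: measurableT_comp.
- by move=> y; rewrite lee_fin.
Qed.

Lemma integrable_conv x : (leb d).-integrable Q (EFin \o (fun y => f (x - y) * m y)).
Proof.
apply/integrableP; split.
  apply/measurable_EFinP; apply: measurable_realfun.measurable_funM => //.
  exact: measurable_funTS.
have B0 : 0 <= B by have := m_bnd (wrap_cube 0); apply: le_trans.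
apply: (@le_lt_trans _ _ (\int[leb d]_(y in Q) (B%:E * `|f (x - y)|%:E))%E); last first.
  rewrite ge0_integralZl//; first by rewrite integral_abs_sub -EFinM ltry.
  by apply/measurable_EFinP; apply: measurable_funTS; exact: measurableT_comp.
apply: ge0_le_integral => //.
- apply/measurable_EFinP; apply: measurableT_comp => //.
  apply: measurable_realfun.measurable_funM => //; exact: measurable_funTS.
- apply/measurable_EFinP; apply: measurable_realfun.measurable_funM => //.
  by apply: measurable_funTS; exact: measurableT_comp.
- by move=> y Qy /=; rewrite lee_fin normrM mulrC ler_wpM2r// m_bnd.
Qed.

Lemma rconv_bounded x : `|rconv x| <= B * norm1.
Proof.
apply: le_trans (le_normr_Rintegral mQ (integrable_conv x)) _.
have iab : (leb d).-integrable Q (EFin \o (fun y => `|f (x - y)|)).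
  apply/integrableP; split.
    by apply/measurable_EFinP; apply: measurable_funTS; exact: measurableT_comp.
  by under eq_integral do rewrite /= normr_id; rewrite integral_abs_sub ltry.
have -> : norm1 = \int[leb d]_(y in Q) `|f (x - y)|.
  by apply: EFin_inj; rewrite -[RHS]integral_EFin_Rintegral// integral_abs_sub.
rewrite -RintegralZl//; apply: le_Rintegral => //.
- by apply: integrable_norm; exact: integrable_conv.
- exact: RintegrableZ.
- by move=> y Qy; rewrite normrM mulrC ler_wpM2r// m_bnd.
Qed.

Section kernel.
Variables (w : 'rV[R]_d -> R).
Hypotheses (mw : measurable_fun Q w) (w1 : forall x, Q x -> `|w x| <= 1).

(** The factors [m] and [w] are cut off outside the cube because Fubini's theorem is applied on the
    whole product space; [f] stays periodic, so that it can be translated. *)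
Let K (z : 'rV[R]_d * 'rV[R]_d) : R := f (z.1 - z.2) * (m \_ Q) z.2 * (w \_ Q) z.1.

Let mK : measurable_fun setT K.
Proof.
have h (k : 'rV[R]_d -> R) : measurable_fun Q k -> measurable_fun setT (k \_ Q).
  by move=> mk; exact/(measurable_restrictT _ _).1.
apply: measurable_realfun.measurable_funM; first apply: measurable_realfun.measurable_funM.
- exact: (measurableT_comp mf measurable_sub_rV).
- exact: (measurableT_comp (h _ m_meas) measurable_snd).
- exact: (measurableT_comp (h _ mw) measurable_fst).
Qed.

(** Integrating in x first, translation invariance bounds the inner integral by [B * norm1] for each
    y in the cube, which has finite volume. *)
Let iK : ((leb d) \x (leb d))%E.-integrable setT (EFin \o K).
Proof.
have mEK : measurable_fun setT (EFin \o K) by exact/measurable_EFinP.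
apply/integrable21ltyP => //.
pose h (y : 'rV[R]_d) : \bar R := (((cst (B * norm1)) \_ Q) y)%:E.
have hfin : (\int[leb d]_y h y < +oo)%E.
  rewrite (_ : (\int[leb d]_y h y)%E = (\int[leb d]_(y in Q) (cst (B * norm1)%:E) y)%E).
    by rewrite integral_cst// [X in (_ * X)%E](leb_cube d s_gt0) -EFinM ltry.
  rewrite [RHS]integral_mkcond; apply: eq_integral => y _.
  by rewrite /h !patchE; case: ifP.
apply: le_lt_trans hfin; apply: ge0_le_integral => //.
- by move=> y _; apply: integral_ge0.
- apply: (@measurable_fun_fubini_tonelli_G _ _ _ _ _ (leb d) (abse \o (EFin \o K))) => //.
  exact: measurableT_comp.
- by move=> z /=; rewrite lee_fin.
- apply/measurable_EFinP/(measurable_restrictT _ _).1 => //; exact: measurable_cst.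
move=> y _; rewrite /h patchE; case: ifPn => yQ; last first.
  rewrite le_eqVlt; apply/orP; left; apply/eqP; apply: integral0_eq => x _.
  by rewrite /K /= patchE (negbTE yQ) mulr0 mul0r normr0.
have Qy : Q y by rewrite inE in yQ.
have B0 : 0 <= B by apply: le_trans (m_bnd Qy).
rewrite (_ : (\int[leb d]_x _)%E = (\int[leb d]_(x in Q) `|f (x - y) * m y * w x|%:E)%E); last first.
  rewrite [RHS]integral_mkcond; apply: eq_integral => x _.
  by rewrite /K /= !patchE yQ; case: ifP => // _; rewrite mulr0 normr0.
rewrite [leRHS](_ : _ = (\int[leb d]_(x in Q) (B%:E * `|f (x - y)|%:E))%E); last first.
  rewrite ge0_integralZl//; first by rewrite integral_abs_shift EFinM.
  by apply/measurable_EFinP; apply: measurable_funTS; exact: measurableT_comp.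
apply: ge0_le_integral => //.
- apply/measurable_EFinP; apply: measurableT_comp => //.
  apply: measurable_realfun.measurable_funM => //.
  by apply: measurable_realfun.measurable_funM => //; exact: measurable_funTS.
- apply/measurable_EFinP; apply: measurable_realfun.measurable_funM => //.
  by apply: measurable_funTS; exact: measurableT_comp.
- move=> x Qx; rewrite lee_fin !normrM mulrAC -[leRHS]mulr1 mulrAC.
  by rewrite ler_pM// ?w1// mulrC ler_wpM2r// m_bnd.
Qed.

Let integrable_shift_w y : (leb d).-integrable Q (EFin \o (fun x => f (x - y) * w x)).
Proof.
have iab : (leb d).-integrable Q (EFin \o (fun x => f (x - y))).
  apply/integrableP; split; first by apply/measurable_EFinP; exact: measurable_funTS.
  by rewrite integral_abs_shift ltry.
apply: (le_integrable mQ _ _ iab).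
  apply/measurable_EFinP; apply: measurable_realfun.measurable_funM => //.
  exact: measurable_funTS.
by move=> x Qx /=; rewrite lee_fin normrM ler_piMr// w1.
Qed.

Let FE : fubini_F (leb d) (EFin \o K) = EFin \o ((fun x => rconv x * w x) \_ Q).
Proof.
apply/funext => x; rewrite /fubini_F /= patchE; case: ifPn => xQ; last first.
  by apply: integral0_eq => y _; rewrite /K /= [X in _ * X]patchE (negbTE xQ) mulr0.
rewrite /rconv -RintegralZr//; last exact: integrable_conv.
rewrite -integral_EFin_Rintegral//; last first.
  rewrite (_ : _ \o _ = EFin \o (fun y => w x * (f (x - y) * m y))).
    by apply: RintegrableZ => //; exact: integrable_conv.
  by apply/funext => y /=; rewrite mulrC.
rewrite [RHS]integral_mkcond; apply: eq_integral => y _.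
by rewrite /K /= !patchE xQ; case: ifP => // _; rewrite mulr0 mul0r.
Qed.

Let GE : fubini_G (leb d) (EFin \o K) =
  EFin \o ((fun y => m y * \int[leb d]_(x in Q) (f (x - y) * w x)) \_ Q).
Proof.
apply/funext => y; rewrite /fubini_G /= patchE; case: ifPn => yQ; last first.
  by apply: integral0_eq => x _; rewrite /K /= patchE (negbTE yQ) mulr0 mul0r.
rewrite -RintegralZl// -integral_EFin_Rintegral//; last exact: RintegrableZ.
rewrite [RHS]integral_mkcond; apply: eq_integral => x _.
by rewrite /K /= !patchE yQ; case: ifP => // _; rewrite ?mulr0//; congr EFin; ring.
Qed.

(** Fubini's theorem also provides the measurability of the inner integral; with [w] constant this
    becomes [measurable_rconv]. *)
Lemma rconv_swap :
  measurable_fun Q (fun x => rconv x * w x) /\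
  \int[leb d]_(x in Q) (rconv x * w x) =
  \int[leb d]_(y in Q) (m y * \int[leb d]_(x in Q) (f (x - y) * w x)).
Proof.
split.
  apply/(measurable_restrictT _ _).2 => //; apply/measurable_EFinP.
  by rewrite -FE; exact: (measurable_fubini_F iK).
rewrite Rintegral_mkcond [RHS]Rintegral_mkcond /Rintegral; congr fine.
transitivity (\int[leb d]_x fubini_F (leb d) (EFin \o K) x)%E; first by rewrite FE.
transitivity (\int[leb d]_x fubini_G (leb d) (EFin \o K) x)%E; last by rewrite GE.
exact: (Fubini iK).
Qed.

End kernel.

Lemma measurable_rconv : measurable_fun Q rconv.
Proof.
have [] := @rconv_swap (fun=> 1).
- exact: measurable_cst.
- by move=> x _; rewrite normr1.
- by under eq_fun do rewrite mulr1.
Qed.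

Lemma sqint_rconv : sqint (leb d) Q rconv.
Proof.
apply: (sqint_bounded _ _ _ (B := B * norm1)) => //; first exact: leb_cube_fin.
  exact: measurable_rconv.
by move=> x _; exact: rconv_bounded.
Qed.

Let if_w (c : 'rV[R]_d -> R) : measurable_fun Q c -> (forall x, `|c x| <= 1) ->
  (leb d).-integrable Q (EFin \o (fun x => f x * c x)).
Proof.
move=> mc c1; apply: (le_integrable mQ _ _ f_int).
  apply/measurable_EFinP; apply: measurable_realfun.measurable_funM => //.
  exact: measurable_funTS.
by move=> x Qx /=; rewrite lee_fin normrM ler_piMr// c1.
Qed.

Let im_w (c : 'rV[R]_d -> R) : measurable_fun Q c -> (forall x, `|c x| <= 1) ->
  (leb d).-integrable Q (EFin \o (fun x => m x * c x)).
Proof.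
move=> mc c1; apply: (integrable_bounded s_gt0 (B := B)).
  exact: measurable_realfun.measurable_funM.
by move=> x Qx; rewrite normrM -[leRHS]mulr1 ler_pM// m_bnd.
Qed.

(** Invariance under the translation by [y], then the addition theorem for the cosine at
    [x = (x - y) + y]. *)
Let Afshift u y : \int[leb d]_(x in Q) (f (x - y) * cosw u x) =
  coefA f u * cosw u y - coefB f u * sinw u y.
Proof.
have mc : measurable_fun setT (fun x => f x * cosw u x).
  by apply: measurable_realfun.measurable_funM => //; exact: measurable_cosw.
have ms : measurable_fun setT (fun x => f x * sinw u x).
  by apply: measurable_realfun.measurable_funM => //; exact: measurable_sinw.
have ic : (leb d).-integrable Q (EFin \o (fun x => f x * cosw u x)).
  by apply: if_w; [exact: measurable_cosw|exact: cosw_le1].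
have is_ : (leb d).-integrable Q (EFin \o (fun x => f x * sinw u x)).
  by apply: if_w; [exact: measurable_sinw|exact: sinw_le1].
rewrite /coefA /coefB -!RintegralZr// -RintegralB//; last 2 first.
- rewrite (_ : _ \o _ = EFin \o (fun x => cosw u y * (f x * cosw u x))); first exact: RintegrableZ.
  by apply/funext => x /=; rewrite mulrC.
- rewrite (_ : _ \o _ = EFin \o (fun x => sinw u y * (f x * sinw u x))); first exact: RintegrableZ.
  by apply/funext => x /=; rewrite mulrC.
rewrite -(Rintegral_torus s_gt0 (f := fun x => f x * cosw u x * cosw u y - f x * sinw u x * sinw u y) (- y)).
- apply: eq_Rintegral => x _.
  have -> : cosw u x = cosw u (x - y) * cosw u y - sinw u (x - y) * sinw u y.
    by rewrite /cosw /sinw -cosD -waveD subrK.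
  by ring.
- by apply: measurable_realfun.measurable_funB; apply: measurable_realfun.measurable_funM.
- by move=> z x; rewrite f_per cosw_per// sinw_per.
Qed.

Let Bfshift u y : \int[leb d]_(x in Q) (f (x - y) * sinw u x) =
  coefB f u * cosw u y + coefA f u * sinw u y.
Proof.
have mc : measurable_fun setT (fun x => f x * cosw u x).
  by apply: measurable_realfun.measurable_funM => //; exact: measurable_cosw.
have ms : measurable_fun setT (fun x => f x * sinw u x).
  by apply: measurable_realfun.measurable_funM => //; exact: measurable_sinw.
have ic : (leb d).-integrable Q (EFin \o (fun x => f x * cosw u x)).
  by apply: if_w; [exact: measurable_cosw|exact: cosw_le1].
have is_ : (leb d).-integrable Q (EFin \o (fun x => f x * sinw u x)).
  by apply: if_w; [exact: measurable_sinw|exact: sinw_le1].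
rewrite /coefA /coefB -!RintegralZr// -RintegralD//; last 2 first.
- rewrite (_ : _ \o _ = EFin \o (fun x => cosw u y * (f x * sinw u x))); first exact: RintegrableZ.
  by apply/funext => x /=; rewrite mulrC.
- rewrite (_ : _ \o _ = EFin \o (fun x => sinw u y * (f x * cosw u x))); first exact: RintegrableZ.
  by apply/funext => x /=; rewrite mulrC.
rewrite -(Rintegral_torus s_gt0 (f := fun x => f x * sinw u x * cosw u y + f x * cosw u x * sinw u y) (- y)).
- apply: eq_Rintegral => x _.
  have -> : sinw u x = sinw u (x - y) * cosw u y + cosw u (x - y) * sinw u y.
    by rewrite /cosw /sinw -sinD -waveD subrK.
  by ring.
- by apply: measurable_realfun.measurable_funD; apply: measurable_realfun.measurable_funM.
- by move=> z x; rewrite f_per cosw_per// sinw_per.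
Qed.

Let imc u : (leb d).-integrable Q (EFin \o (fun x => m x * cosw u x)).
Proof. by apply: im_w; [exact: measurable_cosw|exact: cosw_le1]. Qed.

Let ims u : (leb d).-integrable Q (EFin \o (fun x => m x * sinw u x)).
Proof. by apply: im_w; [exact: measurable_sinw|exact: sinw_le1]. Qed.

(** Real part of the product of [coefA f - i coefB f] and [coefA m - i coefB m]; the next lemma is
    the imaginary part. *)
Lemma coefA_rconv u : coefA rconv u = coefA f u * coefA m u - coefB f u * coefB m u.
Proof.
rewrite {1}/coefA (proj2 (rconv_swap (measurable_cosw s u mQ) (fun x _ => cosw_le1 s u x))).
under eq_Rintegral do rewrite Afshift.
rewrite [in RHS]/coefA [in RHS]/coefB -!RintegralZl// -RintegralB//; [|exact: RintegrableZ|exact: RintegrableZ].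
by apply: eq_Rintegral => y _; rewrite /coefA /coefB; ring.
Qed.

Lemma coefB_rconv u : coefB rconv u = coefB f u * coefA m u + coefA f u * coefB m u.
Proof.
rewrite {1}/coefB (proj2 (rconv_swap (measurable_sinw s u mQ) (fun x _ => sinw_le1 s u x))).
under eq_Rintegral do rewrite Bfshift.
rewrite [in RHS]/coefA [in RHS]/coefB -!RintegralZl// -RintegralD//; [|exact: RintegrableZ|exact: RintegrableZ].
by apply: eq_Rintegral => y _; rewrite /coefA /coefB; ring.
Qed.

Lemma fourierR_rconv u : fourierR s rconv u = fourierR s f u * fourierR s m u.
Proof.
rewrite fourierR_sqint//; last exact: sqint_rconv.
rewrite !fourierRE//; last 2 first.
- by apply: if_w; [exact: measurable_cosw|exact: cosw_le1].
- by apply: if_w; [exact: measurable_sinw|exact: sinw_le1].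
rewrite coefA_rconv coefB_rconv; congr Complex; rewrite /=; ring.
Qed.

End torus_convolution.

(** * The empirical Fourier transform *)

Section density.
Context {R : realType} d1 d2 (T : measurableType d1) (S : measurableType d2).
Variables (nu : {measure set T -> \bar R}) (mu : {measure set S -> \bar R}).
Variables (D : set S) (m : S -> R) (phi : S -> T).
Hypotheses (mD : measurable D) (mm : measurable_fun D m) (m0 : forall x, D x -> 0 <= m x).
Hypotheses (mphi : measurable_fun setT phi).
Hypothesis nuE : forall A, measurable A -> nu A = (\int[mu]_(x in D) (m x * \1_A (phi x))%:E)%E.

Import HBNNSimple.

Let mphiD : measurable_fun D phi.
Proof. exact: measurable_funTS. Qed.

(** The hypothesis is the case of indicators; simple functions follow by linearity, and the general
    case by monotone convergence. *)
Lemma ge0_integral_density (f : T -> \bar R) : measurable_fun setT f -> (forall x, 0 <= f x)%E ->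
  (\int[nu]_x f x = \int[mu]_(x in D) ((m x)%:E * f (phi x)))%E.
Proof.
move=> mf f0.
have nn (h : {nnsfun T >-> R}) :
    (\int[nu]_x (h x)%:E = \int[mu]_(x in D) (m x * h (phi x))%:E)%E.
  have hE x : h x = \sum_(y \in range h) (y * \1_(h @^-1` [set y]) x) by rewrite fimfunE.
  have mind y : measurable_fun D (fun x => \1_(h @^-1` [set y]) (phi x) : R).
    by apply: (measurableT_comp _ mphiD); exact: measurable_indic.
  transitivity (\sum_(y \in range h) (y%:E * nu (h @^-1` [set y])))%E.
    under eq_integral do rewrite hE -fsumEFin//.
    rewrite ge0_integral_fsum//; last 2 first.
    - by move=> y; apply/measurable_EFinP; apply: measurable_realfun.measurable_funM.
    - by move=> y x _; rewrite EFinM nnfun_muleindic_ge0.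
    apply: eq_fsbigr => y _.
    by rewrite integralZl_indic_nnsfun// integral_indic// setIT.
  transitivity (\int[mu]_(x in D) (\sum_(y \in range h) (m x * (y * \1_(h @^-1` [set y]) (phi x)))%:E)%E)%E; last first.
    apply: eq_integral => x _; rewrite hE fsumEFin//; congr EFin.
    by rewrite !fsbig_finite//= mulr_sumr.
  have h0 y x : 0 <= y * \1_(h @^-1` [set y]) (x : T).
    by have := nnfun_muleindic_ge0 h y x; rewrite -EFinM lee_fin.
  rewrite ge0_integral_fsum//; last 2 first.
  - move=> y; apply/measurable_EFinP; apply: measurable_realfun.measurable_funM => //.
    by apply: measurable_realfun.measurable_funM.
  - by move=> y x Dx; rewrite lee_fin mulr_ge0// m0.
  apply: eq_fsbigr => y yh; rewrite nuE//.
  have y0 : 0 <= y by move: yh; rewrite inE => -[x _ <-].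
  rewrite -ge0_integralZl//.
  - by apply: eq_integral => x _; rewrite -EFinM; congr EFin; ring.
  - by apply/measurable_EFinP; apply: measurable_realfun.measurable_funM.
  - by move=> x Dx; rewrite lee_fin mulr_ge0// m0.
pose g := nnsfun_approx measurableT mf.
have gc x : (EFin \o g ^~ x) @ \oo --> f x by exact: cvg_nnsfun_approx.
have -> : (\int[nu]_x f x = limn (fun n => \int[nu]_x (g n x)%:E))%E.
  rewrite -monotone_convergence//.
  - by apply: eq_integral => x _; apply/esym/cvg_lim => //; exact: gc.
  - by move=> n; exact/measurable_EFinP.
  - by move=> n x _; rewrite lee_fin.
  - by move=> x _ a b ab; rewrite lee_fin; exact/lefP/nd_nnsfun_approx.
have -> : (\int[mu]_(x in D) ((m x)%:E * f (phi x)) =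
    limn (fun n => \int[mu]_(x in D) (m x * g n (phi x))%:E))%E.
  rewrite -monotone_convergence//.
  - apply: eq_integral => x _; apply/esym/cvg_lim => //.
    under eq_fun do rewrite EFinM.
    by apply: cvgeZl => //; exact: gc.
  - move=> n; apply/measurable_EFinP; apply: measurable_realfun.measurable_funM => //.
    exact: (measurableT_comp _ mphiD).
  - by move=> n x Dx; rewrite lee_fin mulr_ge0// m0.
  - move=> x Dx a b ab; rewrite lee_fin ler_wpM2l ?m0//; exact/lefP/nd_nnsfun_approx.
by congr (limn _); apply/funext => n; rewrite nn.
Qed.

End density.

(** * Expectation of a product of independent variables *)

Section independence.
Context {R : realType} d1 (Omega : measurableType d1) (P : probability Omega R).
Context d2 (T : measurableType d2).
Implicit Types (X Y : Omega -> T) (h : T -> R).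

Lemma Rintegral_prob_cst (c : R) : \int[P]_w c = c.
Proof. by rewrite Rintegral_cst// [X in fine X]probability_setT mulr1. Qed.

Lemma integrable_prob_bounded (Z : Omega -> R) (B : R) : measurable_fun setT Z ->
  (forall w, `|Z w| <= B) -> P.-integrable setT (EFin \o Z).
Proof.
move=> mZ ZB; apply: measurable_bounded_integrable => //.
  by rewrite [X in (X < _)%E]probability_setT ltry.
by exists B; split; [rewrite num_real|move=> M BM x _; apply: le_trans (ZB x) (ltW BM)].
Qed.

(** By uniqueness of product measures the joint law of [X] and [Y] is the product of their laws, and
    Fubini's theorem applies. *)
Lemma indep_Rintegral X Y h : measurable_fun setT X -> measurable_fun setT Y ->
  measurable_fun setT h -> (forall x, `|h x| <= 1) ->
  (forall A B, measurable A -> measurable B ->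
     P (X @^-1` A `&` Y @^-1` B) = (P (X @^-1` A) * P (Y @^-1` B))%E) ->
  \int[P]_w (h (X w) * h (Y w)) = \int[P]_w h (X w) * \int[P]_w h (Y w).
Proof.
move=> mX mY mh h1 XY.
pose X' : {mfun Omega >-> T} := HB.pack X (isMeasurableFun.Build _ _ _ _ X mX).
pose Y' : {mfun Omega >-> T} := HB.pack Y (isMeasurableFun.Build _ _ _ _ Y mY).
have mZ : measurable_fun setT (fun w => (X w, Y w)) by exact: measurable_fun_pair.
pose Z' : {mfun Omega >-> (T * T)%type} := HB.pack (fun w => (X w, Y w)) (isMeasurableFun.Build _ _ _ _ _ mZ).
pose hh (z : T * T) : R := h z.1 * h z.2.
have mhh : measurable_fun setT hh.
  by apply: measurable_realfun.measurable_funM;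
    [exact: (measurableT_comp mh measurable_fst)|exact: (measurableT_comp mh measurable_snd)].
have hh1 z : `|hh z| <= 1 by rewrite normrM mulr_ile1.
have bint d' (U : measurableType d') (Q : probability U R) (k : U -> R) :
    measurable_fun setT k -> (forall x, `|k x| <= 1) -> Q.-integrable setT (EFin \o k).
  move=> mk k1; apply: measurable_bounded_integrable => //.
    by rewrite [X in (X < _)%E]probability_setT ltry.
  by exists 1; split; [rewrite num_real|move=> M BM x _; apply: le_trans (k1 x) (ltW BM)].
have prodE A : measurable A ->
    (distribution P X' \x distribution P Y')%E A = distribution P Z' A.
  apply: product_measure_unique => B C mB mC.
  by rewrite /distribution /pushforward /= -XY//.
have iprod : ((distribution P X') \x (distribution P Y'))%E.-integrable setT (EFin \o hh).
  apply: measurable_bounded_integrable => //.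
    by rewrite [X in (X < _)%E]prodE// [X in (X < _)%E]probability_setT ltry.
  by exists 1; split; [rewrite num_real|move=> M BM x _; apply: le_trans (hh1 x) (ltW BM)].
have EX : (\int[distribution P X']_x (h x)%:E = \int[P]_w (h (X w))%:E)%E.
  rewrite (@integral_distribution _ _ _ _ _ P X' (EFin \o h))//; first exact/measurable_EFinP.
  by apply: bint => //; exact: (measurableT_comp mh).
have EY : (\int[distribution P Y']_x (h x)%:E = \int[P]_w (h (Y w))%:E)%E.
  rewrite (@integral_distribution _ _ _ _ _ P Y' (EFin \o h))//; first exact/measurable_EFinP.
  by apply: bint => //; exact: (measurableT_comp mh).
have ihX : P.-integrable setT (EFin \o (fun w => h (X w))).
  by apply: bint => //; exact: (measurableT_comp mh).
have ihY : P.-integrable setT (EFin \o (fun w => h (Y w))).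
  by apply: bint => //; exact: (measurableT_comp mh).
apply: EFin_inj; rewrite EFinM -!integral_EFin_Rintegral//; last first.
  apply: bint => [|w]; last by rewrite normrM mulr_ile1.
  by apply: measurable_realfun.measurable_funM; exact: (measurableT_comp mh).
transitivity (\int[distribution P Z']_z (hh z)%:E)%E.
  rewrite (@integral_distribution _ _ _ _ _ P Z' (EFin \o hh))//; first exact/measurable_EFinP.
  by apply: bint => //; exact: (measurableT_comp mhh).
transitivity (\int[(distribution P X' \x distribution P Y')%E]_z (hh z)%:E)%E.
  by apply: eq_measure_integral => A mA _; exact/esym/prodE.
rewrite -(integral12_prod_meas1 iprod) /fubini_F /=.
rewrite -EX -EY.
have iX : (distribution P X').-integrable setT (EFin \o h) by exact: bint.
have iY : (distribution P Y').-integrable setT (EFin \o h) by exact: bint.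
rewrite (integral_EFin_Rintegral measurableT iY) -integralZr//.
apply: eq_integral => x _; rewrite -(integral_EFin_Rintegral measurableT iY) -integralZl//.
Qed.

End independence.

(** * Variance of an empirical mean *)

Section empirical_mean.
Context {R : realType} d1 (Omega : measurableType d1) (P : probability Omega R).
Variables (N : nat) (Z : nat -> Omega -> R) (e : R).
Hypotheses (N_gt0 : (0 < N)%N) (mZ : forall k, (k < N)%N -> measurable_fun setT (Z k))
  (Z1 : forall k w, `|Z k w| <= 1)
  (EZ : forall k, (k < N)%N -> \int[P]_w Z k w = e)
  (EZZ : forall k l, (k < N)%N -> (l < N)%N -> k != l ->
     \int[P]_w (Z k w * Z l w) = e ^+ 2).

(** The covariances vanish off the diagonal and each of the N diagonal terms is at most
    [E Z_k^2 <= 1]; their sum is divided by N^2. *)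
Lemma empirical_mean_variance :
  (\int[P]_w ((N%:R^-1 * \sum_(k < N) Z k w - e) ^+ 2)%:E <= (N%:R^-1)%:E)%E.
Proof.
have N0 : N%:R != 0 :> R by rewrite pnatr_eq0 -lt0n.
have iZ k : (k < N)%N -> P.-integrable setT (EFin \o Z k).
  by move=> kN; apply: (@integrable_prob_bounded _ _ _ P _ 1) => //; exact: mZ.
have iZZ k l : (k < N)%N -> (l < N)%N -> P.-integrable setT (EFin \o (fun w => Z k w * Z l w)).
  move=> kN lN; apply: (@integrable_prob_bounded _ _ _ P _ 1) => [|w].
    by apply: measurable_realfun.measurable_funM; exact: mZ.
  by rewrite normrM mulr_ile1.
have ic (c : R) : P.-integrable setT (EFin \o (fun=> c)).
  by apply: (@integrable_prob_bounded _ _ _ P _ `|c|).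
pose G (k l : 'I_N) w := (Z k w * Z l w - e * Z k w) - e * Z l w + e ^+ 2.
have iG k l : P.-integrable setT (EFin \o G k l).
  rewrite /G; apply: RintegrableD => //; apply: RintegrableB => //; last exact/RintegrableZ/iZ.
  by apply: RintegrableB => //; [exact: iZZ|exact/RintegrableZ/iZ].
have EG k l : \int[P]_w G k l w = \int[P]_w (Z k w * Z l w) - e ^+ 2.
  rewrite /G RintegralD//; last first.
    apply: RintegrableB => //; last exact/RintegrableZ/iZ.
    by apply: RintegrableB => //; [exact: iZZ|exact/RintegrableZ/iZ].
  rewrite RintegralB//; [|by apply: RintegrableB => //; [exact: iZZ|exact/RintegrableZ/iZ]
    |exact/RintegrableZ/iZ].
  rewrite RintegralB//; [|exact: iZZ|exact/RintegrableZ/iZ].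
  rewrite !RintegralZl//; [|exact: iZ|exact: iZ].
  by rewrite !EZ// Rintegral_prob_cst; ring.
have -> : (\int[P]_w ((N%:R^-1 * \sum_(k < N) Z k w - e) ^+ 2)%:E =
    \int[P]_w (N%:R^-2 * \sum_(k < N) \sum_(l < N) G k l w)%:E)%E.
  apply: eq_integral => w _; congr EFin.
  have E : N%:R^-1 * \sum_(k < N) Z k w - e = N%:R^-1 * \sum_(k < N) (Z k w - e).
    rewrite sumrB mulrBr sumr_const card_ord -mulr_natl; congr (_ - _).
    by field.
  rewrite E exprMn exprVn; congr (_ * _).
  rewrite expr2 mulr_suml; apply: eq_bigr => k _; rewrite mulr_sumr.
  by apply: eq_bigr => l _; rewrite /G; ring.
have iS : P.-integrable setT (EFin \o (fun w => \sum_(k < N) \sum_(l < N) G k l w)).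
  by apply: Rintegrable_sum => // k; exact: Rintegrable_sum.
rewrite integral_EFin_Rintegral//; last exact: RintegrableZ.
rewrite lee_fin RintegralZl//.
rewrite Rintegral_sum//; last by move=> k; exact: Rintegrable_sum.
apply: (@le_trans _ _ (N%:R^-2 * \sum_(k < N) 1)); last first.
  by rewrite sumr_const card_ord expr2 invfM -mulrA mulVf// mulr1.
rewrite ler_wpM2l ?invr_ge0 ?exprn_ge0//; apply: ler_sum => k _.
rewrite Rintegral_sum// (bigD1 k)//= big1 ?addr0; last first.
  by move=> l lk; rewrite EG EZZ ?subrr// eq_sym.
rewrite EG; apply: (@le_trans _ _ (\int[P]_w (Z k w * Z k w))); first by rewrite gerBl sqr_ge0.
rewrite -[leRHS](Rintegral_prob_cst P); apply: le_Rintegral => //; first exact: iZZ.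
move=> w _; apply: le_trans (ler_norm _) _; by rewrite normrM mulr_ile1.
Qed.

Lemma measurable_empirical_mean :
  measurable_fun setT (fun w => N%:R^-1 * \sum_(k < N) Z k w).
Proof.
apply: measurable_realfun.measurable_funM => //.
rewrite (_ : (fun _ => _) = (fun w => \sum_(k < N) (if (k < N)%N then Z k w else 0))).
  by apply: measurable_sum => k; rewrite ltn_ord; exact: mZ.
by apply/funext => w; apply: eq_bigr => k _; rewrite ltn_ord.
Qed.

End empirical_mean.

(** * Mean square error of the empirical Fourier transform *)

Section empirical_fourier.
Context {R : realType} (s T : R) (s_gt0 : 0 < s) (d : nat).
Notation Q := (cube s d).
Notation cosw := (cosw s).
Notation sinw := (sinw s).
Context (disp : measure_display) (Omega : measurableType disp) (P : probability Omega R).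
Variables (X : R -> 'rV[R]_d -> 'rV[R]_d) (mu : R -> 'rV[R]_d -> R) (sigma : R).
Variables (N M : nat) (X0 : nat -> Omega -> 'rV[R]_d)
  (eps : nat -> nat -> Omega -> 'rV[R]_d).
Hypothesis model : sampling_model s P (mu 0) sigma N M X0 eps.
Hypothesis mu_push : pushforward_density s T X mu.
Variables (t : R).
Hypothesis t0T : t \in `[0, T].
Hypotheses (mum : measurable_fun Q (mu t)) (mu0 : forall x, Q x -> 0 <= mu t x).
Hypothesis N_gt0 : (0 < N)%N.
Let mQ := @measurable_cube R s d.

(** [mu t] describes the law of a position modulo the lattice, so the representative in the cube is
    the variable with density [mu t]. Periodic functions take the same value at both. *)
Let Y k w : 'rV[R]_d := Defs.wrap s (X t (X0 k w)).

Let mY k : (k < N)%N -> measurable_fun setT (Y k).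
Proof.
move=> kN; have [H _ _] := model; have [mX0 _] := H k kN.
have [mXt _] := mu_push t0T.
exact: (measurableT_comp (@measurable_wrap R s d) (measurableT_comp mXt mX0)).
Qed.

Let Y_density k A : (k < N)%N -> measurable A ->
  P (Y k @^-1` A) = (\int[leb d]_(x in Q) (mu t x * \1_A x)%:E)%E.
Proof.
move=> kN mA; have [H _ _] := model; have [mX0 dX0] := H k kN.
have [mXt pXt] := mu_push t0T.
have mB : measurable [set x | A (Defs.wrap s (X t x))].
  have := measurableT_comp (@measurable_wrap R s d) mXt => /(_ measurableT A mA).
  by rewrite setTI.
rewrite -[LHS]/(P (X0 k @^-1` [set x | A (Defs.wrap s (X t x))])) dX0// pXt//.
rewrite integral_mkcondr; apply: eq_integral => x _.
rewrite patchE indicE; case: (x \in A); first by rewrite mulr1.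
by rewrite mulr0.
Qed.

(** Conservation of mass, read off from the law of one particle. *)
Let mass : (\int[leb d]_(x in Q) (mu t x)%:E = 1)%E.
Proof.
have := Y_density N_gt0 measurableT; rewrite preimage_setT probability_setT => ->.
by apply: eq_integral => x _; rewrite indicT mulr1.
Qed.

Let imu : (leb d).-integrable Q (EFin \o mu t).
Proof.
apply/integrableP; split; first exact/measurable_EFinP.
rewrite (eq_integral (EFin \o mu t)); first by rewrite [X in (X < _)%E]mass ltry.
by move=> x /[!inE] Qx; rewrite /= ger0_norm// mu0.
Qed.

Let imuh (h : 'rV[R]_d -> R) : measurable_fun setT h -> (forall x, `|h x| <= 1) ->
  (leb d).-integrable Q (EFin \o (fun x => mu t x * h x)).
Proof.
move=> mh h1; apply: (le_integrable mQ _ _ imu).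
  apply/measurable_EFinP; apply: measurable_realfun.measurable_funM => //.
  exact: measurable_funTS.
by move=> x Qx /=; rewrite lee_fin normrM ler_piMr.
Qed.

Let Y_integral k (h : 'rV[R]_d -> R) : (k < N)%N -> measurable_fun setT h ->
  (forall x, `|h x| <= 1) ->
  \int[P]_w h (Y k w) = \int[leb d]_(x in Q) (mu t x * h x).
Proof.
move=> kN mh h1.
pose Ym : {mfun Omega >-> 'rV[R]_d} := HB.pack (Y k) (isMeasurableFun.Build _ _ _ _ _ (mY kN)).
have mhY : measurable_fun setT (fun w => h (Y k w)).
  exact: (measurableT_comp mh (mY kN)).
have ihY : P.-integrable setT (EFin \o (fun w => h (Y k w))).
  exact: (@integrable_prob_bounded _ _ _ P _ 1).
have i1 : P.-integrable setT (EFin \o (fun=> 1)).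
  by apply: (@integrable_prob_bounded _ _ _ P _ 1) => // w; rewrite normr1.
(* The density formula is for nonnegative integrands. As [|h| <= 1], [h + 1] qualifies, and the
   added 1 cancels because both measures have mass 1. *)
have h0 x : 0 <= h x + 1 by have := h1 x; rewrite ler_norml; lra.
have mh1 : measurable_fun setT (fun x => (h x + 1)%:E).
  by apply/measurable_EFinP; apply: measurable_realfun.measurable_funD.
have nuE A : measurable A -> distribution P Ym A =
    (\int[leb d]_(x in Q) (mu t x * \1_A (idfun x))%:E)%E by exact: Y_density.
have := ge0_integral_density mQ mum mu0 (@measurable_id _ _ setT) nuE mh1.
rewrite ge0_integral_distribution// => /(_ (fun x => h0 x)).
rewrite (_ : (\int[P]_x _)%E = (\int[P]_w (h (Y k w) + 1)%:E)%E)//.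
rewrite integral_EFin_Rintegral//; last exact: RintegrableD.
rewrite RintegralD// Rintegral_prob_cst.
under [in X in _ = X -> _]eq_integral do rewrite -EFinM mulrDr mulr1.
rewrite integral_EFin_Rintegral//; last by apply: RintegrableD => //; exact: imuh.
rewrite RintegralD//; last exact: imuh.
have -> : \int[leb d]_(x in Q) mu t x = 1 by rewrite /Rintegral mass.
by move=> [/addIr].
Qed.

(** Mutual independence of all the data is applied with the preimages of [A] and [B] under the
    wrapped flow for two initial positions, and with the whole space for every other position and
    all the noise. *)
Let Y_indep k l A B : (k < N)%N -> (l < N)%N -> k != l -> measurable A -> measurable B ->
  P (Y k @^-1` A `&` Y l @^-1` B) = (P (Y k @^-1` A) * P (Y l @^-1` B))%E.
Proof.
move=> kN lN kl mA mB; have [_ _ H] := model.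
have [mXt _] := mu_push t0T.
pose pre (C : set 'rV[R]_d) := [set x | C (Defs.wrap s (X t x))].
have mpre C : measurable C -> measurable (pre C).
  move=> mC; have := measurableT_comp (@measurable_wrap R s d) mXt => /(_ measurableT C mC).
  by rewrite setTI.
pose k' : 'I_N + 'I_M * 'I_N := inl (Ordinal kN).
pose l' : 'I_N + 'I_M * 'I_N := inl (Ordinal lN).
have lk' : l' != k' by apply: contra kl => /eqP[->].
pose C (a : 'I_N + 'I_M * 'I_N) : set 'rV[R]_d :=
  if a == k' then pre A else if a == l' then pre B else setT.
have mC a : measurable (C a).
  by rewrite /C; case: ifP => _; [exact: mpre|case: ifP => _; [exact: mpre|exact: measurableT]].
have := H C mC.
rewrite (bigD1 k')//= (bigD1 l')//= big1 ?mule1; last first.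
  by move=> a /andP[ak al]; rewrite /C (negbTE ak) (negbTE al) preimage_setT probability_setT.
rewrite /C !eqxx (negbTE lk') => <-; congr (P _).
apply/seteqP; split => [w [Aw Bw] a _|w Cw].
  rewrite /=; case: eqP => [->//|_]; case: eqP => [->//|_]//.
split.
  by have := Cw k' I; rewrite /= eqxx.
by have := Cw l' I; rewrite /= eqxx (negbTE lk').
Qed.

Lemma sum_Complex (I : Type) (S : seq I) (a b : I -> R) :
  \sum_(k <- S) Complex (a k) (b k) = Complex (\sum_(k <- S) a k) (\sum_(k <- S) b k).
Proof. by elim: S => [|k S ih]; rewrite ?big_nil// !big_cons ih. Qed.

Definition emp_cos (u : 'rV[int]_d) w := N%:R^-1 * \sum_(k < N) cosw u (X t (X0 k w)).
Definition emp_sin (u : 'rV[int]_d) w := N%:R^-1 * \sum_(k < N) sinw u (X t (X0 k w)).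

Lemma fourier_empE u w :
  fourier_emp s N (fun t k => X t (X0 k w)) t u = Complex (emp_cos u w) (- emp_sin u w).
Proof.
rewrite /fourier_emp; under eq_bigr do rewrite characterE.
rewrite sum_Complex sumrN /emp_cos /emp_sin.
by rewrite /GRing.mul/= !mul0r subr0 addr0 mulrN.
Qed.

Lemma emp_wave_variance (h : 'rV[R]_d -> R) : torus_periodic s h ->
  measurable_fun setT h -> (forall x, `|h x| <= 1) ->
  let Z w := N%:R^-1 * \sum_(k < N) h (X t (X0 k w)) in
  measurable_fun setT Z /\
  (\int[P]_w ((Z w - \int[leb d]_(x in Q) (mu t x * h x)) ^+ 2)%:E <= (N%:R^-1)%:E)%E.
Proof.
move=> hp mh h1 Z.
have hY k w : h (X t (X0 k w)) = h (Y k w) by rewrite wrap_periodic.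
have mZ k : (k < N)%N -> measurable_fun setT (fun w => h (X t (X0 k w))).
  by move=> kN; under eq_fun do rewrite hY; exact: (measurableT_comp mh (mY kN)).
have Z1 k w : `|h (X t (X0 k w))| <= 1 by [].
split; first by apply: (measurable_empirical_mean mZ).
apply: (empirical_mean_variance N_gt0 mZ Z1).
- by move=> k kN; under eq_Rintegral do rewrite hY; exact: Y_integral.
- move=> k l kN lN kl; under eq_Rintegral do rewrite !hY.
  rewrite (indep_Rintegral (mY kN) (mY lN) mh h1); last by move=> A B; exact: Y_indep.
  by rewrite !Y_integral// expr2.
Qed.

(** The real and the imaginary part contribute [1 / N] each. *)
Lemma emp_fourier_variance u :
  let D w := normc (fourier_emp s N (fun t k => X t (X0 k w)) t u - fourierR s (mu t) u) ^+ 2 in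
  measurable_fun setT D /\ (\int[P]_w (D w)%:E <= (2 / N%:R)%:E)%E.
Proof.
have mc : measurable_fun setT (cosw u) by exact: measurable_cosw.
have ms : measurable_fun setT (sinw u) by exact: measurable_sinw.
have [mC vC] := emp_wave_variance (cosw_per s_gt0 u) mc (cosw_le1 s u).
have [mS vS] := emp_wave_variance (sinw_per s_gt0 u) ms (sinw_le1 s u).
have ic : (leb d).-integrable Q (EFin \o (fun x => mu t x * cosw u x)).
  by apply: imuh => //; exact: cosw_le1.
have is_ : (leb d).-integrable Q (EFin \o (fun x => mu t x * sinw u x)).
  by apply: imuh => //; exact: sinw_le1.
move=> D.
have DE w : D w = (emp_cos u w - coefA s (mu t) u) ^+ 2 + (emp_sin u w - coefB s (mu t) u) ^+ 2.
  rewrite /D fourier_empE fourierRE// sqr_normcE/=.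
  by rewrite opprK addrC -sqrrN; ring.
have mD1 : measurable_fun setT (fun w => (emp_cos u w - coefA s (mu t) u) ^+ 2).
  by apply: measurable_funX; apply: measurable_realfun.measurable_funB.
have mD2 : measurable_fun setT (fun w => (emp_sin u w - coefB s (mu t) u) ^+ 2).
  by apply: measurable_funX; apply: measurable_realfun.measurable_funB.
have mDD : measurable_fun setT D.
  by rewrite (funext DE); exact: measurable_realfun.measurable_funD.
split => //.
under eq_integral do rewrite DE EFinD.
rewrite ge0_integralD//; last 4 first.
- by move=> w _; rewrite lee_fin sqr_ge0.
- exact/measurable_EFinP.
- by move=> w _; rewrite lee_fin sqr_ge0.
- exact/measurable_EFinP.
rewrite mulr_natl mulr2n EFinD; exact: (leeD vC vS).
Qed.

End empirical_fourier.

(** * Measurability *)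

Section periodize_measurable.
Context {R : realType} (s : R) (s_gt0 : 0 < s) (d : nat).
Notation Q := (cube s d).
Let mQ := @measurable_cube R s d.

Lemma finite_lattice_box (K : nat) :
  finite_set [set z : 'rV[int]_d | forall i, (`|z ord0 i| <= K)%N].
Proof.
pose f (v : 'rV['I_(K + K).+1]_d) : 'rV[int]_d := \row_i ((v ord0 i)%:Z - K%:Z).
apply: (sub_finite_set (B := f @` setT)); last exact/finite_image/finite_finset.
move=> z /= zK; exists (\row_i inord (absz (z ord0 i + K%:Z))) => //.
apply/rowP => i; rewrite !mxE; have := zK i; move: (z ord0 i) => y yK.
by rewrite inordK; lia.
Qed.

(** The translates meeting the support are those in a bounded box, the same for all points of the
    cube. A single finite list thus replaces a summation range depending on [x]. *)
Lemma periodize_bounded (V : nmodType) (f : 'rV[R]_d -> V) (C : R) (p : 'rV[R]_d) :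
  (forall y, f y != 0 -> forall i, `|y ord0 i| <= C) ->
  exists S : seq 'rV[int]_d, forall x, Q x ->
    periodize s f (x - p) = \sum_(z <- S) f (x - p - lattice s z).
Proof.
move=> fC.
(* The bound on [|z_i|] implied by [|x_i - p_i - s z_i| <= C] and [|x_i| <= s / 2]. *)
pose B := (s / 2 + \sum_i `|p ord0 i| + `|C|) / s.
pose K := Num.bound B.
have hK := finite_lattice_box K.
exists (finmap.enum_fset (fset_set [set z : 'rV[int]_d | forall i, (`|z ord0 i| <= K)%N])) => x Qx.
rewrite -fsbig_finite// /periodize; apply/esym/fsbig_widen => // z [_ /= zK].
apply: contrapT => /eqP /fC H; apply: zK => i.
have := H i; rewrite !mxE => h1; have h2 := Qx i.
have h3 : `|p ord0 i| <= \sum_i `|p ord0 i| by rewrite (bigD1 i)//= lerDl sumr_ge0.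
have h4 : s * `|(z ord0 i)%:~R : R| <= s / 2 + \sum_i `|p ord0 i| + `|C|.
  have -> : s * `|(z ord0 i)%:~R : R| = `|s * (z ord0 i)%:~R| by rewrite normrM gtr0_norm.
  have := ler_norm C; move: h1 h2 h3; rewrite !ler_norml.
  by move: (ler_norm (p ord0 i)) (ler_norm (- p ord0 i)); rewrite normrN; lra.
have B0 : 0 <= B.
  apply: divr_ge0; last exact: ltW.
  by rewrite !addr_ge0 ?sumr_ge0// divr_ge0// ltW.
have h5 : `|(z ord0 i)%:~R : R| <= B by rewrite ler_pdivlMr// mulrC.
have := le_lt_trans h5 (archi_boundP B0).
by rewrite -/K -intr_norm -abszE -pmulrn ltr_nat => /ltnW.
Qed.

Lemma measurable_periodize (f : 'rV[R]_d -> R) (C : R) (p : 'rV[R]_d) :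
  (forall y, f y != 0 -> forall i, `|y ord0 i| <= C) -> measurable_fun setT f ->
  measurable_fun Q (fun x => periodize s f (x - p)).
Proof.
move=> fC mf; have [S hS] := periodize_bounded p fC.
apply: (@eq_measurable_fun _ _ _ _ Q (fun x : 'rV[R]_d => \sum_(z <- S) f (x - p - lattice s z))).
  by move=> x /[!inE] Qx; rewrite hS.
apply: measurable_sum => z; apply: measurable_funTS.
rewrite (_ : (fun x => _) = (fun x : 'rV[R]_d => f (x + (- p - lattice s z)))).
  exact: (measurableT_comp mf (measurable_add_rV _)).
by apply/funext => x; rewrite addrA.
Qed.

Lemma measurable_periodize_coord (f : 'rV[R]_d -> 'rV[R]_d) (C : R) (p : 'rV[R]_d) (i : 'I_d) :
  (forall y, f y != 0 -> forall i, `|y ord0 i| <= C) ->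
  measurable_fun setT (fun y => f y ord0 i) ->
  measurable_fun Q (fun x => periodize s f (x - p) ord0 i).
Proof.
move=> fC mf; have [S hS] := periodize_bounded p fC.
apply: (@eq_measurable_fun _ _ _ _ Q (fun x : 'rV[R]_d => \sum_(z <- S) f (x - p - lattice s z) ord0 i)).
  by move=> x /[!inE] Qx; rewrite hS// summxE.
apply: measurable_sum => z; apply: measurable_funTS.
rewrite (_ : (fun x => _) = (fun x : 'rV[R]_d => f (x + (- p - lattice s z)) ord0 i)).
  exact: (measurableT_comp mf (measurable_add_rV _)).
by apply/funext => x; rewrite addrA.
Qed.

Lemma periodize_ge0 (f : 'rV[R]_d -> R) x : (forall y, 0 <= f y) -> 0 <= periodize s f x.
Proof. by move=> f0; rewrite /periodize fsumr_ge0. Qed.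

End periodize_measurable.

(** * Measurability of the estimators in the space variable *)

Section measurable_estimators.
Context {R : realType} (s T : R) (s_gt0 : 0 < s) (d : nat).
Notation Q := (cube s d).
Let mQ := @measurable_cube R s d.
Variables (kappa : 'rV[R]_d -> R) (C1 : R).
Hypotheses (kappa_kernel : is_kernel s kappa) (kappa_grad : kernel_gradient_bound s C1 kappa).
Variables (N M : nat) (theta : R) (theta_gt0 : 0 < theta).
Variables (pos : R -> nat -> 'rV[R]_d) (e : nat -> nat -> 'rV[R]_d).

Let mk : measurable_fun setT kappa. Proof. by have [[]] := kappa_kernel. Qed.
Let k0 y : 0 <= kappa y. Proof. by have [[]] := kappa_kernel. Qed.
Let kQ y : ~ Q y -> kappa y = 0. Proof. by have [[_ _ _ h] _ _ _] := kappa_kernel; exact: h. Qed.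

Lemma measurable_scale_rV (c : R) : measurable_fun setT (fun y : 'rV[R]_d => c *: y).
Proof.
apply: measurable_rVP => i; under eq_fun do rewrite mxE.
by apply: measurable_realfun.measurable_funM => //; exact: measurable_coord.
Qed.

(** On nonnegative reals the inverse is the power -1, also at 0 where both are 0. *)
Lemma measurable_invr_ge0 D (f : 'rV[R]_d -> R) : measurable D -> measurable_fun D f ->
  (forall x, D x -> 0 <= f x) -> measurable_fun D (fun x => (f x)^-1).
Proof.
move=> mD mf f0; apply: (eq_measurable_fun (fun x => f x `^ (-1))).
  by move=> x /[!inE] Dx; rewrite powR_inv1// f0.
exact: (measurableT_comp (measurable_powR (-1)) mf).
Qed.

Let scaled_cube y : Q (theta^-1 *: y) -> forall i, `|y ord0 i| <= theta * (s / 2).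
Proof.
move=> Qy i; have := Qy i; rewrite mxE normrM gtr0_norm ?invr_gt0//.
by rewrite mulrC ler_pdivrMr// mulrC.
Qed.

(** On the open cube the partial derivative is the pointwise limit of the difference quotients with
    steps [1 / (n + 1)], which are measurable as [kappa] is; elsewhere [kgrad] is 0. *)
Lemma measurable_kgrad i : measurable_fun setT (fun y => kgrad s kappa y ord0 i).
Proof.
rewrite (_ : (fun y => _) = (fun y => 'D_(delta_mx ord0 i) kappa y) \_ (open_cube s d)); last first.
  apply/funext => y; rewrite /kgrad patchE.
  by case: asboolP => oy; [rewrite mem_set// mxE|rewrite memNset// mxE].
apply/(measurable_restrictT _ _).1; first exact: measurable_open_cube.
pose v : 'rV[R]_d := delta_mx ord0 i.
pose h (n : nat) (y : 'rV[R]_d) : R := (n.+1%:R^-1)^-1 * (kappa (y + n.+1%:R^-1 *: v) - kappa y).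
apply: (@measurable_fun_cvg _ _ _ _ h).
  move=> n; apply: measurable_funTS; apply: measurable_realfun.measurable_funM => //.
  apply: measurable_realfun.measurable_funB => //.
  exact: (measurableT_comp mk (measurable_add_rV _)).
move=> y oy; have [dk _] := kappa_grad oy.
have dv : derivable kappa y v by exact: diff_derivable.
have n0 : (fun n : nat => n.+1%:R^-1 : R) @ \oo --> (0 : R)^'.
  move=> A; rewrite /dnbhs /within /= => /cvg_harmonic [n _ nA].
  by exists n => // m nm; apply: (nA m nm); rewrite invr_eq0 pnatr_eq0.
have c := cvg_comp _ _ n0 dv.
rewrite [X in X @ _ --> _](_ : _ = (fun t : R => t^-1 *: ((kappa \o shift y) (t *: v) - kappa y))
   \o (fun n : nat => n.+1%:R^-1)); first exact: c.
by apply/funext => n; rewrite /h /= [y + _]addrC.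
Qed.

Lemma measurable_weight j k : measurable_fun Q (weight s T kappa M theta pos j k).
Proof.
apply: (measurable_periodize s_gt0 (C := theta * (s / 2))).
  move=> y; rewrite /kappa_theta mulf_eq0 negb_or => /andP[_ ky].
  by apply: scaled_cube; apply: contrapT => /kQ; apply/eqP.
apply: measurable_realfun.measurable_funM => //.
exact: (measurableT_comp mk (measurable_scale_rV _)).
Qed.

Lemma weight_ge0 j k x : 0 <= weight s T kappa M theta pos j k x.
Proof.
apply: periodize_ge0 => y; rewrite /kappa_theta mulr_ge0// invr_ge0 exprn_ge0//.
exact: ltW.
Qed.

Lemma measurable_Z_theta j : measurable_fun Q (Z_theta s T kappa N M theta pos j).
Proof. by apply: measurable_sum => k; exact: measurable_weight. Qed.

Lemma Z_theta_ge0 j x : 0 <= Z_theta s T kappa N M theta pos j x.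
Proof. by apply: sumr_ge0 => k _; exact: weight_ge0. Qed.

Let mZ0 j : measurable_fun Q (fun x => Z_theta s T kappa N M theta pos j x == 0).
Proof. by apply: measurable_fun_eqr => //; exact: measurable_Z_theta. Qed.

Let measurable_ifZ j (f g : 'rV[R]_d -> R) : measurable_fun Q f -> measurable_fun Q g ->
  measurable_fun Q (fun x => if Z_theta s T kappa N M theta pos j x == 0 then f x else g x).
Proof.
move=> mf mg; apply: measurable_fun_if => //.
  by apply: (measurable_funS mQ) mf; exact: subIsetl.
by apply: (measurable_funS mQ) mg; exact: subIsetl.
Qed.

Lemma measurable_v_hat j i : measurable_fun Q (fun x => v_hat s T kappa N M theta pos e j x ord0 i).
Proof.
rewrite /v_hat; set j' := minn _ _.
under eq_fun do rewrite (fun_if (fun y : 'rV[R]_d => y ord0 i)).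
apply: measurable_ifZ; first exact: measurable_cst.
under eq_fun do rewrite mxE summxE.
apply: measurable_realfun.measurable_funM.
  by apply: measurable_invr_ge0 => //; [exact: measurable_Z_theta|move=> x _; exact: Z_theta_ge0].
apply: measurable_sum => k; under eq_fun do rewrite mxE.
by apply: measurable_realfun.measurable_funM => //; exact: measurable_weight.
Qed.

Lemma measurable_score_hat j i :
  measurable_fun Q (fun x => score_hat s T kappa N M theta pos j x ord0 i).
Proof.
rewrite /score_hat.
under eq_fun do rewrite (fun_if (fun y : 'rV[R]_d => y ord0 i)).
apply: measurable_ifZ; first exact: measurable_cst.
under eq_fun do rewrite !mxE summxE.
apply: measurable_realfun.measurable_funM => //.
have mkt : measurable_fun setT (fun y : 'rV[R]_d => kappa (theta^-1 *: y)).
  exact: (measurableT_comp mk (measurable_scale_rV _)).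
apply: measurable_realfun.measurable_funM.
  apply: measurable_invr_ge0 => //.
    apply: measurable_sum => k; apply: (measurable_periodize s_gt0 (C := theta * (s / 2))) => //.
    move=> y ky; apply: scaled_cube; apply: contrapT => /kQ h.
    by rewrite h eqxx in ky.
  by move=> x _; apply: sumr_ge0 => k _; exact: periodize_ge0.
apply: measurable_sum => k; apply: (measurable_periodize_coord s_gt0 (C := theta * (s / 2))).
  move=> y; rewrite /kgrad; case: asboolP; last by rewrite eqxx.
  by move=> /open_cubeW Qy _; exact: scaled_cube.
exact: (measurableT_comp (measurable_kgrad i) (measurable_scale_rV _)).
Qed.

Lemma measurable_g_hat j i : measurable_fun Q (fun x => g_hat s T kappa N M theta pos e j x ord0 i).
Proof.
rewrite /g_hat; under eq_fun do rewrite mxE.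
apply: measurable_realfun.measurable_funD; [exact: measurable_v_hat|exact: measurable_score_hat].
Qed.

End measurable_estimators.

(** * Integral inequalities for functions that need not be measurable *)

Section integral_no_measurability.
Context {R : realType} d0 (T : measurableType d0) (P : {measure set T -> \bar R}).
Implicit Types f b c : T -> \bar R.
Import HBNNSimple.

Lemma ge0_le_integral_nnint f b : (forall x, 0 <= f x)%E -> (forall x, f x <= b x)%E ->
  (\int[P]_x f x <= \int[P]_x b x)%E.
Proof.
move=> f0 fb; have b0 x : (0 <= b x)%E by apply: le_trans (fb x).
rewrite !ge0_integralTE//; apply: le_ereal_sup => _ [h /= hf <-].
by exists h => // x; exact: le_trans (hf x) (fb x).
Qed.

(* [f] and [b] need not be measurable: the integral of a nonnegative function is
   the supremum of the integrals of the simple functions below it. *)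
Lemma ge0_integral_le_addZ f b c (k : R) : 0 < k ->
  (forall x, 0 <= f x)%E -> (forall x, 0 <= b x)%E -> (forall x, 0 <= c x)%E ->
  measurable_fun setT c -> (forall x, f x <= k%:E * b x + c x)%E ->
  (\int[P]_x f x <= k%:E * \int[P]_x b x + \int[P]_x c x)%E.
Proof.
move=> k0 f0 b0 c0 mc fbc.
rewrite [X in (X <= _)%E]ge0_integralTE//; apply: ge_ereal_sup => _ [h /= hf <-].
rewrite -(integralT_nnsfun P h).
(* For a simple [h] below [f], the positive part of [h - c] is measurable, lies below [k b], and
   dominates [h] once [c] is added back. Additivity is thus only used for [q] and [c]. *)
pose q x := maxe ((h x)%:E - c x)%E 0%E.
have mh : measurable_fun setT (EFin \o h) by exact/measurable_EFinP.
have mq : measurable_fun setT q.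
  by apply: measurable_maxe => //; apply: emeasurable_funB.
have q0 x : (0 <= q x)%E by rewrite /q le_max lexx orbT.
have qb x : (q x <= k%:E * b x)%E.
  rewrite /q ge_max mule_ge0 ?lee_fin ?(ltW k0)// andbT.
  case: (c x) (c0 x) (fbc x) => [r| |]// _ hx; last by rewrite addeNy leNye.
  by rewrite leeBlDr//; exact: le_trans (hf x) hx.
have hq x : ((h x)%:E - c x <= q x)%E by rewrite /q le_max lexx.
have hqc x : ((h x)%:E <= q x + c x)%E.
  case: (c x) (c0 x) (hq x) => [r| |]// _; first by rewrite leeBlDr.
  by rewrite addey ?leey// gt_eqF// (lt_le_trans _ (q0 x)).
apply: (@le_trans _ _ (\int[P]_x (q x + c x))%E).
  apply: ge0_le_integral => //; [by move=> x _; rewrite lee_fin|exact: emeasurable_funD].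
rewrite ge0_integralD//; apply: leeD => //.
(* The factor [k] is pulled out of the integral of the measurable [q]; only afterwards is [k^-1 q]
   compared with [b]. *)
have qE x : q x = (k%:E * (k^-1%:E * q x))%E.
  by rewrite muleA -EFinM divff ?gt_eqF// mul1e.
have kq0 x : (0 <= k^-1%:E * q x)%E by rewrite mule_ge0// lee_fin invr_ge0 ltW.
rewrite (eq_integral (fun x => k%:E * (k^-1%:E * q x))%E); last by move=> x _; exact: qE.
rewrite ge0_integralZl//; [|exact: emeasurable_funM|by rewrite lee_fin ltW].
apply: lee_wpmul2l; first by rewrite lee_fin ltW.
apply: ge0_le_integral_nnint => // x.
by rewrite -(@lee_pmul2l _ k%:E)// -qE.
Qed.

End integral_no_measurability.

(** * Continuous functions and the coordinate sigma-algebra *)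

Section continuous_measurable.
Context {R : realType} (d : nat).

(** The sigma-algebra is generated by the coordinates, not by the topology. [f] is the limit of its
    values at the lower grid points of mesh [1 / (k + 1)]; these depend on [x] through countably
    many measurable cells. *)
Lemma continuous_measurable_rV (f : 'rV[R]_d -> R) : continuous f -> measurable_fun setT f.
Proof.
move=> cf.
pose Z (k : nat) (x : 'rV[R]_d) : 'rV[int]_d := \row_i Num.floor (k.+1%:R * x ord0 i).
pose q (k : nat) (z : 'rV[int]_d) : 'rV[R]_d := \row_i ((z ord0 i)%:~R / k.+1%:R).
apply: (@measurable_fun_cvg _ _ _ _ (fun k x => f (q k (Z k x)))).
  move=> k _ B mB; rewrite setTI.
  have mZ z : measurable [set x | Z k x = z].
    rewrite (_ : mkset _ = \bigcap_(i in [set: 'I_d])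
        ((fun x : 'rV[R]_d => (Num.floor (k.+1%:R * x ord0 i))%:~R : R) @^-1` [set (z ord0 i)%:~R])).
      apply: fin_bigcap_measurable; first exact: finite_finset.
      move=> i _; rewrite -[X in measurable X]setTI.
      have mi : measurable_fun setT (fun x : 'rV[R]_d => (Num.floor (k.+1%:R * x ord0 i))%:~R : R).
        apply: (measurableT_comp measurable_floor).
        by apply: measurable_realfun.measurable_funM => //; exact: measurable_coord.
      by apply: mi.
    apply/seteqP; split => [x <- i _|x xz]; first by rewrite /= mxE.
    by apply/rowP => i; rewrite mxE; have := xz i I => /= /intr_inj.
  rewrite (_ : _ @^-1` _ = \bigcup_n (if pickle_inv n is Some z then
      [set x | Z k x = z /\ B (f (q k z))] else set0)).
    apply: bigcup_measurable => n _; case: pickle_inv => [z|]//.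
    have [Bz|Bz] := pselect (B (f (q k z))).
      by rewrite (_ : mkset _ = [set x | Z k x = z])//; apply/seteqP; split => x // [].
    by rewrite (_ : mkset _ = set0)//; apply/seteqP; split => x // [].
  apply/seteqP; split => [x /= Bx|x [n _]].
    by exists (pickle (Z k x)) => //; rewrite pickleK_inv.
  by case: pickle_inv => [z|]// [<-].
move=> x _; apply: (@cvg_comp _ _ _ (fun k => q k (Z k x)) f _ (nbhs x)); last exact: cf.
apply/cvg_ballP => e e0; near=> k.
split => // i j; rewrite !mxE (ord1 i).
rewrite /ball/= -(@ltr_pM2l _ k.+1%:R)// -[X in X * `|_|]ger0_norm// -normrM mulrBr mulrCA divff ?gt_eqF// mulr1.
set y := _ * _; rewrite ger0_norm ?subr_ge0 ?floor_le_tmp//.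
apply: (@lt_le_trans _ _ 1).
  by rewrite ltrBlDl (lt_le_trans (floorD1_gt y))// intrD addrC.
rewrite -ler_pdivrMl// mulr1 ltW//; near: k; exact: near_infty_natSinv_lt (PosNum e0).
Unshelve. all: by end_near.
Qed.

End continuous_measurable.

(** * Consistency of the deconvolution *)

Section frequency_bound.
Context {R : realType}.
Implicit Types (z G f phi psi : R[i]) (a l : R).

Lemma sqr_normc_div z l : 0 < l -> normc (z / l%:C%C) ^+ 2 = normc z ^+ 2 / l ^+ 2.
Proof.
move=> l0; have l1 : l%:C%C != 0 :> R[i] by rewrite eq_complex/= eqxx andbT gt_eqF.
have -> : normc z ^+ 2 = normc (z / l%:C%C) ^+ 2 * l ^+ 2.
  by rewrite -(sqr_normcC l) -sqr_normcM divfK.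
by rewrite mulfK// expf_neq0// gt_eqF.
Qed.

Lemma mul_conjc z : conjc z * z = (normc z ^+ 2)%:C%C.
Proof. by case: z => a b; rewrite sqr_normcE/=; simpc; congr Complex; ring. Qed.

(** Clearing the denominator leaves two terms: splitting them costs the factor 2, and dividing by
    [|psi|^2 >= a] the factor [1 / a]. *)
Lemma deconvolution_error a G f phi psi : 0 < a -> a <= normc psi ^+ 2 ->
  normc ((G + f * phi) * conjc psi / (normc psi ^+ 2)%:C%C - f) ^+ 2 <=
  2 / a * (normc G ^+ 2 + normc f ^+ 2 * normc (psi - phi) ^+ 2).
Proof.
move=> a0 apsi; set z := _ - f.
have p0 : 0 < normc psi ^+ 2 by exact: lt_le_trans apsi.
have pn0 : (normc psi ^+ 2)%:C%C != 0 :> R[i] by rewrite eq_complex/= eqxx andbT gt_eqF.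
have zE : z * psi = G + - (f * (psi - phi)).
  rewrite /z -mul_conjc; rewrite -mul_conjc in pn0.
  move: pn0; rewrite mulf_eq0 negb_or => /andP[cn0 pn0].
  by field; rewrite cn0 pn0.
have := sqr_normcD G (- (f * (psi - phi))); rewrite -zE sqr_normcN !sqr_normcM => h.
rewrite mulrAC ler_pdivlMr//; apply: le_trans h.
by rewrite ler_wpM2l// sqr_ge0.
Qed.

(** One bound for three cases. A kept frequency is paid for by the terms in [1 / a], a discarded
    frequency of the head by the term in [1 / |phi|^2], and a discarded one of the tail by the last
    term. *)
Lemma thresholded_deconvolution_error a l G f phi psi (head : bool) : 0 < a -> 1 <= l ->
  (head -> a * l ^+ 2 <= normc phi ^+ 2 / 4 /\ 0 < normc phi ^+ 2) ->
  normc ((if a <= normc (psi / l%:C%C) ^+ 2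
          then (G + f * phi) * conjc psi / (normc psi ^+ 2)%:C%C else 0) - f) ^+ 2 <=
  2 / a * normc G ^+ 2 +
  (2 * normc f ^+ 2 / a + (if head then 4 * normc f ^+ 2 / normc phi ^+ 2 else 0))
    * normc (psi - phi) ^+ 2 +
  (if head then 0 else normc f ^+ 2).
Proof.
move=> a0 l1 hh; have l0 : 0 < l by exact: lt_le_trans l1.
have G0 := sqr_ge0 (normc G); have f0 := sqr_ge0 (normc f).
have D0 := sqr_ge0 (normc (psi - phi)).
have ai0 : 0 <= a^-1 by rewrite invr_ge0 ltW.
have l2 : 1 <= l ^+ 2 by rewrite exprn_ege1.
have fphi0 : 0 <= normc f ^+ 2 / normc phi ^+ 2 by rewrite divr_ge0// sqr_ge0.
rewrite sqr_normc_div// ler_pdivlMr ?exprn_gt0//; case: (leP (a * l ^+ 2) (normc psi ^+ 2)) => hA.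
  have apsi : a <= normc psi ^+ 2 by apply: le_trans hA; rewrite ler_peMr// ltW.
  apply: le_trans (deconvolution_error G f phi a0 apsi) _.
  rewrite [2 / a * _]mulrDr -addrA lerD2l -[leLHS]addr0 lerD//; last by case: ifP.
  rewrite [leRHS]mulrDl [leLHS](_ : _ = 2 * normc f ^+ 2 / a * normc (psi - phi) ^+ 2); last by ring.
  rewrite lerDl mulr_ge0//.
  by case: ifP => // _; rewrite -mulrA mulr_ge0.
rewrite sub0r sqr_normcN.
have a2 : 0 <= 2 / a by rewrite divr_ge0// ltW.
have t1 : 0 <= 2 / a * normc G ^+ 2 by exact: mulr_ge0.
have t2 : 0 <= 2 * normc f ^+ 2 / a * normc (psi - phi) ^+ 2.
  by apply: mulr_ge0 => //; apply: divr_ge0; [exact: mulr_ge0|exact: ltW].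
case: head hh => [/(_ isT)[hal phi0]|_]; last by rewrite addr0 lerDr addr_ge0.
(* [|psi|^2 < a l^2 <= |phi|^2 / 4] yields [|phi|^2 <= |phi|^2 / 2 + 2 |psi - phi|^2]. *)
have : normc phi ^+ 2 <= 4 * normc (psi - phi) ^+ 2.
  have := sqr_normcD psi (- (psi - phi)); rewrite sqr_normcN opprB addrCA subrr addr0.
  by lra.
rewrite addr0 [in X in _ -> X]mulrDl => hphi.
apply: (@le_trans _ _ (4 * normc f ^+ 2 / normc phi ^+ 2 * normc (psi - phi) ^+ 2)); last by lra.
rewrite mulrAC ler_pdivlMr//.
by have := ler_wpM2l f0 hphi; lra.
Qed.

End frequency_bound.

(** * Error bound for one realization of the sample *)

Section error_bound.
Context {R : realType} (s : R) (s_gt0 : 0 < s) (d : nat).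
Implicit Types (u : 'rV[int]_d) (f g : 'rV[R]_d -> R) (h : 'rV[R]_d -> R[i]).
Notation Q := (cube s d).
Notation sqint := (sqint (leb d) Q).
Let mQ := @measurable_cube R s d.

Lemma coefAB f g u : sqint f -> sqint g ->
  coefA s (fun x => f x - g x) u = coefA s f u - coefA s g u.
Proof.
move=> hf hg; rewrite /coefA -RintegralB//; try by apply: sqintM => //; exact: sqint_cosw.
by apply: eq_Rintegral => x _; rewrite mulrBl.
Qed.

Lemma coefBB f g u : sqint f -> sqint g ->
  coefB s (fun x => f x - g x) u = coefB s f u - coefB s g u.
Proof.
move=> hf hg; rewrite /coefB -RintegralB//; try by apply: sqintM => //; exact: sqint_sinw.
by apply: eq_Rintegral => x _; rewrite mulrBl.
Qed.

Lemma fourierRB f g u : sqint f -> sqint g ->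
  fourierR s (fun x => f x - g x) u = fourierR s f u - fourierR s g u.
Proof.
move=> hf hg; rewrite !fourierR_sqint//; last exact: sqintB.
by rewrite coefAB// coefBB//; simpc; congr Complex; ring.
Qed.

Lemma in_L2_subR h f : in_L2 s h -> sqint f -> in_L2 s (fun x => h x - (f x)%:C%C).
Proof.
move=> /in_L2P[hr hi] hf.
have eR : (fun x => complex.Re (h x - (f x)%:C%C)) = fun x => complex.Re (h x) - f x.
  by apply/funext => x; case: (h x).
have eI : (fun x => complex.Im (h x - (f x)%:C%C)) = fun x => complex.Im (h x).
  by apply/funext => x; case: (h x) => a b /=; rewrite oppr0 addr0.
have hR : sqint (fun x => complex.Re (h x - (f x)%:C%C)) by rewrite eR; exact: sqintB.
have hI : sqint (fun x => complex.Im (h x - (f x)%:C%C)) by rewrite eI.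
split; [by case: hR|by case: hI|].
by rewrite (sqL2E _ hI)// ltry.
Qed.

Lemma fourier_subR h f u : in_L2 s h -> sqint f ->
  fourier s (fun x => h x - (f x)%:C%C) u = fourier s h u - fourierR s f u.
Proof.
move=> /[dup] hL2 /in_L2P[hr hi] hf.
have [hR hI] := in_L2P (in_L2_subR hL2 hf).
have eR : (fun x => complex.Re (h x - (f x)%:C%C)) = fun x => complex.Re (h x) - f x.
  by apply/funext => x; case: (h x).
have eI : (fun x => complex.Im (h x - (f x)%:C%C)) = fun x => complex.Im (h x).
  by apply/funext => x; case: (h x) => a b /=; rewrite oppr0 addr0.
rewrite !fourierE// fourierR_sqint// eR eI coefAB// coefBB//.
by simpc; congr Complex; ring.
Qed.

Variables (f m : 'rV[R]_d -> R) (B : R).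
Hypotheses (f_per : torus_periodic s f) (f_sq : sqint f).
Hypotheses (m_meas : measurable_fun Q m) (m_bnd : forall x, Q x -> `|m x| <= B).
Variables (gh : 'rV[R]_d -> R) (mgh : measurable_fun Q gh).
Variables (a : R) (l : 'rV[int]_d -> R) (psi : 'rV[int]_d -> R[i]) (Fh : 'rV[R]_d -> R[i]).
Hypotheses (a_gt0 : 0 < a) (l_ge1 : forall u, 1 <= l u) (Fh_L2 : in_L2 s Fh).
Hypothesis Fh_fourier : forall u, fourier s Fh u =
  if a <= normc (psi u / (l u)%:C%C) ^+ 2
  then fourierR s gh u * conjc (psi u) / (normc (psi u) ^+ 2)%:C%C else 0.
Variables (head : pred 'rV[int]_d) (e : R).
Hypothesis headP : forall u, head u ->
  a * l u ^+ 2 <= normc (fourierR s m u) ^+ 2 / 4 /\ 0 < normc (fourierR s m u) ^+ 2.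
Hypothesis tailP : forall S : seq 'rV[int]_d, uniq S ->
  \sum_(u <- S | ~~ head u) normc (fourierR s f u) ^+ 2 <= e.

(* The second summand accounts for the frequencies of [hd] which are thresholded
   out: there |phi|^2 <= 4 |psi - phi|^2. *)
Definition noise_coef (b : R) (hd : pred 'rV[int]_d) u : R :=
  2 * normc (fourierR s f u) ^+ 2 / b +
  (if hd u then 4 * normc (fourierR s f u) ^+ 2 / normc (fourierR s m u) ^+ 2 else 0).

Lemma noise_coef_ge0 b hd u : 0 < b -> 0 <= noise_coef b hd u.
Proof.
move=> b0; have f0 := sqr_ge0 (normc (fourierR s f u)).
apply: addr_ge0; first by apply: divr_ge0; [exact: mulr_ge0|exact: ltW].
by case: ifP => // _; apply: divr_ge0; [exact: mulr_ge0|exact: sqr_ge0].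
Qed.

(** [sqL2_le_fourier] reduces the claim to finite sets of frequencies, where the bound for one
    frequency is summed; Bessel's inequality turns the terms in [G u] into the error of [gh]. *)
Lemma deconvolution_sqL2_le :
  ((s ^+ d)%:E * sqL2 s (fun x => (Fh x - (f x)%:C%C)%R) <=
   (2 / a * s ^+ d)%:E *
     \int[leb d]_(x in Q) ((gh x - rconv s f m x) ^+ 2)%:E +
   \sum_(n <oo) (nat_ext (fun u => (noise_coef a head u *
                   normc (psi u - fourierR s m u) ^+ 2)%R) n)%:E + e%:E)%E.
Proof.
have sd0 : 0 < s ^+ d by rewrite exprn_gt0.
have f_int : (leb d).-integrable Q (EFin \o f).
  by apply: sqint_integrable => //; exact: leb_cube_fin.
pose t u := noise_coef a head u * normc (psi u - fourierR s m u) ^+ 2.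
have t0 u : 0 <= t u by rewrite mulr_ge0 ?sqr_ge0// noise_coef_ge0.
have g_sq := sqint_rconv s_gt0 f_per f_int m_meas m_bnd.
have mdiff : measurable_fun Q (fun x => gh x - rconv s f m x).
  by apply: measurable_realfun.measurable_funB => //; case: g_sq.
have e0 : 0 <= e by have := tailP (S := [::]) isT; rewrite big_nil.
have ser0 : (0 <= \sum_(n <oo) (nat_ext t n)%:E)%E.
  by apply: nneseries_ge0 => n _ _; rewrite lee_fin nat_ext_ge0.
(* If the error of [gh] is infinite, so is the right-hand side. Otherwise [gh] is square integrable,
   being the sum of a square integrable error and a bounded convolution. *)
have [Ey|Efin] := eqVneq (\int[leb d]_(x in Q) ((gh x - rconv s f m x) ^+ 2)%:E)%E +oo%E.
  have k0 : 0 < 2 / a * s ^+ d by apply: mulr_gt0 => //; exact: divr_gt0.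
  rewrite Ey gt0_muley ?lte_fin//.
  by rewrite addye ?addye ?leey// gt_eqF// (lt_le_trans _ ser0).
have diff_sq : sqint (fun x => gh x - rconv s f m x).
  by apply: sqintP => //; rewrite ltey.
have gh_sq : sqint gh.
  by rewrite (_ : gh = fun x => (gh x - rconv s f m x) + rconv s f m x);
    [exact: sqintD|apply/funext => x; rewrite subrK].
pose G u := fourierR s (fun x => gh x - rconv s f m x) u.
have ghE u : fourierR s gh u = G u + fourierR s f u * fourierR s m u.
  by rewrite /G fourierRB// (fourierR_rconv s_gt0 f_per f_int m_meas m_bnd) subrK.
apply: sqL2_le_fourier => // [|S uS]; first exact: in_L2_subR.
rewrite integral_EFin_Rintegral//; last by case: diff_sq.
apply: (@le_trans _ _ ((2 / a * \sum_(u <- S) normc (G u) ^+ 2 + \sum_(u <- S) t u +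
    \sum_(u <- S | ~~ head u) normc (fourierR s f u) ^+ 2)%:E)).
  rewrite lee_fin mulr_sumr [X in _ + X]big_mkcond -!big_split.
  apply: ler_sum => u _; cbv beta; rewrite fourier_subR// Fh_fourier ghE.
  by have := thresholded_deconvolution_error (G u) (fourierR s f u) (psi u) a_gt0 (l_ge1 u) (@headP u);
     rewrite if_neg.
rewrite !EFinD; apply: leeD; last by rewrite lee_fin; exact: tailP.
apply: leeD; last exact: sum_le_nneseries.
rewrite -EFinM lee_fin -[leRHS]mulrA ler_wpM2l//; first by apply: divr_ge0 => //; exact: ltW.
exact: bessel_fourierR.
Qed.

End error_bound.

(** [S0] comes within [e] of the supremum of all finite sums, so a finite set disjoint from it adds
    at most [e]. *)
Lemma summable_tail (R : realType) (T : eqType) (G : T -> R) (V e : R) : 0 < e ->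
  (forall t, 0 <= G t) ->
  (forall S : seq T, uniq S -> \sum_(t <- S) G t <= V) ->
  exists2 S0 : seq T, uniq S0 & forall S, uniq S -> \sum_(t <- S | t \notin S0) G t <= e.
Proof.
move=> e0 G0 GV.
pose E := [set \sum_(t <- S) G t | S in [set S : seq T | uniq S]].
have hE : has_sup E.
  split; first by exists 0, [::] => //; rewrite big_nil.
  by exists V => _ [S uS <-]; exact: GV.
have [_ [S0 uS0 <-] hS0] := sup_adherent e0 hE.
exists S0 => // S uS; rewrite -big_filter.
have : \sum_(t <- S0 ++ [seq t <- S | t \notin S0]) G t <= sup E.
  apply: ub_le_sup; first by case: hE.
  exists (S0 ++ [seq t <- S | t \notin S0]) => //=; rewrite cat_uniq uS0 filter_uniq// andbT.
  by apply/hasPn => t; rewrite mem_filter => /andP[].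
by rewrite big_cat/=; move: hS0; lra.
Qed.

(** * Risk bound at a fixed sample size *)

Section expected_series.
Context {R : realType} d0 (Omega : measurableType d0) (P : probability Omega R).

(** Expectation and nonnegative series are exchanged, so a variance bound at each index is
    enough. *)
Lemma ge0_integral_nat_ext (T : countType) (D : Omega -> T -> R) (c : T -> R) (v K : R) :
  0 <= v -> (forall t, 0 <= c t) -> (forall w t, 0 <= D w t) ->
  (forall t, measurable_fun setT (D ^~ t)) ->
  (forall t, (\int[P]_w (D w t)%:E <= v%:E)%E) ->
  (forall S : seq T, uniq S -> \sum_(t <- S) c t <= K) ->
  (\int[P]_w (\sum_(n <oo) (nat_ext (fun t => (c t * D w t)%R) n)%:E) <= (K * v)%:E)%E.
Proof.
move=> v0 c0 D0 mD Dv cK.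
have cD0 w t : 0 <= c t * D w t by exact: mulr_ge0.
have mn n : measurable_fun setT (fun w => (nat_ext (fun t => c t * D w t) n)%:E).
  apply/measurable_EFinP; rewrite /nat_ext; case: pickle_inv => [t|]//=.
  exact: measurable_realfun.measurable_funM.
rewrite integral_nneseries//; last by move=> n w _; rewrite lee_fin nat_ext_ge0.
apply: (@le_trans _ _ (\sum_(n <oo) (nat_ext (fun t => (c t * v)%R) n)%:E)%E).
  apply: lee_nneseries => [n _ _|n _].
    by apply: integral_ge0 => w _; rewrite lee_fin nat_ext_ge0.
  rewrite /nat_ext; case: pickle_inv => [t|]/=; last by rewrite integral0.
  under eq_integral do rewrite EFinM.
  rewrite ge0_integralZl//; last 3 first.
  - exact/measurable_EFinP.
  - by move=> w _; rewrite lee_fin.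
  - by rewrite lee_fin.
  by rewrite EFinM lee_wpmul2l// lee_fin.
apply: nneseries_le_sum => [t|S uS]; first exact: mulr_ge0.
by rewrite -mulr_suml ler_wpM2r// cK.
Qed.

End expected_series.

Section expected_error.
Context {R : realType} (s : R) (s_gt0 : 0 < s) (d : nat).
Implicit Types (u : 'rV[int]_d).
Notation Q := (cube s d).
Notation sqint := (sqint (leb d) Q).
Context d0 (Omega : measurableType d0) (P : probability Omega R).
Variables (f m : 'rV[R]_d -> R) (B : R).
Hypotheses (f_per : torus_periodic s f) (f_sq : sqint f).
Hypotheses (m_meas : measurable_fun Q m) (m_bnd : forall x, Q x -> `|m x| <= B).
Variables (gh : Omega -> 'rV[R]_d -> R) (mgh : forall w, measurable_fun Q (gh w)).
Variables (a : R) (l : 'rV[int]_d -> R) (psi : Omega -> 'rV[int]_d -> R[i])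
  (Fh : Omega -> 'rV[R]_d -> R[i]).
Hypotheses (a_gt0 : 0 < a) (l_ge1 : forall u, 1 <= l u) (Fh_L2 : forall w, in_L2 s (Fh w)).
Hypothesis Fh_fourier : forall w u, fourier s (Fh w) u =
  if a <= normc (psi w u / (l u)%:C%C) ^+ 2
  then fourierR s (gh w) u * conjc (psi w u) / (normc (psi w u) ^+ 2)%:C%C else 0.
Variables (S0 : seq 'rV[int]_d) (e v : R).
Hypothesis uS0 : uniq S0.
Hypothesis headP : forall u, u \in S0 ->
  a * l u ^+ 2 <= normc (fourierR s m u) ^+ 2 / 4 /\ 0 < normc (fourierR s m u) ^+ 2.
Hypothesis tailP : forall S : seq 'rV[int]_d, uniq S ->
  \sum_(u <- S | u \notin S0) normc (fourierR s f u) ^+ 2 <= e.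
Hypothesis v_ge0 : 0 <= v.
Hypothesis psi_meas : forall u,
  measurable_fun setT (fun w => normc (psi w u - fourierR s m u) ^+ 2).
Hypothesis psi_var : forall u,
  (\int[P]_w (normc (psi w u - fourierR s m u) ^+ 2)%:E <= v%:E)%E.

Definition head_mass : R :=
  \sum_(u <- S0) 4 * normc (fourierR s f u) ^+ 2 / normc (fourierR s m u) ^+ 2.

(** Bessel's inequality bounds the first part of the weights; the second is supported in [S0]. *)
Lemma sum_noise_coef_le (S : seq 'rV[int]_d) : uniq S ->
  \sum_(u <- S) noise_coef s f m a (mem S0) u <=
  2 / a * (s ^+ d * \int[leb d]_(x in Q) (f x ^+ 2)) + head_mass.
Proof.
move=> uS; rewrite big_split; apply: lerD.
  rewrite (eq_bigr (fun u => 2 / a * normc (fourierR s f u) ^+ 2)); last by move=> u _; ring.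
  rewrite -mulr_sumr ler_wpM2l//; first by apply: divr_ge0 => //; exact: ltW.
  exact: bessel_fourierR.
rewrite -big_mkcond -big_filter; apply: ler_sum_subset => //; first exact: filter_uniq.
  by move=> u; rewrite mem_filter => /andP[].
by move=> u; apply: divr_ge0; [apply: mulr_ge0 => //; exact: sqr_ge0|exact: sqr_ge0].
Qed.

(** The noise series is a measurable function of the sample, whereas the errors of [Fh] and [gh]
    need not be. It takes the place of [c] in [ge0_integral_le_addZ], the only function there that
    must be measurable. *)
Lemma expected_sqL2_le :
  (\int[P]_w sqL2 s (fun x => (Fh w x - (f x)%:C%C)%R) <=
   (2 / a)%:E * \int[P]_w \int[leb d]_(x in Q) ((gh w x - rconv s f m x) ^+ 2)%:E +
   ((s ^+ d)^-1 * ((2 / a * (s ^+ d * \int[leb d]_(x in Q) (f x ^+ 2)) + head_mass) * v + e))%:E)%E.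
Proof.
have sd0 : 0 < s ^+ d by rewrite exprn_gt0.
have e0 : 0 <= e by have := tailP (S := [::]) isT; rewrite big_nil.
have a2 : 0 < 2 / a by exact: divr_gt0.
pose D w u := normc (psi w u - fourierR s m u) ^+ 2.
pose N w := (\sum_(n <oo) (nat_ext (fun u => (noise_coef s f m a (mem S0) u * D w u)%R) n)%:E)%E.
have N0 w : (0 <= N w)%E.
  apply: nneseries_ge0 => n _ _; rewrite lee_fin nat_ext_ge0// => u.
  by apply: mulr_ge0; [exact: noise_coef_ge0|exact: sqr_ge0].
have mN : measurable_fun setT N.
  apply: ge0_emeasurable_sum => [n w _ _|n _].
    rewrite lee_fin nat_ext_ge0// => u.
    by apply: mulr_ge0; [exact: noise_coef_ge0|exact: sqr_ge0].
  apply/measurable_EFinP; rewrite /nat_ext; case: pickle_inv => [u|]//=.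
  by apply: measurable_realfun.measurable_funM => //; exact: psi_meas.
have mNe : measurable_fun setT (fun w => N w + e%:E)%E by exact: emeasurable_funD.
pose c w := ((s ^+ d)^-1%:E * (N w + e%:E))%E.
have Ne0 w : (0 <= N w + e%:E)%E by rewrite adde_ge0.
have c0 w : (0 <= c w)%E by rewrite mule_ge0// lee_fin invr_ge0 ltW.
have si0 : (0 <= (s ^+ d)^-1%:E :> \bar R)%E by rewrite lee_fin invr_ge0 ltW.
have : (\int[P]_w sqL2 s (fun x => (Fh w x - (f x)%:C%C)%R) <=
    (2 / a)%:E * \int[P]_w \int[leb d]_(x in Q) ((gh w x - rconv s f m x) ^+ 2)%:E +
    \int[P]_w c w)%E.
  apply: ge0_integral_le_addZ => //.
  - by move=> w; apply: integral_ge0 => x _; rewrite lee_fin sqr_ge0.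
  - by move=> w; apply: integral_ge0 => x _; rewrite lee_fin sqr_ge0.
  - exact: emeasurable_funM.
  - move=> w; have := deconvolution_sqL2_le s_gt0 f_per f_sq m_meas m_bnd (mgh w) a_gt0
      l_ge1 (Fh_L2 w) (Fh_fourier w) (head := mem S0) headP tailP.
    rewrite -addeA -/(D w) -/(N w) => h.
    rewrite -(@lee_pmul2l _ (s ^+ d)%:E)//; apply: le_trans h _.
    set I := (\int[_]_(x in _) _)%E.
    have I0 : (0 <= I)%E by apply: integral_ge0 => x _; rewrite lee_fin sqr_ge0.
    rewrite [leRHS]ge0_muleDr ?c0//; last by apply: mule_ge0 => //; rewrite lee_fin ltW.
    rewrite muleA -EFinM [s ^+ d * _]mulrC leeD2l//.
    by rewrite /c muleA -EFinM divff ?gt_eqF// mul1e.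
move=> h; apply: le_trans h _; apply: leeD => //; rewrite /c ge0_integralZl// EFinM lee_wpmul2l//.
rewrite ge0_integralD// [X in (_ + X)%E]integral_cst// [X in (_ * X)%E](probability_setT P) mule1 EFinD leeD2r//.
apply: ge0_integral_nat_ext => //.
- by move=> u; exact: noise_coef_ge0.
- by move=> w u; exact: sqr_ge0.
- exact: sum_noise_coef_le.
Qed.

End expected_error.

(** * Convergence along a filter *)

Section limits.
Context {R : realType}.

(** The case [e = 1] makes the values eventually finite, after which convergence is checked in
    [R]. *)
Lemma cvge0P (T : Type) (Fl : set_system T) {FF : ProperFilter Fl} (f : T -> \bar R) :
  (forall x, 0 <= f x)%E ->
  (f @ Fl --> (0 : \bar R)%E) <-> (forall e : R, 0 < e -> \forall x \near Fl, (f x <= e%:E)%E).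
Proof.
move=> f0; split => [fl e e0|h].
  have : \forall y \near nbhs (0 : \bar R)%E, (y < e%:E)%E.
    by apply: open_nbhs_nbhs; split; [exact: open_ereal_lt_ereal|rewrite /= lte_fin].
  by move=> h; near=> x; apply: ltW; near: x; exact: fl h.
apply/fine_cvgP; split.
  near=> x; rewrite ge0_fin_numE//.
  by apply: (@le_lt_trans _ _ 1%E); [near: x; exact: h|rewrite ltry].
apply/cvgrPdist_le => e e0; near=> x.
have fx : (f x <= e%:E)%E by near: x; exact: h.
rewrite sub0r normrN ger0_norm/= ?fine_ge0//.
by rewrite -lee_fin fineK// ge0_fin_numE// (le_lt_trans fx)// ltry.
Unshelve. all: by end_near.
Qed.

Lemma ell_ge1 (s : R) d (u : 'rV[int]_d) : 0 <= s -> 1 <= ell s u.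
Proof.
move=> s0; have h : 1 <= 1 + \sum_i ((u ord0 i)%:~R ^+ 2) :> R.
  by rewrite lerDl sumr_ge0// => i _; exact: sqr_ge0.
have s2 : 0 <= s / 2 by rewrite divr_ge0.
by have := ler_powR h s2; rewrite powRr0.
Qed.

Lemma near_seq (T : Type) (Fl : set_system T) {FF : Filter Fl} (I : eqType) (S : seq I)
    (Q : T -> I -> Prop) :
  (forall u, u \in S -> \forall x \near Fl, Q x u) -> \forall x \near Fl, forall u, u \in S -> Q x u.
Proof.
elim: S => [_|v S ih h]; first by near=> x => u; rewrite in_nil.
have hv := h v (mem_head v S).
have hS : \forall x \near Fl, forall u, u \in S -> Q x u.
  by apply: ih => u uS; apply: h; rewrite in_cons uS orbT.
near=> x => u; rewrite in_cons => /orP[/eqP->|uS]; first by near: x.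
by have := near hS x; apply.
Unshelve. all: by end_near.
Qed.

End limits.

(** * Choice of the constants *)

Section consistency.
Context {R : realType} (side : R) (side_gt0 : 0 < side) (d : nat).
Notation Q := (cube side d).
Context (T : Type) (Fl : set_system T) {FF : ProperFilter Fl}.
Context d0 (Omega : measurableType d0) (P : probability Omega R).
Variables (f m g : 'rV[R]_d -> R) (B : R).
Hypotheses (f_per : torus_periodic side f) (f_sq : sqint (leb d) Q f).
Hypothesis g_conv : forall x, g x = rconv side f m x.
Hypotheses (m_meas : measurable_fun Q m) (m_bnd : forall x, Q x -> `|m x| <= B).
Hypothesis m_fourier : forall u, 0 < normc (fourierR side m u) ^+ 2.
Variables (a : T -> R) (l : 'rV[int]_d -> R) (n : T -> nat).
Variables (gh : T -> Omega -> 'rV[R]_d -> R) (psi : T -> Omega -> 'rV[int]_d -> R[i])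
  (Fh : T -> Omega -> 'rV[R]_d -> R[i]).
Hypotheses (l_ge1 : forall u, 1 <= l u) (Fh_L2 : forall t w, in_L2 side (Fh t w)).
Hypothesis a_gt0 : forall t, 0 < a t.
Hypothesis mgh : forall t w, measurable_fun Q (gh t w).
Hypothesis Fh_fourier : \forall t \near Fl, forall w u, fourier side (Fh t w) u =
  if a t <= normc (psi t w u / (l u)%:C%C) ^+ 2
  then fourierR side (gh t w) u * conjc (psi t w u) / (normc (psi t w u) ^+ 2)%:C%C else 0.
Hypothesis psi_var : \forall t \near Fl, forall u,
  measurable_fun setT (fun w => normc (psi t w u - fourierR side m u) ^+ 2) /\
  (\int[P]_w (normc (psi t w u - fourierR side m u) ^+ 2)%:E <= (2 / (n t)%:R)%:E)%E.
Hypotheses (a_to0 : a @ Fl --> (0 : R)) (n_gt0 : \forall t \near Fl, (0 < n t)%N).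
Hypothesis rate : (fun t => maxe ((a t * (n t)%:R)^-1)%:E
  ((\int[P]_w \int[leb d]_(x in Q) ((gh t w x - g x) ^+ 2)%:E)
     * ((a t)^-1)%:E)%E) @ Fl --> (0 : \bar R)%E.

Lemma deconvolution_consistent :
  (fun t => (\int[P]_w sqL2 side (fun x => (Fh t w x - (f x)%:C%C)%R))%E) @ Fl
    --> (0 : \bar R)%E.
Proof.
have sd0 : 0 < side ^+ d by rewrite exprn_gt0.
pose V := side ^+ d * \int[leb d]_(x in Q) (f x ^+ 2).
have V0 : 0 <= V by apply: mulr_ge0; [exact: ltW|exact: Rintegral_sqr_ge0].
apply/cvge0P => [t|e e0].
  by apply: integral_ge0 => w _; apply: integral_ge0 => x _; rewrite lee_fin sqr_ge0.
have r0 t : (0 <= maxe ((a t * (n t)%:R)^-1)%:E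
  ((\int[P]_w \int[leb d]_(x in Q) ((gh t w x - rconv side f m x) ^+ 2)%:E)
     * ((a t)^-1)%:E))%E.
  by rewrite le_max lee_fin invr_ge0 mulr_ge0// ltW.
move: rate; rewrite (_ : g = rconv side f m); last exact/funext.
move=> /(cvge0P r0).1 rate0.
(* After division by [side ^+ d] the tail contributes [e / 4]. *)
pose e' := side ^+ d * (e / 4).
have e'0 : 0 < e' by rewrite mulr_gt0// divr_gt0.
have [S0 uS0 tailP] := summable_tail e'0
  (fun u => sqr_ge0 (normc (fourierR side f u))) (fun S uS => bessel_fourierR side_gt0 uS f_sq).
pose H := head_mass side f m S0.
have H0 : 0 <= H.
  apply: sumr_ge0 => u _; apply: divr_ge0; last exact: sqr_ge0.
  by apply: mulr_ge0 => //; exact: sqr_ge0.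
(* Collects the factors of [de]: 2 from the error of [gh], and [4 * V] and [2 * H] from the weights
   times the variance [2 / n]. The choice of [de] below makes the total [e / 2]. *)
pose C := 2 + (side ^+ d)^-1 * (4 * V + 2 * H).
have si0 : 0 <= (side ^+ d)^-1 by rewrite invr_ge0 ltW.
have W0 : 0 <= 4 * V + 2 * H by lra.
have C0 : 0 < C by have := mulr_ge0 si0 W0; rewrite /C; lra.
pose de := e / 2 / C.
have de0 : 0 < de by apply: divr_gt0 => //; exact: divr_gt0.
have headP : \forall t \near Fl, forall u, u \in S0 ->
    a t * l u ^+ 2 <= normc (fourierR side m u) ^+ 2 / 4 /\ 0 < normc (fourierR side m u) ^+ 2.
  apply: near_seq => u _.
  have l0 : 0 < l u ^+ 2 by rewrite exprn_gt0// (lt_le_trans _ (l_ge1 u)).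
  have b0 : 0 < normc (fourierR side m u) ^+ 2 / 4 / l u ^+ 2 by rewrite !divr_gt0.
  have al : \forall t \near Fl, `|a t| < normc (fourierR side m u) ^+ 2 / 4 / l u ^+ 2.
    by move: b0; exact: cvgr0_norm_lt.
  near=> t; split => //; rewrite -ler_pdivlMr// ltW//.
  by apply: le_lt_trans (ler_norm _) _; near: t.
(* For [a t <= 1] one has [1 / n <= 1 / (a n)], so the assumed rate controls the term in [1 / n] as
   well. *)
have al : \forall t \near Fl, `|a t| < 1.
  by move: (@ltr01 R); exact: cvgr0_norm_lt.
apply: filter_app Fh_fourier; apply: filter_app psi_var; apply: filter_app headP.
near=> t => hd vt ht.
have nt : (0 < n t)%N by near: t.
have n0 : 0 < (n t)%:R :> R by rewrite ltr0n.
have a1 : a t <= 1.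
  by apply: le_trans (ler_norm _) _; apply: ltW; near: t.
have : (maxe ((a t * (n t)%:R)^-1)%:E
  ((\int[P]_w \int[leb d]_(x in Q) ((gh t w x - rconv side f m x) ^+ 2)%:E)
     * ((a t)^-1)%:E) <= de%:E)%E by near: t; exact: rate0.
rewrite ge_max lee_fin => /andP[h1 h2].
have v0 : 0 <= 2 / (n t)%:R :> R by rewrite divr_ge0// ltW.
apply: le_trans (expected_sqL2_le side_gt0 f_per f_sq m_meas m_bnd (mgh t) (a_gt0 t) l_ge1
  (Fh_L2 t) ht uS0 hd tailP v0 (fun u => (vt u).1) (fun u => (vt u).2)) _.
move: h2; set E2 := (\int[P]_w _)%E => h2.
have {}h2 : ((2 / a t)%:E * E2 <= (2 * de)%:E)%E.
  by rewrite EFinM -muleA [X in (_ * X)%E]muleC [leRHS]EFinM lee_wpmul2l// lee_fin.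
apply: le_trans (leeD2r _ h2) _; rewrite -EFinD lee_fin -/V -/H.
have ai0 : 0 <= (a t)^-1 by rewrite invr_ge0 ltW.
have h3 : (n t)%:R^-1 <= de.
  apply: le_trans h1; rewrite invfM.
  by apply: ler_peMl; [rewrite invr_ge0 ltW|rewrite invf_ge1].
have -> : (2 / a t * V + H) * (2 / (n t)%:R) = 4 * V * (a t * (n t)%:R)^-1 + 2 * H * (n t)%:R^-1.
  by rewrite invfM; ring.
apply: (@le_trans _ _ (2 * de + (side ^+ d)^-1 * ((4 * V + 2 * H) * de + e'))).
  rewrite lerD2l ler_wpM2l// lerD2r [leRHS]mulrDl.
  by apply: lerD; apply: ler_wpM2l => //; exact: mulr_ge0.
have -> : 2 * de + (side ^+ d)^-1 * ((4 * V + 2 * H) * de + e') = C * de + (side ^+ d)^-1 * e'.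
  by rewrite /C; ring.
rewrite /e' mulKf ?gt_eqF// /de mulrC divfK ?gt_eqF//.
lra.
Unshelve. all: by end_near.
Qed.
End consistency.

(** The proof supplies the inputs of [deconvolution_consistent]: [mu_push] gives the law of the
    positions at [tstar], [v_MV] the convolution form of [v + grad_log mu], the kernel conditions
    the measurability of [g_hat] in space, and [rate] its accuracy. *)
Theorem theorem16 (R : realType) (d : nat) (side T : R)
    (d_ge1 : (0 < d)%N) (side_gt0 : 0 < side) (T_gt0 : 0 < T)
    (* velocity field, lifted flow, density *)
    (v X : R -> 'rV[R]_d -> 'rV[R]_d) (mu : R -> 'rV[R]_d -> R)
    (v_per : forall t, t \in `[0, T] -> torus_periodic side (v t))
    (X_flow : is_flow T v X)
    (mu_per : forall t, t \in `[0, T] -> torus_periodic side (mu t))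
    (mu0_prob : (\int[leb d]_(x in cube side d) (mu 0 x)%:E = 1)%E)
    (mu_push : pushforward_density side T X mu)
    (mu_smooth : smooth_density T mu)
    (lambda1 lambda2 : R) (lambda1_gt0 : 0 < lambda1) (lambda2_gt0 : 0 < lambda2)
    (mu_bounds : forall t x, t \in `[0, T] -> lambda1 <= mu t x <= lambda2)
    (* McKean-Vlasov form of the velocity *)
    (F : 'rV[R]_d -> 'rV[R]_d) (F_per : torus_periodic side F)
    (F_int : forall k : 'I_d,
       (leb d).-integrable (cube side d) (fun x => (F x ord0 k)%:E))
    (v_MV : mckean_vlasov side T F v mu)
    (* Assumptions 1 and 2 *)
    (L : R) (assumption1 : lipschitz_velocity T L v)
    (Lv C0 : R) (assumption2_v : regular_velocity T Lv v)
    (assumption2_mu : forall y, enorm (grad_log (mu 0) y) <= C0)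
    (* kernel *)
    (kappa : 'rV[R]_d -> R) (kappa_kernel : is_kernel side kappa)
    (C1 : R) (kappa_grad : kernel_gradient_bound side C1 kappa)
    (* asymptotic regime: nm = (N, M), with bandwidth theta and regularization
       parameter alpha depending on it *)
    (Fl : set_system (nat * nat)) (Fl_filter : ProperFilter Fl)
    (N_infty : (fun nm => nm.1) @ Fl --> \oo)
    (h_to0 : (fun nm => time_step T nm.2) @ Fl --> (0 : R))
    (tstar : R) (jstar : nat -> nat)
    (tstar_grid : \forall nm \near Fl,
       [/\ (0 < nm.2)%N, (jstar nm.2 <= nm.2)%N &
           tstar = grid_time T nm.2 (jstar nm.2)])
    (theta alpha : nat * nat -> R)
    (theta01 : forall nm, 0 < theta nm < 1)
    (theta_small : forall nm, theta nm <= Num.sqrt lambda1 / Num.sqrt 2)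
    (alpha_gt0 : forall nm, 0 < alpha nm)
    (* data *)
    (disp : measure_display) (Omega : measurableType disp)
    (P : probability Omega R) (sigma : R) (sigma_ge0 : 0 <= sigma)
    (X0 : nat * nat -> nat -> Omega -> 'rV[R]_d)
    (eps : nat * nat -> nat -> nat -> Omega -> 'rV[R]_d)
    (model : forall nm,
       sampling_model side P (mu 0) sigma nm.1 nm.2 (X0 nm) (eps nm))
    (* Assumption 4 *)
    (assumption4 : forall u : 'rV[int]_d,
       0 < normc (fourierR side (mu tstar) u) ^+ 2)
    (* the estimator *)
    (i : 'I_d) (p s : R) (s_ge0 : 0 <= s) (s_le_p : s <= p)
    (Fi_Hp : in_H side p (fun x => (F x ord0 i)%:C%C))
    (F_hat : nat * nat -> Omega -> 'rV[R]_d -> R[i])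
    (F_hatP : forall nm w,
       is_F_hat side T kappa nm.1 nm.2 (theta nm)
         (fun t k => X t (X0 nm k w)) (fun j k => eps nm j k w)
         s (alpha nm) (jstar nm.2) i (F_hat nm w))
    (alpha_to0 : alpha @ Fl --> (0 : R))
    (rate : (fun nm =>
       maxe ((alpha nm * nm.1%:R)^-1)%:E
            ((\int[P]_w \int[leb d]_(x in cube side d)
                ((g_hat side T kappa nm.1 nm.2 (theta nm)
                    (fun t k => X t (X0 nm k w)) (fun j k => eps nm j k w)
                    (jstar nm.2) x ord0 i
                  - (v tstar x + grad_log (mu tstar) x) ord0 i) ^+ 2)%:E)
             * ((alpha nm)^-1)%:E)%E) @ Fl --> (0 : \bar R)%E) :
  (fun nm => (\int[P]_w
     sqL2 side (fun x => (F_hat nm w x - (F x ord0 i)%:C%C)%R))%E) @ Fl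
    --> (0 : \bar R)%E.
Proof.
(* The grid condition holds only eventually, but the filter is proper, so some instance of it exists
   and places [tstar] in [0, T]. *)
have [tT tgrid] : tstar \in `[0, T] /\ \forall nm \near Fl, tstar = grid_time T nm.2 (jstar nm.2).
  split; last by apply: filterS tstar_grid => nm [].
  have [[N M] /= [M0 jM ->]] := filter_ex tstar_grid.
  have Mr : 0 < M%:R :> R by rewrite ltr0n.
  rewrite in_itv/= /grid_time /time_step mulrA; apply/andP; split.
    by apply: divr_ge0; [apply: mulr_ge0 => //|]; exact: ltW.
  by rewrite ler_pdivrMr// mulrC ler_pM2l// ler_nat.
have f_sq : sqint (leb d) (cube side d) (fun x => F x ord0 i).
  by have [] := in_L2P (proj1 Fi_Hp).
have f_per : torus_periodic side (fun x => F x ord0 i).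
  by move=> z x; rewrite F_per.
have m_meas : measurable_fun (cube side d) (mu tstar).
  (* With the empty list of directions, smoothness is continuity of the extension of [mu]. *)
  have [m [/(_ [::])[/= cm _] muE]] := mu_smooth.
  rewrite (_ : mu tstar = fun x => m (tstar, x)); last by apply/funext => x; rewrite muE.
  apply: measurable_funTS; apply: continuous_measurable_rV => x.
  apply: (@continuous_comp _ _ _ (fun x => (tstar, x)) m); last exact: cm.
  exact: (@cvg_pair _ _ _ (nbhs x) (nbhs tstar) (nbhs x) _ _ _ (fun=> tstar) id (cvg_cst _) cvg_id).
have m_bnd x : cube side d x -> `|mu tstar x| <= lambda2.
  by move=> _; have /andP[h1 h2] := @mu_bounds _ x tT; rewrite ger0_norm// (le_trans (ltW lambda1_gt0)).
have gE x : (v tstar x + grad_log (mu tstar) x) ord0 i =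
    rconv side (fun x => F x ord0 i) (mu tstar) x.
  by rewrite v_MV// subrK mxE.
have m0 x : cube side d x -> 0 <= mu tstar x.
  by move=> _; have /andP[h1 h2] := @mu_bounds _ x tT; exact: le_trans (ltW lambda1_gt0) h1.
have N_gt0 : \forall nm \near Fl, (0 < nm.1)%N by exact: (cvgnyPge _).1 N_infty 1%N.
pose pos nm w t k := X t (X0 nm k w).
pose gh nm w x := g_hat side T kappa nm.1 nm.2 (theta nm) (pos nm w)
  (fun j k => eps nm j k w) (jstar nm.2) x ord0 i.
pose psi nm w u := fourier_emp side nm.1 (pos nm w) tstar u.
have mgh nm w : measurable_fun (cube side d) (gh nm w).
  have /andP[theta0 _] := theta01 nm.
  exact: (measurable_g_hat T side_gt0 kappa_kernel kappa_grad nm.1 nm.2 theta0 (pos nm w)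
    (fun j k => eps nm j k w) (jstar nm.2) i).
have F_hat_L2 nm w : in_L2 side (F_hat nm w) by have [] := F_hatP nm w.
have F_hatE : \forall nm \near Fl, forall w u, fourier side (F_hat nm w) u =
    if alpha nm <= normc (psi nm w u / (ell s u)%:C%C) ^+ 2
    then fourierR side (gh nm w) u * conjc (psi nm w u) / (normc (psi nm w u) ^+ 2)%:C%C else 0.
  (* The estimator is defined with [grid_time], and [psi] with [tstar]; the two times agree
     eventually. *)
  apply: filterS tgrid => nm tE w u; have [_ ->] := F_hatP nm w.
  rewrite /fourier_F_hat -tE; congr (if _ then _ else _).
  by apply/idP/idP; rewrite inE.
have psi_var : \forall nm \near Fl, forall u,
    measurable_fun setT (fun w => normc (psi nm w u - fourierR side (mu tstar) u) ^+ 2) /\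
    (\int[P]_w (normc (psi nm w u - fourierR side (mu tstar) u) ^+ 2)%:E <=
     (2 / (nm.1)%:R)%:E)%E.
  apply: filterS N_gt0 => nm N0 u.
  exact: (emp_fourier_variance side_gt0 (model nm) mu_push tT m_meas m0 N0 u).
have ell1 (u : 'rV[int]_d) : 1 <= ell s u by exact: ell_ge1.
exact: (deconvolution_consistent side_gt0 f_per f_sq gE m_meas m_bnd assumption4
  ell1 F_hat_L2 alpha_gt0 mgh F_hatE psi_var alpha_to0 N_gt0 rate).
Qed.
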